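(* Let $\mathcal{A}$ be a finite alphabet and let $H\subset\mathcal{A}^{\mathbb{Z}}$ be a one-dimensional nearest-neighbor subshift of finite type whose Rauzy graph does not satisfy condition D. Then there exists a one-dimensional subshift of finite type $V\subset\mathcal{A}^{\mathbb{Z}}$ such that the topological entropy $h(X_{H,V})$ is not a computable real number.
   Context: For one-dimensional subshifts of finite type (SFTs) $H,V\subset\mathcal{A}^{\mathbb{Z}}$, the combined subshift is $$X_{H,V} := \{ x \in \mathcal{A}^{\mathbb{Z}^2} \mid \forall i, j \in \mathbb{Z},\ (x_{k,j})_{k \in \mathbb{Z}} \in H \text{ and } (x_{i,\ell})_{\ell \in \mathbb{Z}} \in V \}.$$ The topological entropy of a (nonempty) two-dimensional subshift $X$ is $h(X)=\lim_{n\to\infty}\frac{\log_2 N_X(n,n)}{n^2}$, where $N_X(n,n)$ is the number of $n\times n$ patterns appearing in configurations of $X$. $H$ is nearest-neighbor if it is defined by a set of forbidden words of length $2$. Its Rauzy graph $\mathcal{G}(H)=(\mathcal{V},\vec{E})$ is the directed graph whose vertices are the letters appearing in configurations of $H$, with $(a,b)\in\vec{E}$ iff the word $ab$ appears in some configuration of $H$. The strongly connected components (SCCs) are the maximal sets of mutually reachable vertices; transient vertices (those with no nontrivial path to themselves) do not form SCCs. Condition D: the graph satisfies condition D if all its SCCs have a type in common among the following three (an SCC may have none, one or several types): - $S$ is of reflexive type if $(v,v)\in\vec{E}$ for all $v\in S$; - $S$ is of symmetric type if for all $v\neq w\in S$ with $(v,w)\in\vec{E}$ one has $(w,v)\in\vec{E}$;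 - $S$ is of state-split cycle type if there are $p\geq 1$ and a partition $S=\bigsqcup_{i=0}^{p-1}V_i$ such that for all $i$, all $v\in V_i$ and all $w\in S$: $(v,w)\in\vec{E}\Leftrightarrow w\in V_{i+1 \bmod p}$. *)

(* Defs.v *)
From HB Require Import structures.
From mathcomp Require Import all_boot all_order all_algebra.
From mathcomp Require Import all_classical all_reals all_analysis.

Set Implicit Arguments.
Unset Strict Implicit.
Unset Printing Implicit Defensive.

Import Order.TTheory GRing.Theory Num.Theory.
Import numFieldNormedType.Exports.

Local Open Scope classical_set_scope.
Local Open Scope ring_scope.

Section OneDimensional.
Variable A : finType.

Definition word_at (w : seq A) (x : int -> A) (i : int) : Prop :=
  mkseq (fun k => x (i + k%:Z)) (size w) = w.

Definition occurs (w : seq A) (x : int -> A) : Prop :=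
  exists i : int, word_at w x i.

Definition avoiding (F : seq (seq A)) : set (int -> A) :=
  [set x | forall w, w \in F -> ~ occurs w x].

Definition is_sft (X : set (int -> A)) : Prop :=
  exists F : seq (seq A), X = avoiding F.

Definition is_nearest_neighbor (X : set (int -> A)) : Prop :=
  exists2 F : seq (seq A), (forall w, w \in F -> size w = 2%N) & X = avoiding F.

End OneDimensional.

Record digraph (T : finType) := Digraph { vertex : set T; arc : rel T }.

Definition rauzy_graph (A : finType) (H : set (int -> A)) : digraph A :=
  {| vertex := [set a | exists2 x, H x & occurs [:: a] x];
     arc := fun a b => `[< exists2 x, H x & occurs [:: a; b] x >] |}.

Section ConditionD.
Variables (T : finType) (G : digraph T).

Definition reachable (v w : T) : Prop :=
  exists p : seq T, [/\ p != [::], path (arc G) v p & last v p = w].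

(* As [reachable] asks for a path with at least one arc, taking v = w below
   rules out transient vertices. *)
Definition mutually_reachable (S : set T) : Prop :=
  S `<=` vertex G /\ forall v w, S v -> S w -> reachable v w.

Definition is_scc (S : set T) : Prop :=
  [/\ S !=set0, mutually_reachable S &
      forall S', mutually_reachable S' -> S `<=` S' -> S' = S].

Definition reflexive_type (S : set T) : Prop := forall v, S v -> arc G v v.

Definition symmetric_type (S : set T) : Prop :=
  forall v w, S v -> S w -> v <> w -> arc G v w -> arc G w v.

(* [ordS i] is i + 1 mod p. *)
Definition state_split_cycle_type (S : set T) : Prop :=
  exists (p : nat) (V : 'I_p -> set T),
    [/\ (1 <= p)%N,
        forall i, V i !=set0,
        trivIset setT V,
        \bigcup_i V i = S &
        forall i v w, V i v -> S w -> (arc G v w <-> V (ordS i) w)].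

Definition condition_D : Prop :=
  [\/ forall S, is_scc S -> reflexive_type S,
      forall S, is_scc S -> symmetric_type S |
      forall S, is_scc S -> state_split_cycle_type S].

End ConditionD.

Definition combined_subshift (A : finType) (H V : set (int -> A)) :
    set (int * int -> A) :=
  [set x | forall i j : int, H (fun k => x (k, j)) /\ V (fun l => x (i, l))].

Section Entropy.
Variables (A : finType) (X : set (int * int -> A)).

Definition pattern_appears (m n : nat) (u : {ffun 'I_m * 'I_n -> A}) : Prop :=
  exists2 x, X x &
    exists i j : int, forall k l, u (k, l) = x (i + k%:Z, j + l%:Z).

Definition pattern_count (m n : nat) : nat :=
  #|[pred u : {ffun 'I_m * 'I_n -> A} | `[< pattern_appears u >]]|.

Definition entropy (R : realType) : R :=
  lim ((fun n : nat =>
    ln (pattern_count n n)%:R / ln 2 / n%:R ^+ 2 : R) @ \oo).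

End Entropy.

(* Codes of the mu-recursive partial functions of arity n. *)
Inductive rec_code : nat -> Type :=
| RZero n : rec_code n
| RSucc : rec_code 1
| RProj n (i : 'I_n) : rec_code n
| RComp m n (f : rec_code m) (g : 'I_m -> rec_code n) : rec_code n
| RPrec n (f : rec_code n) (g : rec_code n.+2) : rec_code n.+1
| RMin n (f : rec_code n.+1) : rec_code n.

(* [rec_graph c v y]: the partial function coded by c is defined at v, with
   value y.  The recursion variable of [RPrec] and the variable minimised by
   [RMin] come first; s lists the successive values of a primitive recursion. *)
Fixpoint rec_graph n (c : rec_code n) : n.-tuple nat -> nat -> Prop :=
  match c in rec_code n return n.-tuple nat -> nat -> Prop with
  | RZero _ => fun _ y => y = 0%N
  | RSucc => fun v y => y = (thead v).+1
  | RProj _ i => fun v y => y = tnth v i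
  | RComp m _ f g => fun v y =>
      exists2 w : m.-tuple nat,
        forall i, rec_graph (g i) v (tnth w i) & rec_graph f w y
  | RPrec _ f g => fun v y =>
      exists s : nat -> nat,
        [/\ rec_graph f [tuple of behead v] (s 0%N),
            forall k, (k < thead v)%N ->
              rec_graph g [tuple of k :: s k :: behead v] (s k.+1) &
            y = s (thead v)]
  | RMin _ f => fun v y =>
      rec_graph f [tuple of y :: v] 0%N /\
      forall k, (k < y)%N -> exists z, rec_graph f [tuple of k :: v] z.+1
  end.

Definition computable_function (f : nat -> nat) : Prop :=
  exists c : rec_code 1, forall n, rec_graph c [tuple n] (f n).

(* Some computable sequence of rationals converges to x with error at most
   2^-n at index n. *)
Definition computable_real (R : realType) (x : R) : Prop :=
  exists s a b : nat -> nat,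
    [/\ computable_function s, computable_function a, computable_function b,
        forall n, b n != 0%N &
        forall n, `| (-1) ^+ s n * (a n)%:R / (b n)%:R - x | <= 2 ^- n].

(* Main.v *)
(* The entropy of the tilings by suitable Wang tiles is not computable.  The tiles form a
   Robinson-like hierarchy whose levels play the role of time: a nondeterministic counter
   machine makes one step from each level to the next, and a register of value c is a mark
   on one column out of 2^c of the current level.  The crosses of level k have density
   4^-(k+1) and carry a free bit if the machine outputs 1 at time k, so the entropy is the
   maximum over the runs of the sum of 4^-(k+1) over the times of output 1, which is attained
   by the lexicographically largest output.  The machine guesses, program by program, whether
   it runs forever (output 1).  A wrong guess of this kind is eventually discovered and blocks
   the run, and a wrong guess that a program halts is not maximal; thus the largest output
   solves the halting problem, and it can be read off any approximation of the entropy.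

   To transfer the tilings to a graph that violates condition D, let V consist of the
   concatenations of blocks of height M n, each made of the n-th positions of M closed walks
   of length n in the graph.  The walks are such that two adjacent columns must be shifted by
   exactly M, so that each row follows one of the walks.  This needs walks f with no arc from
   f i to f (i + d), for all d <> 1: a component that is not reflexive handles d = 0, one that
   is not symmetric d = -1, and one that is not a state-split cycle the other d.  The same
   component has arcs x0 -> y0 and x1 -> y1 without an arc x0 -> y1, through which a bit can
   be sent to the next column; this lets V compare the tiles of adjacent columns. *)

Require Import Defs.
From HB Require Import structures.
From mathcomp Require Import all_boot all_order all_algebra.
From mathcomp Require Import all_classical all_reals all_analysis.
From mathcomp Require Import zify ring lra.

Set Implicit Arguments.
Unset Strict Implicit.
Unset Printing Implicit Defensive.

Import Order.TTheory GRing.Theory Num.Theory.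
Import numFieldNormedType.Exports.

(** * Counter programs *)

Section CounterPrograms.
Local Open Scope nat_scope.

(** A column of a level carries only a finite datum, so an unbounded register has to be spread over
    the level: value c becomes the spacing 2^c of marks. Passing to the next level merges columns in
    pairs and thus halves every spacing; keeping beforehand one mark out of 4, 2 or 1 makes the
    register grow, stay or shrink. The test for zero is local: adjacent columns are both marked only
    at spacing 1. With digits 0 and 1 in base 4, a tail weighs at most a third of the unit of the
    digit before it. Hence lexicographic and numerical order agree, and a digit is read off an
    approximation without any problem of carries. A run with a smaller output is not excluded, only
    outnumbered: all crosses of a level agree on the output, so the choice of the run costs nothing
    in entropy and the largest output wins. In an arbitrary tiling some rows and columns may lie on
    no level at all; cutting at level K leaves an uncontrolled part of density about 2^-K. One tile
    occupies L = M n letters of a column, so the entropy is divided by the integer L, which does not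
    affect computability. *)

Inductive com : Type :=
| Inc of nat
| Dec of nat
| Out of bool
| Stuck
| Seq of com & com
| Loop of nat & com
| Choice of com & com.

Definition store := nat -> nat.

Definition upd (s : store) (i v : nat) : store := fun j => if j == i then v else s j.

(** The deterministic part of the semantics: undefined at [Out], [Choice] and [Stuck], which [nstep]
    treats below. *)
Definition sstep (x : seq com * store) : option (seq com * store) :=
  match x with
  | (Inc i :: K, s) => Some (K, upd s i (s i).+1)
  | (Dec i :: K, s) => Some (K, upd s i (s i).-1)
  | (Seq a b :: K, s) => Some (a :: b :: K, s)
  | (Loop i c :: K, s) => Some (if s i == 0 then K else c :: Loop i c :: K, s)
  | _ => None
  end.

Definition steps x t y := iter t (obind sstep) (Some x) = Some y.

Lemma steps_trans x y z t u : steps x t y -> steps y u z -> steps x (t + u) z.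
Proof. by rewrite /steps addnC iterD => -> ->. Qed.

Lemma stepsS x y z t : sstep x = Some y -> steps y t z -> steps x t.+1 z.
Proof. by move=> xy yz; rewrite -add1n; apply: steps_trans yz. Qed.

(** Quantifying over the rest [K] of the stack makes executions compose: a command does not look at
    what lies below it. *)
Definition exec c s s' := forall K, exists t, steps (c :: K, s) t (K, s').

Lemma exec_inc i s : exec (Inc i) s (upd s i (s i).+1).
Proof. by move=> K; exists 1. Qed.

Lemma exec_dec i s : exec (Dec i) s (upd s i (s i).-1).
Proof. by move=> K; exists 1. Qed.

Lemma exec_seq a b s s' s'' : exec a s s' -> exec b s' s'' -> exec (Seq a b) s s''.
Proof.
move=> ea eb K; have [t et] := ea (b :: K); have [u eu] := eb K.
by exists (t + u).+1; apply: stepsS (steps_trans et eu).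
Qed.

Lemma exec_loop0 i c s : s i = 0 -> exec (Loop i c) s s.
Proof. by move=> si K; exists 1; rewrite /steps /= si. Qed.

Lemma exec_loopS i c s s' s'' :
  s i <> 0 -> exec c s s' -> exec (Loop i c) s' s'' -> exec (Loop i c) s s''.
Proof.
move=> /eqP/negPf si ec el K; have [t et] := ec (Loop i c :: K); have [u eu] := el K.
by exists (t + u).+1; apply: stepsS (steps_trans et eu); rewrite /= si.
Qed.

Lemma exec_eq c s s1 s2 : exec c s s1 -> s1 = s2 -> exec c s s2.
Proof. by move=> + <-. Qed.

Definition clr i := Loop i (Dec i).
Definition mv i o := Loop i (Seq (Dec i) (Inc o)).
Definition mv2 i o t := Loop i (Seq (Dec i) (Seq (Inc o) (Inc t))).
Definition copy i o t := Seq (mv2 i o t) (mv t i).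

Ltac updt := apply: funext => r; rewrite /upd;
  repeat (match goal with |- context [if ?a == ?b then _ else _] => case: (eqVneq a b) => ? end);
  subst; try lia.

Lemma exec_clr i s : exec (clr i) s (upd s i 0).
Proof.
move si: (s i) => n; elim: n s si => [|n IH] s si.
  by apply: exec_eq (exec_loop0 _ si) _; updt.
apply: exec_loopS (exec_dec _ _) _; first by rewrite si.
apply: exec_eq (IH _ _) _; first by rewrite /upd eqxx si.
by updt.
Qed.

Lemma exec_mv i o s : i != o -> exec (mv i o) s (upd (upd s o (s o + s i)) i 0).
Proof.
move=> io; move si: (s i) => n; elim: n s si => [|n IH] s si.
  by apply: exec_eq (exec_loop0 _ si) _; updt.
apply: exec_loopS; first by rewrite si.
  by apply: exec_seq; [apply: exec_dec|apply: exec_inc].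
apply: exec_eq (IH _ _) _; first by rewrite /upd eqxx (negPf io) si.
by updt; move/eqP: io; lia.
Qed.

Lemma exec_mv2 i o t s : i != o -> i != t -> o != t ->
  exec (mv2 i o t) s (upd (upd (upd s o (s o + s i)) t (s t + s i)) i 0).
Proof.
move=> io it ot; move si: (s i) => n; elim: n s si => [|n IH] s si.
  by apply: exec_eq (exec_loop0 _ si) _; updt.
apply: exec_loopS; first by rewrite si.
  by apply: exec_seq; [apply: exec_dec|apply: exec_seq; apply: exec_inc].
apply: exec_eq (IH _ _) _; first by rewrite /upd eqxx (negPf io) (negPf it) si.
by updt; move/eqP: io it ot; lia.
Qed.

Lemma exec_copy i o t s : i != o -> i != t -> o != t -> s t = 0 -> s o = 0 ->
  exec (copy i o t) s (upd s o (s i)).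
Proof.
move=> io it ot st so; apply: exec_seq; first exact: exec_mv2.
apply: exec_eq; first by apply: exec_mv; rewrite eq_sym.
by updt; move/eqP: io it ot; lia.
Qed.

Fixpoint clrs f m := if m is m'.+1 then Seq (clr (f + m')) (clrs f m') else clr f.

Lemma exec_clrs f m s s' : s' f = 0 -> (forall r, (r < f) || (f + m <= r) -> s r = s' r) ->
  (forall r, f <= r < f + m -> s' r = 0) -> exec (clrs f m) s s'.
Proof.
elim: m s => [|m IH] s s'f ss' s'0 /=.
  apply: exec_eq (exec_clr _ _) _; updt => //.
  by apply: ss'; lia.
apply: exec_seq (exec_clr _ _) _; apply: IH => // [r rP|r rP]; last by apply: s'0; lia.
rewrite /upd; case: eqP => [->|ne]; first by rewrite s'0 //; lia.
by apply: ss'; lia.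
Qed.

(** Inputs are in the registers [inp i], the result goes to [o], and the registers from [f] on are
    scratch, zero before and after. For [RComp], f, ..., f+m-1 hold the inner values; for [RPrec],
    f, f+1, f+2, f+3 hold the round, the current value, the number of rounds left and the next
    value; for [RMin], f is the candidate and f+1 its value. *)
Fixpoint compile n (c : rec_code n) : ('I_n -> nat) -> nat -> nat -> com :=
  match c in rec_code n return ('I_n -> nat) -> nat -> nat -> com with
  | RZero _ => fun inp o f => clr f
  | RSucc => fun inp o f => Seq (copy (inp ord0) o f) (Inc o)
  | RProj _ i => fun inp o f => copy (inp i) o f
  | RComp m _ h g => fun inp o f =>
      foldr (fun j acc => Seq (compile (g j) inp (f + j) (f + m)) acc)
        (Seq (compile h (fun j => f + j) o (f + m)) (clrs f m)) (enum 'I_m)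
  | RPrec n h g => fun inp o f =>
      Seq (compile h (fun i => inp (lift ord0 i)) f.+1 (f + 4))
     (Seq (copy (inp ord0) f.+2 f.+3)
     (Seq (Loop f.+2 (Seq (Dec f.+2)
          (Seq (compile g (fun i => if unlift ord0 i is Some j then
                    (if unlift ord0 j is Some k then inp (lift ord0 k) else f.+1) else f)
                  f.+3 (f + 4))
          (Seq (clr f.+1) (Seq (mv f.+3 f.+1) (Inc f))))))
     (Seq (mv f.+1 o) (clr f))))
  | RMin n h => fun inp o f =>
      let b := compile h (fun i => if unlift ord0 i is Some j then inp j else f) f.+1 f.+2 in
      Seq b (Seq (Loop f.+1 (Seq (clr f.+1) (Seq (Inc f) b))) (mv f o))
  end.

Lemma tnth_beheadE n (v : n.+1.-tuple nat) i :
  tnth [tuple of behead v] i = tnth v (lift ord0 i).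
Proof. by rewrite tnth_behead; congr (tnth v _); apply: val_inj; rewrite /= inordK // ltnS ltn_ord. Qed.

(** The final store is exactly [upd s o y]: inputs intact and scratch zero again, so that calls can
    follow one another in the induction. The target starts at 0 because moves add to it. *)
Lemma exec_compile n (c : rec_code n) : forall v y, rec_graph c v y ->
  forall inp o f s, (forall i, inp i < f) -> o < f -> (forall i, inp i != o) -> s o = 0 ->
  (forall j, f <= j -> s j = 0) -> (forall i, s (inp i) = tnth v i) ->
  exec (compile c inp o f) s (upd s o y).
Proof.
elim: c => {n} [n||n i|m n h IHh g IHg|n h IHh g IHg|n h IHh] v y /=.
- move=> -> inp o f s _ of_ _ so s0 _; apply: exec_eq (exec_clr _ _) _; updt => //.
  by rewrite s0.
- move=> -> inp o f s inpf of_ inpo so s0 sv.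
  have i0f := inpf ord0; have := inpo ord0 => i0o; have := sv ord0 => sv0.
  apply: exec_seq; first by apply: exec_copy => //; [lia|lia|exact: s0].
  apply: exec_eq (exec_inc _ _) _; updt.
  by rewrite sv0; congr S.
- move=> -> inp o f s inpf of_ inpo so s0 sv.
  have i0f := inpf i; have := inpo i => i0o.
  apply: exec_eq; first by apply: exec_copy => //; [lia|lia|exact: s0].
  by rewrite sv.
- move=> [w wg wh] inp o f s inpf of_ inpo so s0 sv.
  (* The store once the first k inner functions have been evaluated. *)
  pose st k : store := fun r => if (f <= r < f + k) then nth 0 w (r - f) else s r.
  have st0 : s = st 0.
    by apply: funext => r; rewrite /st; case: ifP => //; lia.
  suff main l k : l = drop k (enum 'I_m) -> k <= m ->
      exec (foldr (fun j acc => Seq (compile (g j) inp (f + j) (f + m)) acc)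
        (Seq (compile h (fun j => f + j) o (f + m)) (clrs f m)) l) (st k) (upd s o y).
    by rewrite {1}st0; apply: main; rewrite ?drop0.
  elim: l k => [|j l IH] k lE km.
    have {km lE} kE : k = m.
      have := congr1 size lE; rewrite size_drop size_enum_ord /=; lia.
    subst k; rewrite /=; apply: exec_seq.
      apply: (IHh _ _ wh) => //; first by move=> i; have := ltn_ord i; lia.
      - lia.
      - by move=> i; apply/eqP; lia.
      - by rewrite /st; case: ifP => //; lia.
      - by move=> r rP; rewrite /st; case: ifP => [|_]; [lia|apply: s0; lia].
      - move=> i; have := ltn_ord i; rewrite /st => im; rewrite ifT; last by lia.
        by rewrite (tnth_nth 0); congr nth; lia.
    apply: exec_clrs; first by rewrite /upd ifF ?s0 //; apply/eqP; lia.
    - move=> r rP; rewrite /upd; case: eqP => // _; rewrite /st ifF //; lia.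
    - by move=> r rP; rewrite /upd ifF ?s0 //; [lia|apply/eqP; lia].
  have kl : k < m.
    by have := congr1 size lE; rewrite size_drop size_enum_ord /=; lia.
  have := lE; rewrite (drop_nth j) ?size_enum_ord // => -[jE lE'].
  have {}jE : nat_of_ord j = k by rewrite {1}jE nth_enum_ord.
  rewrite /=; apply: exec_seq (IH k.+1 lE' kl).
  apply: exec_eq.
    apply: (IHg j _ _ (wg j)) => //.
    - by move=> i; have := inpf i; lia.
    - by rewrite jE; lia.
    - by move=> i; apply/eqP; have := inpf i; lia.
    - by rewrite /st jE ifF ?s0 //; lia.
    - by move=> r rP; rewrite /st ifF ?s0 //; lia.
    - by move=> i; rewrite /st ifF //; have := inpf i; lia.
  apply: funext => r; rewrite /upd /st jE.
  case: eqP => [->|ne]; last by congr (if _ then _ else _); lia.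
  rewrite ifT; last by lia.
  by rewrite (tnth_nth 0) jE; congr nth; lia.
- move=> [sq [sq0 sqS ->]] inp o f s inpf of_ inpo so s0 sv.
  have if0 := inpf ord0; have io0 := inpo ord0.
  set T := thead v in sqS *.
  have sT : s (inp ord0) = T by rewrite sv.
  have [e0 e1 e2 e3] : [/\ s f = 0, s f.+1 = 0, s f.+2 = 0 & s f.+3 = 0] by split; apply: s0; lia.
  (* Loop invariant: k rounds are done and T - k are left. *)
  pose L k := upd (upd (upd s f k) f.+1 (sq k)) f.+2 (T - k).
  apply: exec_seq.
    apply: (IHh _ _ sq0) => //; try by move=> *; apply: s0; lia.
    - by move=> i; have := inpf (lift ord0 i); lia.
    - lia.
    - by move=> i; apply/eqP; have := inpf (lift ord0 i); lia.
    - by move=> i; rewrite sv tnth_beheadE.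
  apply: exec_seq; first by apply: exec_copy; rewrite /upd ?ifF //; try lia; apply/eqP; lia.
  apply: (@exec_seq _ _ _ (L T)); last first.
    apply: exec_seq; first by apply: exec_mv; apply/eqP; lia.
    apply: exec_eq (exec_clr _ _) _; rewrite /L; updt.
  have -> : upd (upd s f.+1 (sq 0)) f.+2 (upd s f.+1 (sq 0) (inp ord0)) = L 0.
    by rewrite /L; updt.
  suff Lk d k : k + d = T -> exec (Loop f.+2
     (Seq (Dec f.+2)
        (Seq
           (compile g
              (fun i : 'I_n.+2 =>
               match unlift ord0 i with
               | Some j =>
                   match unlift ord0 j with
                   | Some k0 => inp (lift ord0 k0)
                   | None => f.+1
                   end
               | None => f
               end) f.+3 (f + 4)) (Seq (clr f.+1) (Seq (mv f.+3 f.+1) (Inc f)))))) (L k) (L T).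
    exact: (Lk T).
  elim: d k => [|d IH] k kT.
    have -> : k = T by lia.
    by apply: exec_loop0; rewrite /L /upd eqxx; lia.
  apply: exec_loopS (IH k.+1 _); [by rewrite /L /upd eqxx; lia| |lia].
  apply: exec_seq (exec_dec _ _) _.
  apply: exec_seq.
    have kT' : k < T by lia.
    apply: (IHg _ _ (sqS k kT')).
    - by move=> i; case: unliftP => [j|] _; [case: unliftP => [j'|] _|]; try lia; have := inpf (lift ord0 j'); lia.
    - lia.
    - by move=> i; case: unliftP => [j|] _; [case: unliftP => [j'|] _|]; apply/eqP; try lia; have := inpf (lift ord0 j'); lia.
    - by rewrite /L /upd !ifF //; apply/eqP; lia.
    - by move=> r rP; rewrite /L /upd !ifF ?s0 //; try lia; apply/eqP; lia.
    - move=> i; case: unliftP => [j|] ->; last first.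
        by rewrite (tnth_nth 0) /L /upd /=; repeat (case: eqP => ?; try lia).
      rewrite tnthS; case: unliftP => [j'|] ->; last first.
        by rewrite (tnth_nth 0) /L /upd /=; repeat (case: eqP => ?; try lia).
      rewrite tnthS tnth_beheadE -sv /L /upd; have := inpf (lift ord0 j').
      by repeat (case: eqP => ?; try lia).
  apply: exec_seq (exec_clr _ _) _.
  apply: exec_seq; first by apply: exec_mv; apply/eqP; lia.
  apply: exec_eq (exec_inc _ _) _; rewrite /L; updt.
- move=> [h0 hS] inp o f s inpf of_ inpo so s0 sv.
  have [e0 e1] : s f = 0 /\ s f.+1 = 0 by split; apply: s0; lia.
  have hk k z : rec_graph h [tuple of k :: v] z ->
      exec (compile h (fun i => if unlift ord0 i is Some j then inp j else f) f.+1 f.+2)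
        (upd s f k) (upd (upd s f k) f.+1 z).
    move=> hg; apply: (IHh _ _ hg).
    - by move=> i; case: unliftP => [j|] _; try lia; have := inpf j; lia.
    - lia.
    - by move=> i; case: unliftP => [j|] _; apply/eqP; try lia; have := inpf j; lia.
    - by rewrite /upd ifF //; apply/eqP; lia.
    - by move=> r rP; rewrite /upd ifF ?s0 //; try lia; apply/eqP; lia.
    - move=> i; case: unliftP => [j|] ->; last first.
        by rewrite (tnth_nth 0) /upd eqxx.
      by rewrite tnthS -sv /upd; have := inpf j; case: eqP => //; lia.
  set b := compile h _ _ _ in hk *.
  have su : s = upd s f 0 by updt.
  have next k : k < y -> exists z, rec_graph h [tuple of k.+1 :: v] z /\ (z == 0) = (k.+1 == y).
    move=> ky; case: (eqVneq k.+1 y) => [yE|ne]; first by exists 0; rewrite yE.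
    have ky' : k.+1 < y by lia.
    by have [z zg] := hS k.+1 ky'; exists z.+1.
  suff {su} Lk d k z : k + d = y -> rec_graph h [tuple of k :: v] z -> (z == 0) = (k == y) ->
      exec (Loop f.+1 (Seq (clr f.+1) (Seq (Inc f) b))) (upd (upd s f k) f.+1 z) (upd s f y).
    have [z [zg z0]] : exists z, rec_graph h [tuple of 0 :: v] z /\ (z == 0) = (0 == y).
      by case: (posnP y) h0 hS => [->|y0] h0 hS; [exists 0|have [z] := hS 0 y0; exists z.+1; split => //; lia].
    rewrite [X in exec _ X _]su; apply: exec_seq (hk 0 z zg) _.
    apply: exec_seq (Lk y 0 z _ zg _) _ => //.
    by apply: exec_eq (exec_mv _ _) _; [apply/eqP; lia|updt].
  elim: d k z => [|d IH] k z ky kz z0.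
    have ke : k = y by lia.
    move: z0; rewrite ke eqxx => /eqP ->.
    by apply: exec_eq (exec_loop0 _ _) _; rewrite /upd ?eqxx //; updt.
  have ky' : k < y by lia.
  have [z' [z'g z'0]] := next k ky'.
  apply: exec_loopS (IH k.+1 z' _ z'g z'0); [by rewrite /upd eqxx; lia| |lia].
  apply: exec_seq (exec_clr _ _) _; apply: exec_seq (exec_inc _ _) _.
  have -> : upd (upd (upd (upd s f k) f.+1 z) f.+1 0) f (upd (upd (upd s f k) f.+1 z) f.+1 0 f).+1 = upd s f k.+1 by updt.
  exact: hk.
Qed.
End CounterPrograms.

(** * Recursive functions *)

Section RecursiveFunctions.
Local Open Scope nat_scope.

(** [F] takes bare lists, of which only those of length n matter; functions are then plain
    expressions in [nth 0 v i], composed without tuple casts. *)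
Definition recf n (F : seq nat -> nat) :=
  exists c : rec_code n, forall v : n.-tuple nat, rec_graph c v (F v).

Lemma recf_ext n F F' : (forall v, size v = n -> F v = F' v) -> recf n F -> recf n F'.
Proof. by move=> FF' [c cF]; exists c => v; rewrite -FF' ?size_tuple. Qed.

Lemma recf_var n i : i < n -> recf n (fun v => nth 0 v i).
Proof. by move=> lt_in; exists (RProj (Ordinal lt_in)) => v /=; rewrite (tnth_nth 0). Qed.

Lemma recf_comp m n F (G : 'I_m -> seq nat -> nat) :
  recf m F -> (forall i, recf n (G i)) -> recf n (fun v => F [tuple G i v | i < m]).
Proof.
move=> [f fF] /choice [g gG]; exists (RComp f g) => v /=.
by exists [tuple G i v | i < m] => [i|]; [rewrite tnth_mktuple|exact: fF].
Qed.

Lemma nth_mkseq_tuple m (G : 'I_m -> nat) i (im : i < m) :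
  nth 0 [tuple G i | i < m] i = G (Ordinal im).
Proof. by rewrite -[i]/(nat_of_ord (Ordinal im)) nth_mktuple. Qed.

Lemma recf_app1 f n F : recf 1 (fun v => f (nth 0 v 0)) -> recf n F -> recf n (fun v => f (F v)).
Proof.
move=> rf rF; have := @recf_comp 1 n _ (fun _ => F) rf (fun _ => rF).
by apply: recf_ext => v _; rewrite (nth_mkseq_tuple (fun=> F v) (isT : 0 < 1)).
Qed.

Lemma recf_app2 f n F G : recf 2 (fun v => f (nth 0 v 0) (nth 0 v 1)) ->
  recf n F -> recf n G -> recf n (fun v => f (F v) (G v)).
Proof.
move=> rf rF rG.
have rFG (i : 'I_2) : recf n (if i == ord0 then F else G) by case: ifP.
apply: recf_ext (recf_comp rf rFG) => v _.
by rewrite (nth_mkseq_tuple _ (isT : 0 < 2)) (nth_mkseq_tuple _ (isT : 1 < 2)).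
Qed.

Lemma recf_S n F : recf n F -> recf n (fun v => (F v).+1).
Proof. by apply: (@recf_app1 S); exists RSucc => v /=; rewrite -[tval v]/(tval v) /thead (tnth_nth 0). Qed.

Lemma recf_const n k : recf n (fun=> k).
Proof. by elim: k => [|k /recf_S//]; exists (RZero n). Qed.

Lemma recf_prec n B St N : recf n B -> recf n.+2 St -> recf n N ->
  recf n (fun v => nat_rect (fun=> nat) (B v) (fun k acc => St [:: k, acc & v]) (N v)).
Proof.
move=> [b bB] [s sS] [c cN].
exists (RComp (RPrec b s) (fun i => if unlift ord0 i is Some j then RProj j else c)) => v /=.
exists [tuple of N v :: v] => [i|].
  by case: unliftP => [j|] -> /=; rewrite ?tnthS.
exists (fun t => nat_rect (fun=> nat) (B v) (fun k acc => St [:: k, acc & v]) t).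
by split => [|k _|].
Qed.

Lemma recf_min n F g : recf n.+1 F ->
  (forall v, size v = n -> F (g v :: v) = 0 /\ forall k, k < g v -> F (k :: v) <> 0) -> recf n g.
Proof.
move=> [f fF] gP; exists (RMin f) => v /=.
have [g0 gS] := gP v (size_tuple v).
split; first by rewrite -g0; exact: (fF [tuple of _ :: v]).
move=> k /gS; have := fF [tuple of k :: v] => /=.
by case: (F _) => // z; exists z.
Qed.

Lemma recf_add n F G : recf n F -> recf n G -> recf n (fun v => F v + G v).
Proof.
apply: (@recf_app2 addn).
apply: recf_ext (@recf_prec 2 (fun v => nth 0 v 0) (fun v => (nth 0 v 1).+1) (fun v => nth 0 v 1) _ _ _); do ?[apply: recf_S|apply: recf_var] => // v _.
by elim: (nth 0 v 1) => [|m /= ->]; rewrite ?addn0 ?addnS.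
Qed.

Lemma recf_mul n F G : recf n F -> recf n G -> recf n (fun v => F v * G v).
Proof.
apply: (@recf_app2 muln).
apply: recf_ext (@recf_prec 2 (fun v => 0) (fun v => nth 0 v 1 + nth 0 v 2) (fun v => nth 0 v 1) _ _ _); do ?[apply: recf_add|apply: recf_const|apply: recf_var] => // v _.
by elim: (nth 0 v 1) => [|m /= ->]; rewrite ?muln0 ?mulnS 1?addnC.
Qed.

Lemma recf_exp n F G : recf n F -> recf n G -> recf n (fun v => F v ^ G v).
Proof.
apply: (@recf_app2 expn).
apply: recf_ext (@recf_prec 2 (fun v => 1) (fun v => nth 0 v 1 * nth 0 v 2) (fun v => nth 0 v 1) _ _ _); do ?[apply: recf_mul|apply: recf_const|apply: recf_var] => // v _.
by elim: (nth 0 v 1) => [|m /= ->]; rewrite ?expnS 1?mulnC.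
Qed.

Lemma recf_pred n F : recf n F -> recf n (fun v => (F v).-1).
Proof.
apply: (@recf_app1 predn).
apply: recf_ext (@recf_prec 1 (fun v => 0) (fun v => nth 0 v 0) (fun v => nth 0 v 0) _ _ _); do ?[apply: recf_const|apply: recf_var] => // v _.
by case: (nth 0 v 0).
Qed.

Lemma recf_sub n F G : recf n F -> recf n G -> recf n (fun v => F v - G v).
Proof.
apply: (@recf_app2 subn).
apply: recf_ext (@recf_prec 2 (fun v => nth 0 v 0) (fun v => (nth 0 v 1).-1) (fun v => nth 0 v 1) _ _ _); do ?[apply: recf_pred|apply: recf_var] => // v _.
by elim: (nth 0 v 1) => [|m /= ->]; rewrite ?subn0 ?subnS.
Qed.

Lemma recf_leq n F G : recf n F -> recf n G -> recf n (fun v => nat_of_bool (F v <= G v)).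
Proof.
move=> rF rG; have := recf_sub (recf_const n 1) (recf_sub rF rG).
by apply: recf_ext => v _; lia.
Qed.

Lemma recf_eq n F G : recf n F -> recf n G -> recf n (fun v => nat_of_bool (F v == G v)).
Proof.
move=> rF rG; have := recf_sub (recf_const n 1) (recf_add (recf_sub rF rG) (recf_sub rG rF)).
by apply: recf_ext => v _; lia.
Qed.

Lemma recf_sum n N F : recf n N -> recf n.+1 F ->
  recf n (fun v => \sum_(k < N v) F (nat_of_ord k :: v)).
Proof.
move=> rN rF.
pose G (i : 'I_n.+1) (v : seq nat) := if i == 0 :> nat then nth 0 v 0 else nth 0 v i.+1.
have rG : recf n.+2 (fun v => nth 0 v 1 + F [tuple G i v | i < n.+1]).
  apply: recf_add; [exact: recf_var|apply: (@recf_comp n.+1 n.+2 F G) => // i].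
  by rewrite /G; case: eqP => _; apply: recf_var; have := ltn_ord i; lia.
have := recf_prec (recf_const n 0) rG rN; apply: recf_ext => v sv.
elim: (N v) => [|m /= ->]; first by rewrite big_ord0.
rewrite big_ord_recr /=; congr (_ + F _).
apply: (@eq_from_nth _ 0) => [|i]; rewrite size_tuple ?card_ord /= ?sv // => im.
rewrite (nth_mkseq_tuple _ im) /G /=.
by case: i im.
Qed.

(** The quotient of a by d is the number of i < a with (i + 1) d <= a; the factor testing 1 <= d
    accounts for division by zero, of value 0. *)
Lemma recf_div n F G : recf n F -> recf n G -> recf n (fun v => F v %/ G v).
Proof.
apply: (@recf_app2 divn).
apply: recf_ext (@recf_sum 2 (fun v => nth 0 v 0)
  (fun v => nat_of_bool ((nth 0 v 0).+1 * nth 0 v 2 <= nth 0 v 1) * nat_of_bool (1 <= nth 0 v 2)) _ _); do ?[apply: recf_mul|apply: recf_leq|apply: recf_S|apply: recf_const|apply: recf_var] => // v _ /=.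
move: (nth 0 v 0) (nth 0 v 1) => a [|d]; first by rewrite divn0 big1 // => i _; rewrite muln0.
rewrite (eq_bigr (fun i : 'I_a => nat_of_bool (i < a %/ d.+1))); last first.
  by move=> i _; rewrite muln1 leq_divRL.
rewrite -(big_mkord xpredT (fun i => nat_of_bool (i < a %/ d.+1))).
rewrite (big_cat_nat (n := a %/ d.+1)) //=; last exact: leq_div.
rewrite [X in _ + X]big_nat_cond [X in _ + X]big1 ?addn0; last by move=> i /andP[/andP[h _] _]; rewrite ltnNge h.
rewrite big_nat_cond (eq_bigr (fun=> 1)); last by move=> i /andP[/andP[_ h] _]; rewrite h.
by rewrite -big_nat_cond sum_nat_const_nat muln1 subn0.
Qed.

Lemma recf_mod n F G : recf n F -> recf n G -> recf n (fun v => F v %% G v).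
Proof.
move=> rF rG; have := recf_sub rF (recf_mul (recf_div rF rG) rG).
by apply: recf_ext => v _; rewrite {1}(divn_eq (F v) (G v)) addKn.
Qed.

Lemma recf_computable f : recf 1 (fun v => f (nth 0 v 0)) <-> computable_function f.
Proof.
split=> [] [c cf]; exists c; first by move=> n; exact: (cf [tuple n]).
by move=> v; case/tupleP: v => n v; rewrite [v]tuple0; exact: cf.
Qed.

Lemma computable_app f n F : computable_function f -> recf n F -> recf n (fun v => f (F v)).
Proof. by move=> /recf_computable rf; apply: recf_app1. Qed.

End RecursiveFunctions.

(** * Programs as Collatz-like functions *)

Section Stacks.
Local Open Scope nat_scope.

Definition hreg (K : seq com) :=
  match K with Inc i :: _ | Dec i :: _ | Loop i _ :: _ => i.+1 | _ => 0 end.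

Definition eff (K : seq com) (s : store) : store :=
  match K with
  | Inc i :: _ => upd s i (s i).+1
  | Dec i :: _ => upd s i (s i).-1
  | _ => s
  end.

(** Control depends on the store only through the zero tests [z]. Neither the empty stack nor
    [Stuck] has a successor, so an infinite run meets neither of them. *)
Definition nstep (z : nat -> bool) (K K' : seq com) : Prop :=
  match K with
  | [::] | Stuck :: _ => False
  | Inc _ :: L | Dec _ :: L | Out _ :: L => K' = L
  | Seq a b :: L => K' = a :: b :: L
  | Loop i c :: L => K' = if z i then L else c :: Loop i c :: L
  | Choice a b :: L => K' = a :: L \/ K' = b :: L
  end.

Definition hout (K : seq com) := if K is Out b :: _ then b else false.

Lemma nstep_sstep K s K' s' : sstep (K, s) = Some (K', s') ->
  [/\ hout K = false, s' = eff K s & forall L, nstep (fun i => s i == 0) K L <-> L = K'].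
Proof. by case: K => [|[i|i|b||a b|i a|a b] K] //= [<- <-]; split. Qed.

(** The stacks that can arise while c runs on top of K. They are finitely many because the body of a
    loop runs on top of the loop itself; this turns the control stack into a finite state. *)
Fixpoint conts c K : seq (seq com) :=
  (c :: K) :: match c with
  | Seq a b => conts a (b :: K) ++ conts b K
  | Loop i a => conts a (Loop i a :: K)
  | Choice a b => conts a K ++ conts b K
  | _ => [::]
  end.

Lemma conts_head c K : List.In (c :: K) (conts c K).
Proof. by case: c => *; left. Qed.

Lemma conts_closed c K z L L' : List.In L (conts c K) -> nstep z L L' ->
  L' = K \/ List.In L' (conts c K).
Proof.
elim: c K => [i|i|b||a IHa b IHb|i a IHa|a IHa b IHb] K /=.
- by case=> // <- /= ->; left.
- by case=> // <- /= ->; left.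
- by case=> // <- /= ->; left.
- by case=> // <-.
- case=> [<- /= ->|/List.in_app_iff[/IHa{}IHa|/IHb{}IHb] h].
  + by right; right; apply/List.in_app_iff; left; apply: conts_head.
  + have [->|?] := IHa h; right; right; apply/List.in_app_iff; last by left.
    by right; apply: conts_head.
  + have [->|?] := IHb h; first by left.
    by right; right; apply/List.in_app_iff; right.
- case=> [<- /= ->|/IHa{}IHa h].
    by case: (z i); [left|right; right; apply: conts_head].
  by have [->|?] := IHa h; right; [left|right].
- case=> [<- /= [] ->|/List.in_app_iff[/IHa{}IHa|/IHb{}IHb] h].
  + by right; right; apply/List.in_app_iff; left; apply: conts_head.
  + by right; right; apply/List.in_app_iff; right; apply: conts_head.
  + have [->|?] := IHa h; [by left|right; right; apply/List.in_app_iff; by left].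
  + have [->|?] := IHb h; [by left|right; right; apply/List.in_app_iff; by right].
Qed.

Definition stacks c := rcons (conts c [::]) [::].

Lemma In_nth (T : Type) (x0 x : T) l : List.In x l -> exists2 i, i < size l & nth x0 l i = x.
Proof.
elim: l => [|y l IH] //= [->|/IH[i il <-]]; first by exists 0.
by exists i.+1.
Qed.

Lemma nth_In (T : Type) (x0 : T) l i : i < size l -> List.In (nth x0 l i) l.
Proof. by elim: l i => [|y l IH] [|i] //= il; [left|right; apply: IH]. Qed.

Lemma In_rcons (T : Type) (x y : T) l : List.In x (rcons l y) <-> x = y \/ List.In x l.
Proof. by elim: l => [|z l IH] /=; [split => [[]|[]] //; by left|rewrite IH; tauto]. Qed.

Lemma stacks_closed c z L L' : List.In L (stacks c) -> nstep z L L' -> List.In L' (stacks c).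
Proof.
move=> /In_rcons[->//|h] /(conts_closed h) h'.
by apply/In_rcons.
Qed.

Lemma stacks_start c : nth [::] (stacks c) 0 = [:: c].
Proof. by case: c. Qed.

Lemma size_stacks c : 0 < size (stacks c).
Proof. by rewrite size_rcons. Qed.

Definition nregs c := foldr maxn 1 (map hreg (stacks c)).

Lemma hreg_lt c K : List.In K (stacks c) -> hreg K <= nregs c.
Proof.
rewrite /nregs; elim: (stacks c) => [|L l IH] //= [->|/IH]; first exact: leq_maxl.
by move=> h; apply: leq_trans h (leq_maxr _ _).
Qed.

Lemma nregs_gt0 c : 0 < nregs c.
Proof. by rewrite /nregs; elim: (stacks c) => //= L l IH; rewrite leq_max IH orbT. Qed.

End Stacks.

Section Collatz.
Local Open Scope nat_scope.

Definition digit Q N i := (N %/ Q ^ i) %% Q.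

(** A Collatz-like map: n goes to A (n / P) + B, where A and B depend on n mod P. The modulus and
    all coefficients are digits of N in base Q, so two numbers describe a program, and running it is
    a plain arithmetic iteration. *)
Definition cstep Q N n :=
  let P := digit Q N 1 in
  digit Q N (2 + 2 * (n %% P)) * (n %/ P) + digit Q N (3 + 2 * (n %% P)).

Definition citer Q N e t := iter t (cstep Q N) (digit Q N 0 * 2 ^ e).

Lemma digitsP (f : nat -> nat) m : exists Q N, forall i, i < m -> digit Q N i = f i.
Proof.
have [M fM] : exists M, forall i, i < m -> f i < M.
  exists (\max_(i < m) f i).+1 => i im.
  by rewrite ltnS (@leq_bigmax _ (fun i : 'I_m => f i) (Ordinal im)).
exists M; elim: m f fM => [|m IH] f fM; first by exists 0.
have M0 : 0 < M by apply: leq_ltn_trans (fM 0 isT).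
have [|N NP] := IH (fun i => f i.+1); first by move=> i im; apply: fM.
exists (f 0 + N * M) => -[_|i im]; rewrite /digit.
  by rewrite divn1 addnC modnMDl modn_small ?fM.
rewrite expnS divnMA [f 0 + _]addnC divnMDl // (divn_small (fM 0 _)) // addn0.
exact: NP.
Qed.

(** Any injective sequence of primes can code the registers; starting at 2 makes the input e, held
    in register 0, appear as 2^e. *)
Fixpoint nprime j := if j is j'.+1 then pdiv (nprime j')`!.+1 else 2.

Lemma nprime_prime j : prime (nprime j).
Proof. by case: j => //= j; rewrite pdiv_prime // ltnS fact_gt0. Qed.

Lemma nprime_lt j : nprime j < nprime j.+1.
Proof.
rewrite /= ltnNge; apply/negP => h; set p := pdiv _ in h.
have pp : prime p by rewrite pdiv_prime // ltnS fact_gt0.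
have d1 : p %| (nprime j)`!.+1 by apply: pdiv_dvd.
have d2 : p %| (nprime j)`! by apply: dvdn_fact; rewrite prime_gt0 ?h.
by move: d1; rewrite -addn1 dvdn_addr // Euclid_dvd1.
Qed.

Lemma nprime_inj : injective nprime.
Proof.
have lt : {homo nprime : i j / i < j} by apply: homo_ltn nprime_lt; apply: ltn_trans.
by move=> i j e; case: (ltngtP i j) => // /lt; rewrite e ltnn.
Qed.

Section Encoding.
Variable c : com.
Let l := stacks c.
Let sz := size l.
Let r := nregs c.

Definition rad := \prod_(j < r) nprime j.
Definition val_store (s : store) := \prod_(j < r) nprime j ^ s j.
Definition enc i s := i + sz * val_store s.

Lemma val_store_gt0 s : 0 < val_store s.
Proof. by rewrite prodn_gt0 // => j; rewrite expn_gt0 prime_gt0 ?nprime_prime. Qed.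

Lemma val_store_upd s i v : i < r -> val_store (upd s i v) * nprime i ^ s i = val_store s * nprime i ^ v.
Proof.
move=> ir; rewrite /val_store [X in X * _ = _](bigD1 (Ordinal ir)) //= [X in _ = X * _](bigD1 (Ordinal ir)) //= /upd eqxx.
rewrite [in LHS](eq_bigr (fun j : 'I_r => nprime j ^ s j)) => [|j /eqP ji].
  by lia.
by rewrite ifF //; apply/eqP => e; apply: ji; apply: val_inj.
Qed.

Lemma dvdn_val_store s i : i < r -> (nprime i %| val_store s) = (s i != 0).
Proof.
move=> ir; rewrite /val_store Euclid_dvd_prod ?nprime_prime //.
apply/idP/idP.
  rewrite big_has => /hasP[j _]; rewrite Euclid_dvdX ?nprime_prime // => /andP[].
  by rewrite dvdn_prime2 ?nprime_prime // => /eqP/nprime_inj <-; rewrite lt0n.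
move=> si; rewrite big_has; apply/hasP; exists (Ordinal ir); rewrite ?mem_index_enum //.
by rewrite Euclid_dvdX ?nprime_prime // dvdnn /= lt0n.
Qed.

Lemma nprime_rad i : i < r -> nprime i %| rad.
Proof. by move=> ir; rewrite /rad (bigD1 (Ordinal ir)) //= dvdn_mulr. Qed.

Lemma rad_gt0 : 0 < rad.
Proof. by rewrite prodn_gt0 // => j; rewrite prime_gt0 ?nprime_prime. Qed.

Definition idx K := find (fun L => `[< L = K >]) l.

Lemma idxP K : List.In K l -> idx K < sz /\ nth [::] l (idx K) = K.
Proof.
move=> Kl; have hK : has (fun L => `[< L = K >]) l.
  have [i il iK] := In_nth [::] Kl; apply/(has_nthP [::]); exists i => //.
  exact/asboolP.
by split; [rewrite -has_find|have := nth_find [::] hK => /asboolP].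
Qed.

Definition next_stack (K : seq com) (z : bool) :=
  match K with
  | Inc _ :: L | Dec _ :: L => L
  | Seq a b :: L => [:: a, b & L]
  | Loop i a :: L => if z then L else a :: Loop i a :: L
  | K => K
  end.

(* One step of the program on the code [i + sz * V] of a configuration: the
   control stack is read off modulo [sz], and a register i is zero iff
   [nprime i] does not divide [V].  A stack that is about to output is sent
   to 0, a number that codes no configuration. *)
Definition nfun n :=
  let K := nth [::] l (n %% sz) in
  let V := n %/ sz in
  match K with
  | Out _ :: _ => 0
  | Inc i :: _ => idx (next_stack K true) + sz * (V * nprime i)
  | Dec i :: _ => idx (next_stack K true) + sz * (if nprime i %| V then V %/ nprime i else V)
  | Loop i _ :: _ => idx (next_stack K (~~ (nprime i %| V))) + sz * V
  | K => idx (next_stack K true) + sz * V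
  end.

Lemma sz_gt0 : 0 < sz. Proof. exact: size_stacks. Qed.

(** The residue modulo [sz * rad] fixes the control stack and tells which of the primes divide the
    part that codes the store, hence fixes the instruction and its branch; every branch is
    affine. *)
Lemma nfun_affine nu : nu < sz * rad ->
  exists AB : nat * nat, forall v, nfun (nu + sz * rad * v) = AB.1 * v + AB.2.
Proof.
move=> nuP; set i := nu %% sz; set rho := nu %/ sz.
have nE v : (nu + sz * rad * v) %% sz = i by rewrite -mulnA mulnC addnC modnMDl.
have VE v : (nu + sz * rad * v) %/ sz = rho + rad * v.
  by rewrite -mulnA mulnC addnC divnMDl ?sz_gt0 // addnC.
have Kin : List.In (nth [::] l i) l by apply: nth_In; rewrite ltn_mod sz_gt0.
have := hreg_lt Kin; rewrite /nfun.
case KE : (nth [::] l i) => [|[x|x|b||a b|x a|a b] K] /= xr.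
- exists (sz * rad, idx [::] + sz * rho) => v; rewrite nE VE KE /=; lia.
- exists (sz * rad * nprime x, idx K + sz * rho * nprime x) => v; rewrite nE VE KE /=; lia.
- have [q qE] := dvdnP (nprime_rad xr); have p0 := prime_gt0 (nprime_prime x).
  have dE v : (nprime x %| rho + rad * v) = (nprime x %| rho).
    by rewrite dvdn_addl // qE dvdn_mulr // dvdn_mull.
  case xrho : (nprime x %| rho).
    exists (sz * q, idx K + sz * (rho %/ nprime x)) => v; rewrite nE VE KE /= dE xrho.
    have -> : rho + rad * v = (q * v) * nprime x + rho by rewrite qE; lia.
    by rewrite divnMDl //; lia.
  by exists (sz * rad, idx K + sz * rho) => v; rewrite nE VE KE /= dE xrho; lia.
- by exists (0, 0) => v; rewrite nE KE.
- by exists (sz * rad, idx (Stuck :: K) + sz * rho) => v; rewrite nE VE KE /=; lia.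
- by exists (sz * rad, idx [:: a, b & K] + sz * rho) => v; rewrite nE VE KE /=; lia.
- have [q qE] := dvdnP (nprime_rad xr).
  have dE v : (nprime x %| rho + rad * v) = (nprime x %| rho).
    by rewrite dvdn_addl // qE dvdn_mulr // dvdn_mull.
  exists (sz * rad, idx (next_stack (Loop x a :: K) (~~ (nprime x %| rho))) + sz * rho) => v.
  by rewrite nE VE KE /= dE; lia.
- by exists (sz * rad, idx (Choice a b :: K) + sz * rho) => v; rewrite nE VE KE /=; lia.
Qed.

Lemma nfun_code : exists Q N, digit Q N 0 = sz /\ forall n, cstep Q N n = nfun n.
Proof.
have P0 : 0 < sz * rad by rewrite muln_gt0 sz_gt0 rad_gt0.
have /choice[AB ABP] : forall nu, exists AB : nat * nat, nu < sz * rad ->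
    forall v, nfun (nu + sz * rad * v) = AB.1 * v + AB.2.
  move=> nu; case: (ltnP nu (sz * rad)) => [/nfun_affine[AB h]|]; first by exists AB.
  by exists (0, 0).
(* Order of the digits: the factor of the initial value, the modulus, then the slope and the offset
   for each residue in turn. *)
pose f i := match i with
  | 0 => sz | 1 => sz * rad
  | i.+2 => if odd i then (AB i./2).2 else (AB i./2).1 end.
have fA k : f (2 + 2 * k) = (AB k).1 by rewrite -[2 + _]/((2 * k).+2) /f mul2n odd_double doubleK.
have fB k : f (3 + 2 * k) = (AB k).2.
  by rewrite -[3 + _]/((2 * k).+1.+2) /f mul2n [odd _]/= odd_double /= uphalf_double.
have f0 : f 0 = sz by [].
have f1 : f 1 = sz * rad by [].
clearbody f; move: (sz * rad) P0 ABP f1 => P P0 ABP f1.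
have [Q [N QN]] := digitsP f (2 + 2 * P).
exists Q, N; split; first by rewrite QN.
move=> n; rewrite /cstep (QN 1) ?f1; last by lia.
have nP : n %% P < P by rewrite ltn_mod.
rewrite !QN ?fA ?fB; [|lia|lia].
by rewrite -(ABP _ nP) addnC mulnC -divn_eq.
Qed.

Definition loads e : store := fun j => if j == 0 then e else 0.

Lemma nfun_sstep K s K' s' : List.In K l -> sstep (K, s) = Some (K', s') ->
  nfun (enc (idx K) s) = enc (idx K') s'.
Proof.
move=> Kl; have [iK nK] := idxP Kl.
have V0 := val_store_gt0 s.
have -> : nfun (enc (idx K) s) = nfun (idx K + sz * val_store s) by [].
have eq1 : (idx K + sz * val_store s) %% sz = idx K.
  by rewrite addnC mulnC modnMDl modn_small.
have eq2 : (idx K + sz * val_store s) %/ sz = val_store s.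
  by rewrite addnC mulnC divnMDl ?sz_gt0 // divn_small // addn0.
have := hreg_lt Kl; rewrite /nfun eq1 eq2 nK.
case: K Kl {iK nK eq1 eq2} => [|[x|x|b||a b|x a|a b] K] //= Kl xr [<- <-] //.
- have := val_store_upd s (s x).+1 xr; rewrite expnS mulnA => /eqP.
  rewrite eqn_pmul2r ?expn_gt0 ?prime_gt0 ?nprime_prime // => /eqP h.
  by rewrite /enc h.
- rewrite dvdn_val_store // /enc; case: eqP => [s0|/eqP s0] /=.
    by rewrite s0 /=; congr (_ + _ * val_store _); apply: funext => j; rewrite /upd; case: eqP => // ->.
  have pE : nprime x ^ s x = nprime x * nprime x ^ (s x).-1 by rewrite -expnS prednK ?lt0n.
  have := val_store_upd s (s x).-1 xr; rewrite pE mulnA => /eqP.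
  rewrite eqn_pmul2r ?expn_gt0 ?prime_gt0 ?nprime_prime // => /eqP <-.
  by rewrite mulnK ?prime_gt0 ?nprime_prime.
- by rewrite dvdn_val_store // negbK.
Qed.

Lemma sstep_stacks K s K' s' : List.In K l -> sstep (K, s) = Some (K', s') -> List.In K' l.
Proof.
move=> Kl /nstep_sstep[_ _ h]; apply: (stacks_closed Kl).
by apply/(h K').
Qed.

Lemma nfun_steps K s t K' s' : List.In K l -> steps (K, s) t (K', s') ->
  List.In K' l /\ iter t nfun (enc (idx K) s) = enc (idx K') s'.
Proof.
move=> Kl; rewrite /steps; elim: t K' s' => [|t IH] K' s' /=; first by case=> <- <-.
case E : (iter _ _ _) => [[K1 s1]|] //= h.
have [K1l ->] := IH _ _ E.
by split; [apply: sstep_stacks h|apply: nfun_sstep].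
Qed.

Lemma idx_start : idx [:: c] = 0.
Proof.
rewrite /idx; case E : l => [|L l'] //=.
have := stacks_start c; rewrite -/l E /= => ->.
by rewrite asboolT.
Qed.

Lemma val_loads e : val_store (loads e) = 2 ^ e.
Proof.
rewrite /val_store (bigD1 (Ordinal (nregs_gt0 c))) //= big1 ?muln1 //.
by move=> j /eqP ji; rewrite /loads ifF ?expn0 //; apply/eqP => j0; apply: ji; apply: val_inj.
Qed.

Lemma start_in : List.In [:: c] l.
Proof. by rewrite /l -(stacks_start c); apply: nth_In; apply: size_stacks. Qed.

(** The two ways to end stay apart: an output sends the code to 0, while the empty stack gives a
    nonzero fixed point. *)
Lemma collatz_code : exists Q N, forall e,
  (forall t K s, steps ([:: c], loads e) t (Out true :: K, s) -> exists u, citer Q N e u = 0) /\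
  (forall t s, steps ([:: c], loads e) t ([::], s) -> forall u, citer Q N e u <> 0).
Proof.
have [Q [N [Q0 QN]]] := nfun_code; exists Q, N => e.
have st0 : digit Q N 0 * 2 ^ e = enc (idx [:: c]) (loads e).
  by rewrite /enc idx_start val_loads Q0.
have itE u : citer Q N e u = iter u nfun (enc (idx [:: c]) (loads e)).
  by rewrite /citer st0; apply: eq_iter.
have enc0 K s : enc K s <> 0.
  by have := muln_gt0 sz (val_store s); rewrite sz_gt0 val_store_gt0 /enc; lia.
split=> t => [K|] s st.
  have [Kl iE] := nfun_steps start_in st; exists t.+1.
  rewrite itE /= iE /nfun /enc addnC mulnC modnMDl.
  by have [iK nK] := idxP Kl; rewrite modn_small // nK.
move=> u; rewrite itE; have [Kl iE] := nfun_steps start_in st.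
have [ut|ut] := leqP u t.
  move: st; rewrite -(subnK ut) /steps iterD.
  have iN k : iter k (obind sstep) None = None by elim: k => //= k ->.
  case E : (iter u _ _) => [[K1 s1]|]; last by rewrite iN.
  by move=> _; have [_ ->] := nfun_steps start_in E.
rewrite -(subnK (ltnW ut)) iterD iE.
suff fixp : nfun (enc (idx [::]) s) = enc (idx [::]) s.
  have -> k : iter k nfun (enc (idx [::]) s) = enc (idx [::]) s by elim: k => //= k ->.
  exact: enc0.
have [iK nK] := idxP Kl; rewrite /nfun /enc addnC mulnC modnMDl modn_small // nK.
by rewrite divnMDl ?sz_gt0 // divn_small // addn0 mulnC addnC.
Qed.

End Encoding.
End Collatz.

(** * An undecidable halting problem *)

Section Halting.
Local Open Scope nat_scope.

(** Injective since Q is less than the gap to the next square; being a polynomial, it is easily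
    computed inside [bad]. *)
Definition pairN Q N := (Q + N) ^ 2 + Q.

Lemma pairN_inj Q N Q' N' : pairN Q N = pairN Q' N' -> Q = Q' /\ N = N'.
Proof.
rewrite /pairN => e.
have sE : Q + N = Q' + N'.
  by case: (ltngtP (Q + N) (Q' + N')) => // h; nia.
by rewrite sE in e; lia.
Qed.

Definition halting k := exists Q N t, k = pairN Q N /\ citer Q N k t = 0.

(** Diagonal argument: P computes h, outputs if the value is 1 and ends otherwise. On its own code
    e, the value 1 makes e halt and the value 0 keeps the iteration away from 0, each against
    [hP]. *)
Lemma halting_undecidable (h : nat -> bool) :
  computable_function (fun k => nat_of_bool (h k)) -> (forall k, h k <-> ~ halting k) -> False.
Proof.
move=> [c cP] hP.
pose P := Seq (compile c (fun=> 0) 1 2) (Loop 1 (Out true)).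
have [Q [N QN]] := collatz_code P.
pose e := pairN Q N; have [yes no] := QN e.
have ex : exec (compile c (fun=> 0) 1 2) (loads e) (upd (loads e) 1 (h e)).
  apply: (exec_compile (cP e)) => // [j|i]; first by case: j => [|[]].
  by rewrite ord1.
have [t st] := ex [:: Loop 1 (Out true)].
case he : (h e) st => st.
  have last1 : steps ([:: Loop 1 (Out true)], upd (loads e) 1 1) 1
    ([:: Out true; Loop 1 (Out true)], upd (loads e) 1 1) by [].
  have [|u eu] := yes (t + 1).+1 [:: Loop 1 (Out true)] (upd (loads e) 1 1).
    by apply: stepsS (steps_trans st last1).
  by have /hP := he; apply; exists Q, N, u.
have last0 : steps ([:: Loop 1 (Out true)], upd (loads e) 1 0) 1 ([::], upd (loads e) 1 0) by [].
have st0 : steps ([:: P], loads e) (t + 1).+1 ([::], upd (loads e) 1 0).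
  by apply: stepsS (steps_trans st last0).
suff : h e by rewrite he.
apply/hP => -[Q' [N' [u [/pairN_inj[<- <-] eu]]]].
exact: no st0 u eu.
Qed.

(** n is read as a history: in binary, a 1 followed by the guesses for the programs 0, 1, ... The
    first factor says that guess k is the binary digit i. A term is 1 if that guess says that
    program k runs forever although it reaches 0 at time t. All searches are bounded by n itself,
    which makes the sum recursive. *)
Definition bad n :=
  \sum_(i < n) \sum_(k < n) \sum_(Q < n) \sum_(N < n) \sum_(t < n)
    (n %/ 2 ^ (k + i).+1 == 1) * ((n %/ 2 ^ i) %% 2 == 1) * (k == pairN Q N :> nat)
    * (citer Q N k t == 0).

Ltac recf_tac := repeat first
  [ apply: recf_add | apply: recf_mul | apply: recf_exp | apply: recf_div
  | apply: recf_mod | apply: recf_eq | apply: recf_S | apply: recf_var; by []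
  | apply: recf_const ].

Lemma recf_digit n Q N i : recf n Q -> recf n N -> recf n i ->
  recf n (fun v => digit (Q v) (N v) (i v)).
Proof. by move=> *; rewrite /digit; recf_tac. Qed.

Lemma recf_cstep n Q N x : recf n Q -> recf n N -> recf n x ->
  recf n (fun v => cstep (Q v) (N v) (x v)).
Proof.
move=> rQ rN rx; rewrite /cstep; have rP := recf_digit rQ rN (recf_const n 1).
have rm := recf_mod rx rP; have rd := recf_div rx rP.
apply: recf_add; first apply: recf_mul => //.
  by apply: recf_digit => //; recf_tac.
by apply: recf_digit => //; recf_tac.
Qed.

Lemma bad_computable : computable_function bad.
Proof.
apply/recf_computable; rewrite /bad.
pose F (v : seq nat) := (nth 0 v 5 %/ 2 ^ (nth 0 v 3 + nth 0 v 4).+1 == 1)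
   * ((nth 0 v 5 %/ 2 ^ nth 0 v 4) %% 2 == 1) * (nth 0 v 3 == (nth 0 v 2 + nth 0 v 1) ^ 2 + nth 0 v 2)
   * (citer (nth 0 v 2) (nth 0 v 1) (nth 0 v 3) (nth 0 v 0) == 0).
have rF : recf 6 F.
  apply: recf_mul; first by recf_tac.
  apply: recf_eq; last exact: recf_const.
  have rB : recf 6 (fun v => digit (nth 0 v 2) (nth 0 v 1) 0 * 2 ^ nth 0 v 3).
    by apply: recf_mul; [apply: recf_digit|]; recf_tac.
  have rS : recf 8 (fun v => cstep (nth 0 v 4) (nth 0 v 3) (nth 0 v 1)).
    by apply: recf_cstep; apply: recf_var.
  apply: recf_ext (recf_prec rB rS (@recf_var 6 0 isT)) => v _.
  by rewrite /citer; elim: (nth 0 v 0) => //= t ->.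
have r1 := recf_sum (@recf_var 5 4 isT) rF.
have r2 := recf_sum (@recf_var 4 3 isT) r1.
have r3 := recf_sum (@recf_var 3 2 isT) r2.
have r4 := recf_sum (@recf_var 2 1 isT) r3.
have r5 := recf_sum (@recf_var 1 0 isT) r4.
exact: r5.
Qed.

End Halting.

(** * The largest output *)

Section Histories.
Local Open Scope nat_scope.

Lemma sum_neq0 n (F : 'I_n -> nat) : \sum_(i < n) F i <> 0 <-> exists i, F i <> 0.
Proof.
split=> [/eqP|[i Fi] /eqP].
  by rewrite sum_nat_eq0 => /forallPn[i]; rewrite implyTb => /eqP Fi; exists i.
by rewrite sum_nat_eq0 => /forallP /(_ i) /eqP.
Qed.

(** The leading 1 lets the number of guesses be recovered from the value. *)
Fixpoint hist (b : nat -> bool) j := if j is j'.+1 then 2 * hist b j' + b j' else 1.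

Lemma hist_bounds b j : 2 ^ j <= hist b j < 2 ^ j.+1.
Proof. by elim: j => //= j IH; rewrite !expnS in IH *; case: (b j); lia. Qed.

Lemma hist_div b i j : hist b (i + j) %/ 2 ^ i = hist b j.
Proof.
elim: i => [|i IH] /=; first by rewrite divn1.
rewrite expnS divnMA mulnC divnMDl // (_ : b _ %/ 2 = 0) ?addn0 //.
by case: (b _).
Qed.

Lemma hist_eq1 b j m : hist b j %/ 2 ^ m = 1 -> j = m.
Proof.
have [jm|mj] := ltnP j m.
  rewrite divn_small // -[m](subnK jm).
  by have := hist_bounds b j; rewrite expnD; have := expn_gt0 2 (m - j.+1); nia.
rewrite -{1}(subnKC mj) hist_div; case: (j - m) (subnKC mj) => [|k] h; first by lia.
by move=> h1; have := hist_bounds b k.+1; rewrite h1 expnS; have := expn_gt0 2 k; lia.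
Qed.

Lemma hist_mod b i j : (hist b (i + j.+1) %/ 2 ^ i) %% 2 = b j.
Proof. by rewrite hist_div /= mulnC modnMDl; case: (b j). Qed.

Lemma bad_hist b j : bad (hist b j) <> 0 -> exists k, [/\ k < j, b k & halting k].
Proof.
rewrite /bad.
case/sum_neq0 => i /sum_neq0[k] /sum_neq0[Q] /sum_neq0[N] /sum_neq0[t].
case: eqP => [h1|] //; case: eqP => [h2|] //; case: eqP => [h3|] //; case: eqP => [h4|] // _.
move: (nat_of_ord i) (nat_of_ord k) (nat_of_ord Q) (nat_of_ord N) (nat_of_ord t) h1 h2 h3 h4.
move=> {}i {}k {}Q {}N {}t h1 h2 h3 h4.
have jE := hist_eq1 h1; exists k; split; [lia| |by exists Q, N, t].
by move: h2; rewrite jE addnC -addnS hist_mod; case: (b k).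
Qed.

(** A guess stays in the history forever, and the search bounds of [bad] grow exponentially with the
    number of guesses, so any refutation eventually fits into them. *)
Lemma hist_bad (b : nat -> bool) k : b k -> halting k -> exists j, bad (hist b j.+1) <> 0.
Proof.
move=> bk [Q [N [t [kE it]]]]; pose j := k + Q + N + t; exists j.
have big : j.+1 < hist b j.+1.
  by have /andP[h _] := hist_bounds b j.+1; apply: leq_trans h; apply: ltn_expl.
have [hi hk hQ hN ht] : [/\ j - k < hist b j.+1, k < hist b j.+1, Q < hist b j.+1,
  N < hist b j.+1 & t < hist b j.+1] by split; lia.
rewrite /bad; apply/sum_neq0; exists (Ordinal hi); apply/sum_neq0; exists (Ordinal hk).
apply/sum_neq0; exists (Ordinal hQ); apply/sum_neq0; exists (Ordinal hN).
apply/sum_neq0; exists (Ordinal ht) => /=.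
have e1 : (k + (j - k)).+1 = j.+1 by lia.
have h1 : hist b j.+1 %/ 2 ^ j.+1 = 1 by have := hist_div b j.+1 0; rewrite addn0.
have h2 : (hist b j.+1 %/ 2 ^ (j - k)) %% 2 = b k.
  by have := hist_mod b (j - k) k; rewrite (_ : j - k + k.+1 = j.+1) //; lia.
by rewrite e1 h1 h2 bk it kE !eqxx.
Qed.

End Histories.

(** * The program that guesses which programs run forever *)

Section MainProgram.
Local Open Scope nat_scope.

Definition dbl (b : bool) :=
  Seq (Loop 0 (Seq (Dec 0) (Seq (Inc 2) (Inc 2)))) (if b then Seq (mv 2 0) (Inc 0) else mv 2 0).

Lemma exec_dbl n b : exec (dbl b) (loads n) (loads (2 * n + b)).
Proof.
pose s i := upd (loads i) 2 (2 * (n - i)).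
have e i : i <= n -> exec (Loop 0 (Seq (Dec 0) (Seq (Inc 2) (Inc 2)))) (s i) (s 0).
  elim: i => [|i IH] ilt; first exact: exec_loop0.
  apply: exec_loopS (IH _) => //; last exact: ltnW.
  apply: exec_seq (exec_dec _ _) _; apply: exec_seq (exec_inc _ _) _.
  apply: exec_eq (exec_inc _ _) _; apply: funext => r; rewrite /s /upd /loads.
  by case: r => [|[|[|r]]] //=; lia.
have sn : loads n = s n.
  by apply: funext => r; rewrite /s /upd /loads; case: r => [|[|[|r]]] //=; lia.
rewrite sn; apply: exec_seq (e n (leqnn n)) _.
have e2 : exec (mv 2 0) (s 0) (loads (2 * n)).
  apply: exec_eq (exec_mv _ _) _ => //; apply: funext => r; rewrite /s /upd /loads.
  by case: r => [|[|[|r]]] //=; lia.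
case: b; last by rewrite addn0.
apply: exec_seq e2 _; apply: exec_eq (exec_inc _ _) _; apply: funext => r.
by rewrite /upd /loads; case: r => //=; lia.
Qed.

Variable cG : rec_code 1.
Hypothesis cGP : forall n, rec_graph cG [tuple n] (bad n).

Definition check := Seq (compile cG (fun=> 0) 1 2) (Loop 1 Stuck).
(** The constant first output is a marker. Rounds last as long as their check takes; with the
    markers the guessed bits can be located from the output alone. *)
Definition body := Seq (Out true) (Seq (Choice (Seq (Out true) (dbl true)) (Seq (Out false) (dbl false))) check).
(** [Inc 0] installs the history 1, which contains no guess; histories are positive, so the loop
    never ends. *)
Definition main := Seq (Inc 0) (Loop 0 body).
Definition after b := [:: dbl b; check; Loop 0 body].

Lemma after_steps n b : exists t, steps (after b, loads n) t
  ([:: Loop 1 Stuck; Loop 0 body], upd (loads (2 * n + b)) 1 (bad (2 * n + b))).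
Proof.
have [t st] := exec_dbl n b [:: check; Loop 0 body].
have ex : exec (compile cG (fun=> 0) 1 2) (loads (2 * n + b)) (upd (loads (2 * n + b)) 1 (bad (2 * n + b))).
  by apply: (exec_compile (cGP _)) => // [j|i]; [case: j => [|[]]|rewrite ord1].
have [u su] := ex [:: Loop 1 Stuck; Loop 0 body].
by exists (t + u.+1); apply: steps_trans st (stepsS _ su).
Qed.

(** What follows a guess is deterministic, so its duration depends only on the history and the
    guessed bit. *)
Lemma phase_length : exists len : nat -> bool -> nat, forall n (b : bool), bad (2 * n + b) = 0 ->
  steps (after b, loads n) (len n b) ([:: Loop 0 body], loads (2 * n + b)).
Proof.
suff /choice[f fP] : forall nb : nat * bool, exists t, bad (2 * nb.1 + nb.2) = 0 ->
    steps (after nb.2, loads nb.1) t ([:: Loop 0 body], loads (2 * nb.1 + nb.2)).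
  by exists (fun n b => f (n, b)) => n b; apply: (fP (n, b)).
move=> [n b] /=; have [t st] := after_steps n b; exists (t + 1) => b0.
apply: steps_trans st _; rewrite b0 /steps /=; congr (Some (_, _)).
by apply: funext => r; rewrite /upd /loads; case: r => [|[]].
Qed.

Definition prun (P : com) (K : nat -> seq com) (s : nat -> store) :=
  [/\ K 0 = [:: P], s 0 = loads 0,
      forall k, nstep (fun i => s k i == 0) (K k) (K k.+1) &
      forall k, s k.+1 = eff (K k) (s k)].

Lemma prun_steps P K s T t K' s' : prun P K s -> steps (K T, s T) t (K', s') ->
  [/\ K (T + t) = K', s (T + t) = s' & forall u, u < t -> hout (K (T + u)) = false].
Proof.
move=> [_ _ nK ns]; rewrite /steps; elim: t K' s' => [|t IH] K' s' /=.
  by case=> <- <-; rewrite addn0.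
case E : (iter _ _ _) => [[K1 s1]|] //= h.
have [eK es ho] := IH _ _ E.
have [no sE' KE'] := nstep_sstep h.
have K'E : K (T + t.+1) = K' by apply/KE'; rewrite addnS -eK -es; apply: nK.
split=> // [|u]; first by rewrite addnS ns eK es.
by rewrite ltnS leq_eqVlt => /orP[/eqP ->|/ho]; rewrite ?eK.
Qed.

Variable len : nat -> bool -> nat.
Hypothesis lenP : forall n (b : bool), bad (2 * n + b) = 0 ->
  steps (after b, loads n) (len n b) ([:: Loop 0 body], loads (2 * n + b)).

(* Time and history at the start of the j-th round of a run with output beta.
   In the round starting at T, the marker is output at T + 2 and the guessed
   bit at T + 6. *)
Fixpoint phase (beta : nat -> bool) j : nat * nat :=
  if j is j'.+1 then
    let: (T, n) := phase beta j' in (T + 7 + len n (beta (T + 6)), 2 * n + beta (T + 6))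
  else (2, 1).

Definition bit beta j := beta ((phase beta j).1 + 6).

Lemma phase_hist beta j : (phase beta j).2 = hist (bit beta) j.
Proof. by elim: j => //= j; rewrite /bit; case: (phase beta j) => T n /= ->. Qed.

Lemma prun_phase K s j : prun main K s -> let beta k := hout (K k) in
  let: (T, n) := phase beta j in
  [/\ K T = [:: Loop 0 body], s T = loads n, 0 < n, bad (2 * n + beta (T + 6)) = 0 &
   forall t, T <= t < (phase beta j.+1).1 -> beta t = (t == T + 2) || ((t == T + 6) && beta (T + 6))].
Proof.
move=> run beta.
have round T n : K T = [:: Loop 0 body] -> s T = loads n -> 0 < n ->
    let b := beta (T + 6) in
    [/\ K (T + 7) = after b, s (T + 7) = loads n &
     forall t, T <= t < T + 7 -> beta t = (t == T + 2) || ((t == T + 6) && b)].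
  move=> KT sT n0; have [eK0 s0 nK ns] := run.
  have st t L L' : K t = L -> s t = loads n -> nstep (fun i => loads n i == 0) L L' ->
    (forall L2, nstep (fun i => loads n i == 0) L L2 -> L2 = L') -> eff L (loads n) = loads n ->
    K t.+1 = L' /\ s t.+1 = loads n.
    move=> KE sE _ un ef; split; last by rewrite ns KE sE ef.
    by apply: un; rewrite -sE -KE; apply: nK.
  have n0' : loads n 0 == 0 = false by rewrite /loads /=; lia.
  have K1 : K T.+1 = [:: body; Loop 0 body] by have := nK T; rewrite KT sT /= n0'.
  have s1 : s T.+1 = loads n by rewrite ns KT.
  have K2 : K T.+2 = [:: Out true; Seq (Choice (Seq (Out true) (dbl true)) (Seq (Out false) (dbl false))) check; Loop 0 body].
    by have := nK T.+1; rewrite K1.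
  have s2 : s T.+2 = loads n by rewrite ns K1.
  have K3 : K T.+3 = [:: Seq (Choice (Seq (Out true) (dbl true)) (Seq (Out false) (dbl false))) check; Loop 0 body].
    by have := nK T.+2; rewrite K2.
  have s3 : s T.+3 = loads n by rewrite ns K2.
  have K4 : K T.+4 = [:: Choice (Seq (Out true) (dbl true)) (Seq (Out false) (dbl false)); check; Loop 0 body].
    by have := nK T.+3; rewrite K3.
  have s4 : s T.+4 = loads n by rewrite ns K3.
  have [b K5] : exists b, K T.+4.+1 = [:: Seq (Out b) (dbl b); check; Loop 0 body].
    by have := nK T.+4; rewrite K4 /= => -[->|->]; [exists true|exists false].
  have s5 : s T.+4.+1 = loads n by rewrite ns K4.
  have K6 : K T.+4.+2 = Out b :: after b by have := nK T.+4.+1; rewrite K5.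
  have s6 : s T.+4.+2 = loads n by rewrite ns K5.
  have K7 : K T.+4.+3 = after b by have := nK T.+4.+2; rewrite K6.
  have s7 : s T.+4.+3 = loads n by rewrite ns K6.
  have e6 : T + 6 = T.+4.+2 by lia.
  have e7 : T + 7 = T.+4.+3 by lia.
  have bE : beta (T + 6) = b by rewrite /beta e6 K6.
  rewrite bE e7 K7 s7; split => // t tP.
  have [->|[->|[->|[->|[->|[->|->]]]]]] : t = T \/ t = T.+1 \/ t = T.+2 \/ t = T.+3 \/
    t = T.+4 \/ t = T.+4.+1 \/ t = T.+4.+2 by lia.
  - by rewrite /beta KT /=; lia.
  - by rewrite /beta K1 /=; lia.
  - by rewrite /beta K2 /=; lia.
  - by rewrite /beta K3 /=; lia.
  - by rewrite /beta K4 /=; lia.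
  - by rewrite /beta K5 /=; lia.
  - by rewrite /beta K6 /=; lia.
have full T n : K T = [:: Loop 0 body] -> s T = loads n -> 0 < n ->
    let b := beta (T + 6) in let T' := T + 7 + len n b in
    [/\ K T' = [:: Loop 0 body], s T' = loads (2 * n + b), bad (2 * n + b) = 0 &
     forall t, T <= t < T' -> beta t = (t == T + 2) || ((t == T + 6) && b)].
  move=> KT sT n0 b T'; have [eK7 s7 bE] := round T n KT sT n0.
  have b0 : bad (2 * n + b) = 0.
    case: (posnP (bad (2 * n + b))) => // bp.
    have [t st] := after_steps n b.
    (* If [bad] were nonzero here, the run would arrive at [Stuck], which has no successor. *)
    have st' : steps (after b, loads n) (t + 1) ([:: Stuck; Loop 1 Stuck; Loop 0 body],
        upd (loads (2 * n + b)) 1 (bad (2 * n + b))).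
      apply: steps_trans st _; rewrite /steps /= ifF //.
      by rewrite /upd eqxx; lia.
    rewrite -/b -eK7 -s7 in st'.
    have [eK _ _] := prun_steps run st'.
    by have [_ _ /(_ (T + 7 + (t + 1)))] := run; rewrite eK.
  have st := lenP b0; rewrite -/b -eK7 -s7 in st.
  have [eK es ho] := prun_steps run st; split => // t tP.
  have [t7|t7] := ltnP t (T + 7); first by apply: bE; lia.
  have -> : t = T + 7 + (t - (T + 7)) by lia.
  by rewrite /beta ho; lia.
elim: j => [|j] /=.
  have [eK0 s0 nK ns] := run.
  have K1 : K 1 = [:: Inc 0; Loop 0 body] by have := nK 0; rewrite eK0.
  have s1 : s 1 = loads 0 by rewrite ns eK0.
  have K2 : K 2 = [:: Loop 0 body] by have := nK 1; rewrite K1.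
  have s2 : s 2 = loads 1.
    by rewrite ns K1 /= s1; apply: funext => r; rewrite /upd /loads; case: eqP.
  by have [_ _ ? ?] := full 2 1 K2 s2 isT; split.
case: (phase beta j) => T n /= [KT sT n0 b0 _].
have [eK1 s1 b1 _] := full T n KT sT n0.
have n1 : 0 < 2 * n + beta (T + 6) by lia.
by have [_ _ ? ?] := full _ _ eK1 s1 n1; split.
Qed.

End MainProgram.

(** * The run with correct guesses is maximal and not computable *)

Section Runs.
Local Open Scope nat_scope.

Variable cG : rec_code 1.
Hypothesis cGP : forall n, rec_graph cG [tuple n] (bad n).
Variable len : nat -> bool -> nat.
Hypothesis lenP : forall n (b : bool), bad (2 * n + b) = 0 ->
  steps (after cG b, loads n) (len n b) ([:: Loop 0 (body cG)], loads (2 * n + b)).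

Let P := main cG.
Let ph := phase len.
Let bt := bit len.

Lemma prun_out01 K s : prun P K s -> hout (K 0) = false /\ hout (K 1) = false.
Proof. by case=> K0 _ nK _; have := nK 0; rewrite K0 /= => ->. Qed.

Lemma phaseS beta j : ph beta j.+1 =
  ((ph beta j).1 + 7 + len (ph beta j).2 (bt beta j), 2 * (ph beta j).2 + bt beta j).
Proof. by rewrite /ph /bt /bit /=; case: (phase len beta j). Qed.

Lemma phase_time beta j :
  (ph beta j.+1).1 = (ph beta j).1 + 7 + len (ph beta j).2 (bt beta j).
Proof. by rewrite phaseS. Qed.

Lemma prun_phaseE K s beta j : prun P K s -> (forall k, beta k = hout (K k)) ->
  let T := (ph beta j).1 in
  [/\ K T = [:: Loop 0 (body cG)], s T = loads (hist (bt beta) j),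
   bad (hist (bt beta) j.+1) = 0 &
   forall t, T <= t < (ph beta j.+1).1 -> beta t = (t == T + 2) || ((t == T + 6) && bt beta j)].
Proof.
move=> run bK; have := prun_phase cGP lenP j run.
rewrite (_ : (fun k => hout (K k)) = beta); last by apply: funext => k; rewrite bK.
rewrite /= -/(ph beta j.+1).
have := phase_hist len beta j; rewrite /= -/(bit len beta) /bt /bit /ph.
by case E : (phase len beta j) => [T n] /= -> [? ? _ ? ?]; split.
Qed.

(** Between guesses runs are deterministic, so two outputs can only part where the first differing
    guess is output, at offset 6 of its round. *)
Lemma agree K s K' s' beta beta' j : prun P K s -> (forall k, beta k = hout (K k)) ->
  prun P K' s' -> (forall k, beta' k = hout (K' k)) ->
  (forall i, i < j -> bt beta i = bt beta' i) ->
  ph beta j = ph beta' j /\ forall t, t < (ph beta j).1 + 6 -> beta t = beta' t.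
Proof.
move=> run bK run' bK' bE.
suff [phE tE] : ph beta j = ph beta' j /\ forall t, t < (ph beta j).1 -> beta t = beta' t.
  split=> // t tP; have [|tj] := ltnP t (ph beta j).1; first exact: tE.
  have [_ _ _ h] := prun_phaseE j run bK; have [_ _ _ h'] := prun_phaseE j run' bK'.
  have r1 : (ph beta j).1 <= t < (ph beta j.+1).1 by rewrite phase_time; lia.
  have r2 : (ph beta' j).1 <= t < (ph beta' j.+1).1 by rewrite phase_time -phE; lia.
  have t6 : (t == (ph beta j).1 + 6) = false by apply/eqP; lia.
  by rewrite h // h' // -phE t6.
elim: j bE => [|j IH] bE.
  split=> // -[|[|t]] // _; rewrite bK bK'.
    by have [-> _] := prun_out01 run; have [-> _] := prun_out01 run'.
  by have [_ ->] := prun_out01 run; have [_ ->] := prun_out01 run'.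
have [|phE tE] := IH; first by move=> i ij; apply: bE; lia.
have bj := bE j (ltnSn j).
split=> [|t tP]; first by rewrite !phaseS phE bj.
have [|tj] := ltnP t (ph beta j).1; first exact: tE.
have [_ _ _ h] := prun_phaseE j run bK; have [_ _ _ h'] := prun_phaseE j run' bK'.
have r1 : (ph beta j).1 <= t < (ph beta j.+1).1 by rewrite tj.
have r2 : (ph beta' j).1 <= t < (ph beta' j.+1).1.
  by rewrite -phE tj; move: tP; rewrite !phase_time -phE bj.
by rewrite h // h' // -phE bj.
Qed.

Definition bstar j := `[< ~ halting j >].
Let N := hist bstar.

(** A history of j guesses has binary logarithm j, so the history tells which program is next. *)
Definition guess n := bstar (trunc_log 2 n).

Lemma guess_hist j : guess (N j) = bstar j.
Proof. by rewrite /guess (trunc_log_eq _ (hist_bounds _ _)). Qed.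

Lemma bad_bstar j : bad (N j) = 0.
Proof.
case: (posnP (bad (N j))) => // b0; have /bad_hist[k [_ /asboolP bk hk]] : bad (N j) <> 0 by lia.
by [].
Qed.

(** [Choice] is resolved by [guess] applied to register 0, which holds the history whenever a choice
    is met. *)
Definition dnext (x : seq com * store) : seq com * store :=
  (match x.1 with
   | Choice a b :: L => if guess (x.2 0) then a :: L else b :: L
   | Out _ :: L => L
   | _ => if sstep x is Some y then y.1 else x.1
   end, eff x.1 x.2).

Definition live (x : seq com * store) := if x.1 is [::] then false else if x.1 is Stuck :: _ then false else true.

Lemma dnext_nstep x : live x -> nstep (fun i => x.2 i == 0) x.1 (dnext x).1.
Proof.
by case: x => [[|[i|i|b||a b|i a|a b] K] s] //= _; case: ifP => _; [left|right].
Qed.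

Lemma dnext_sstep x y : sstep x = Some y -> dnext x = y /\ live x.
Proof. by case: x => [[|[i|i|b||a b|i a|a b] K] s] //= [<-]. Qed.

Lemma dnext_steps x t y : steps x t y -> iter t dnext x = y /\ forall u, u < t -> live (iter u dnext x).
Proof.
rewrite /steps; elim: t y => [|t IH] y /=; first by case=> <-.
case E : (iter _ _ _) => [z|] //= h; have [<- lz] := dnext_sstep h.
have [zE lv] := IH _ E; rewrite zE; split=> // u.
by rewrite ltnS leq_eqVlt => /orP[/eqP ->|/lv//]; rewrite zE.
Qed.

Lemma round_guess n u : 0 < n -> let x := ([:: Loop 0 (body cG)], loads n) in
  [/\ iter 7 dnext x = (after cG (guess n), loads n), u < 7 -> live (iter u dnext x) &
   hout (iter 6 dnext x).1 = guess n].
Proof.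
move=> n0 x; pose L := Loop 0 (body cG); pose st := loads n.
pose A b := Seq (Out b) (dbl b); pose g := guess n.
have i1 : iter 1 dnext x = ([:: body cG; L], st).
  by rewrite /= /dnext /= /loads /= ifF //; lia.
have i2 : iter 2 dnext x = ([:: Out true; Seq (Choice (A true) (A false)) (check cG); L], st).
  by rewrite iterS i1.
have i3 : iter 3 dnext x = ([:: Seq (Choice (A true) (A false)) (check cG); L], st).
  by rewrite iterS i2.
have i4 : iter 4 dnext x = ([:: Choice (A true) (A false); check cG; L], st).
  by rewrite iterS i3.
have i5 : iter 5 dnext x = ([:: A g; check cG; L], st).
  rewrite iterS i4 /dnext [_.1]/= [_.2]/= (_ : st 0 = n) // -/g.
  by case: g.
have i6 : iter 6 dnext x = (Out g :: after cG g, st) by rewrite iterS i5.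
have i7 : iter 7 dnext x = (after cG g, st) by rewrite iterS i6.
rewrite i7 i6; split=> //.
case: u => [|[|[|[|[|[|[|u]]]]]]] // _.
- by rewrite i1.
- by rewrite i2.
- by rewrite i3.
- by rewrite i4.
- by rewrite i5.
- by rewrite i6.
Qed.

Lemma best_run : exists K s, prun P K s /\ forall j, bt (fun k => hout (K k)) j = bstar j.
Proof.
pose x0 : seq com * store := ([:: P], loads 0).
have hist_gt0 j : 0 < N j by have /andP[h _] := hist_bounds bstar j; apply: leq_trans h; rewrite expn_gt0.
(* The run is back at the head of the loop at arbitrarily late times, having been live all along;
   hence it is always live. *)
have reach j : exists T, [/\ j <= T, iter T dnext x0 = ([:: Loop 0 (body cG)], loads (N j)) &
    forall u, u < T -> live (iter u dnext x0)].
  elim: j => [|j [T [jT TE lv]]].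
    exists 2; split=> // [|u]; last by case: u => [|[|u]].
    by rewrite /= /dnext /=; congr (_, _); apply: funext => r; rewrite /upd /loads; case: eqP.
  have [e7 _ _] := round_guess 0 (hist_gt0 j).
  have b0 : bad (2 * N j + guess (N j)) = 0 by rewrite guess_hist; apply: (bad_bstar j.+1).
  have [e lv'] := dnext_steps (lenP b0).
  exists (len (N j) (guess (N j)) + (7 + T)); split; first by lia.
    by rewrite !iterD TE e7 e guess_hist.
  move=> u uP; have [|Tu] := ltnP u T; first exact: lv.
  have [u7|u7] := ltnP u (7 + T).
    rewrite -(subnK Tu) iterD TE.
    by have [_ + _] := round_guess (u - T) (hist_gt0 j); apply; lia.
  rewrite -(subnK u7) !iterD TE e7; apply: lv'; lia.
have lv t : live (iter t dnext x0).
  by have [T [tT _ lv]] := reach t.+1; apply: lv.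
pose K t := (iter t dnext x0).1; pose s t := (iter t dnext x0).2.
have run : prun P K s.
  by split=> // k; rewrite /K /s iterS; apply: dnext_nstep.
exists K, s; split=> // j; set beta := fun k => _.
elim/ltn_ind: j => j IH.
have [KT sT _ _] := prun_phaseE (beta := beta) j run (fun _ => erefl).
have histE : hist (bt beta) j = N j.
  rewrite /N; elim: {KT sT} j IH => //= j IHj IH.
  by rewrite IHj ?IH // => i ij; apply: IH; lia.
set T := (ph beta j).1 in KT sT.
have TE : iter T dnext x0 = ([:: Loop 0 (body cG)], loads (N j)).
  by rewrite [LHS]surjective_pairing -/(K T) -/(s T) KT sT histE.
rewrite /bt /bit -/(ph beta j) -/T /beta /K addnC iterD TE.
by have [_ _ ->] := round_guess 0 (hist_gt0 j); rewrite guess_hist.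
Qed.

(** At the first differing guess the other run cannot have the bit 1: the correct bit would be 0, so
    the program halts, and by [hist_bad] some later history of that run would be bad. *)
Lemma best_run_max K s K' s' : prun P K s -> (forall j, bt (fun k => hout (K k)) j = bstar j) ->
  prun P K' s' -> let beta k := hout (K k) in let beta' k := hout (K' k) in
  beta' = beta \/ exists t, [/\ forall u, u < t -> beta' u = beta u, beta' t = false & beta t].
Proof.
move=> run bE run' beta beta'.
have [ex|nex] := pselect (exists j, bt beta' j != bt beta j); last first.
  left; apply: funext => t.
  have bb j : bt beta' j = bt beta j by apply/eqP; apply: contrapT => /negP h; apply: nex; exists j.
  have [_ h] := agree run' (fun _ => erefl) run (fun _ => erefl) (j := t) (fun i _ => bb i).
  have le : t <= (ph beta' t).1 by elim: t {h} => // t IH; rewrite phase_time; lia.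
  by apply: h; apply: (leq_ltn_trans le); rewrite -[X in X < _]addn0 ltn_add2l.
right; have [j jne jmin] := ex_minnP ex.
have lt_j i : i < j -> bt beta' i = bt beta i.
  by move=> ij; apply/eqP; apply: contraTT ij => /jmin; rewrite -leqNgt.
have [phE tE] := agree run' (fun _ => erefl) run (fun _ => erefl) lt_j.
exists ((ph beta' j).1 + 6); split=> //.
- case b'1 : (beta' ((ph beta' j).1 + 6)) => //.
  have b'j : bt beta' j by [].
  have hj : halting j.
    apply: contrapT => nh; move: jne; rewrite b'j bE.
    by rewrite /bstar asboolT.
  have [i bi] := hist_bad b'j hj.
  by have [_ _ h _] := prun_phaseE (beta := beta') i run' (fun _ => erefl); case: bi; rewrite -[RHS]h.
- case b1 : (beta ((ph beta' j).1 + 6)) => //.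
  have bj : bt beta j = false by rewrite /bt /bit -/(ph beta j) -phE.
  have b'j : bt beta' j by move: jne; rewrite bj; case: (bt beta' j).
  have hj : halting j.
    by move: bj; rewrite bE /bstar => /asboolPn /contrapT.
  have [i bi] := hist_bad b'j hj.
  by have [_ _ h _] := prun_phaseE (beta := beta') i run' (fun _ => erefl); case: bi; rewrite -[RHS]h.
Qed.

(** The bits of [bstar] can be found in the output: bit j stands 4 places after marker j, and the
    next marker is the first 1 from 5 places after marker j on. *)
Lemma best_run_noncomputable K s : prun P K s -> (forall j, bt (fun k => hout (K k)) j = bstar j) ->
  ~ computable_function (fun k => nat_of_bool (hout (K k))).
Proof.
move=> run bE; set beta := fun k => hout (K k) => cb.
have pt j t : (ph beta j).1 <= t < (ph beta j.+1).1 ->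
    beta t = (t == (ph beta j).1 + 2) || ((t == (ph beta j).1 + 6) && bt beta j).
  by have [_ _ _] := prun_phaseE (beta := beta) j run (fun _ => erefl); apply.
have mark j : beta ((ph beta j).1 + 2) by rewrite (pt j) ?eqxx // phase_time; lia.
have /choice[g gP] : forall x, exists t, [/\ x <= t, beta t & forall u, x <= u < t -> beta u = false].
  move=> x; have ex : exists t, (x <= t) && beta t.
    exists ((ph beta x).1 + 2); rewrite mark andbT.
    suff : x <= (ph beta x).1 by lia.
    by elim: x => // x IH; rewrite phase_time; lia.
  have [t /andP[xt bt_] tmin] := ex_minnP ex; exists t; split=> // u /andP[xu ut].
  by apply/negP => bu; have := tmin u; rewrite xu bu => /(_ isT); lia.
have gE x y : x <= y -> beta y -> (forall u, x <= u < y -> beta u = false) -> g x = y.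
  move=> xy by_ nu; have [xg bg ng] := gP x.
  case: (ltngtP (g x) y) => // h; first by have := nu (g x); rewrite xg h bg => /(_ isT).
  by have := ng y; rewrite xy h by_ => /(_ isT).
pose M j := nat_rect (fun=> nat) (g 0) (fun k acc => g (acc + 5)) j.
have ME j : M j = (ph beta j).1 + 2.
  elim: j => [|j IH].
    apply: gE => //.
    case=> [|[|u]] uP; try by have [] := prun_out01 run.
    have T0 : (ph beta 0).1 = 2 by [].
    by rewrite T0 in uP; rewrite (pt 0) ?phase_time T0; lia.
  rewrite [M j.+1]/=.
  rewrite -/(M j) IH; apply: gE; first by rewrite phase_time; lia.
    exact: mark.
  move=> u uP; have [uT|uT] := ltnP u (ph beta j.+1).1.
    by rewrite (pt j); lia.
  by rewrite (pt j.+1) ?(phase_time _ j.+1); lia.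
have rg : recf 1 (fun v => g (nth 0 v 0)).
  have rF : recf 2 (fun v => 1 - (nth 0 v 1 <= nth 0 v 0) * beta (nth 0 v 0)).
    apply: recf_sub; first exact: recf_const.
    apply: recf_mul; first by apply: recf_leq; apply: recf_var.
    by apply: (computable_app cb); apply: recf_var.
  apply: (recf_min rF) => -[|x [|y v]] //= _; have [xg bg ng] := gP x.
  rewrite xg bg; split=> // k kg; case: leqP => //= xk.
  by rewrite ng ?xk.
have rM : recf 1 (fun v => M (nth 0 v 0)).
  have rS : recf 3 (fun v => g (nth 0 v 1 + 5)).
    by apply: (recf_app1 rg); apply: recf_add; [apply: recf_var|apply: recf_const].
  have rB : recf 1 (fun v => g 0) by apply: recf_const.
  exact: recf_prec rB rS (@recf_var 1 0 isT).
apply: (@halting_undecidable (fun j => beta (M j + 4))).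
  apply/recf_computable; apply: (computable_app cb).
  by apply: recf_add => //; apply: recf_const.
move=> k; rewrite ME -addnA; have -> : beta ((ph beta k).1 + (2 + 4)) = bstar k by rewrite -bE.
by split=> /asboolP.
Qed.

End Runs.

(** * Counter machines *)

Record machine := Machine {
  mstate : finType;
  mreg : nat;
  mstart : mstate;
  mtrans : ('I_mreg -> bool) -> mstate -> mstate -> Prop;
  (* [Some true] increments and [Some false] decrements a register. *)
  mdelta : mstate -> 'I_mreg -> option bool;
  mout : mstate -> bool }.

Section Machines.
Local Open Scope nat_scope.

Definition shift_reg (d : option bool) (n : nat) :=
  if d is Some b then (if b then n.+1 else n.-1) else n.

Definition mrun (m : machine) (q : nat -> mstate m) (c : nat -> 'I_(mreg m) -> nat) :=
  [/\ q 0 = mstart m, forall i, c 0 i = 0,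
      forall k, mtrans (fun i => c k i == 0) (q k) (q k.+1) &
      forall k i, c k.+1 i = shift_reg (mdelta (q k) i) (c k i)].

Definition moutput (m : machine) (beta : nat -> bool) :=
  exists q c, @mrun m q c /\ forall k, beta k = mout (q k).

Section OfProgram.
Variable P : com.
Let l := stacks P.
Let r := nregs P.
Let stk (i : 'I_(size l)) : seq com := nth [::] l i.
Let zext (z : 'I_r -> bool) n := if insub n is Some i then z i else true.

(** No instruction of the program touches a register beyond the first r ([hreg_lt]), so those stay
    0, in accordance with [zext]. *)
Definition prog_machine : machine := {|
  mstate := 'I_(size l);
  mreg := r;
  mstart := Ordinal (size_stacks P);
  mtrans := fun z i j => nstep (zext z) (stk i) (stk j);
  mdelta := fun i x => match stk i with
    | Inc y :: _ => if x == y :> nat then Some true else None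
    | Dec y :: _ => if x == y :> nat then Some false else None
    | _ => None end;
  mout := fun i => hout (stk i) |}.

Lemma prog_machine_output beta :
  moutput prog_machine beta <-> exists K s, prun P K s /\ forall k, beta k = hout (K k).
Proof.
split=> [[q [c [[q0 c0 tr dl] bE]]]|[K [s [[K0 s0 nK ns] bE]]]].
  exists (fun k => stk (q k)), (fun k n => if insub n is Some i then c k i else 0); split=> //.
  split=> [|||k].
  - by rewrite q0 /stk /= /l stacks_start.
  - by apply: funext => n; case: insubP => [i _ _|_]; rewrite ?c0 /loads; case: eqP.
  - move=> k; have := tr k; rewrite /= (_ : zext _ = fun i => (if insub i is Some j then c k j else 0) == 0) //.
    by apply: funext => n; rewrite /zext; case: insubP.
  have Kin : List.In (stk (q k)) l by apply: nth_In; apply: ltn_ord.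
  have hr := hreg_lt Kin; apply: funext => n.
  transitivity (if insub n is Some i then shift_reg (mdelta (q k) i) (c k i) else 0).
    by case: insubP => // i _ _; rewrite dl.
  rewrite /=; case: (stk (q k)) hr => [|[x|x|b||a b|x a|a b] L] /= hr; case: insubP => // [i ir iE|nr].
  - by rewrite /upd -iE; case: eqP => [<-|_] /=; rewrite valK.
  - by rewrite /upd ifF; [rewrite insubF //; apply/negbTE|apply/eqP => e; rewrite e hr in nr].
  - by rewrite /upd -iE; case: eqP => [<-|_] /=; rewrite valK.
  - by rewrite /upd ifF; [rewrite insubF //; apply/negbTE|apply/eqP => e; rewrite e hr in nr].
have Kin k : List.In (K k) l.
  elim: k => [|k IH]; first by rewrite K0 -(stacks_start P); apply: nth_In; apply: size_stacks.
  exact: stacks_closed IH (nK k).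
have sz k n : r <= n -> s k n = 0.
  move=> rn; elim: k => [|k IH]; first by rewrite s0 /loads; case: eqP => // n0; have := nregs_gt0 P; lia.
  rewrite ns; have := hreg_lt (Kin k); case: (K k) => [|[x|x|b||a b|x a|a b] L] //= xr.
    by rewrite /upd ifF //; apply/eqP; rewrite -/r in xr; lia.
  by rewrite /upd ifF //; apply/eqP; rewrite -/r in xr; lia.
have /choice[q qE] : forall k, exists i, stk i = K k /\ (k = 0 -> i = Ordinal (size_stacks P)).
  move=> k; have [->|k0] := eqVneq k 0.
    by exists (Ordinal (size_stacks P)); rewrite K0 /stk /= /l stacks_start.
  have [i il iE] := In_nth [::] (Kin k).
  by exists (Ordinal il); split=> // e; rewrite e in k0.
have sq k : stk (q k) = K k by have [] := qE k.
exists q, (fun k i => s k i); split; last by move=> k; rewrite bE /= sq.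
split=> [|i|k|k i] /=.
- by have [_ ->] := qE 0.
- by rewrite s0 /loads; case: eqP => // ->.
- rewrite !sq (_ : zext _ = fun n => s k n == 0) //; apply: funext => n.
  by rewrite /zext; case: insubP => [i _ <-//|]; rewrite -leqNgt => /sz ->.
by rewrite ns sq; case: (K k) => [|[x|x|b||a b|x a|a b] L] //=; rewrite /upd; case: eqP => // ->.
Qed.

End OfProgram.

Lemma machine_exists : exists (m : machine) (beta : nat -> bool),
  [/\ moutput m beta,
    forall beta', moutput m beta' -> beta' = beta \/
      exists t, [/\ forall u, u < t -> beta' u = beta u, beta' t = false & beta t] &
    ~ computable_function (fun k => nat_of_bool (beta k))].
Proof.
have [cG cGP] := bad_computable.
have [len lenP] := phase_length cGP.
have [K [s [run bE]]] := best_run cGP lenP.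
exists (prog_machine (main cG)), (fun k => hout (K k)); split.
- by apply/prog_machine_output; exists K, s.
- move=> beta' /prog_machine_output[K' [s' [run' bE']]].
  have -> : beta' = fun k => hout (K' k) by apply: funext.
  exact: (best_run_max cGP lenP run bE run').
- exact: (best_run_noncomputable cGP lenP run bE).
Qed.

End Machines.

(** * A hierarchy of Wang tiles *)

Section IntInduction.
Local Open Scope ring_scope.

Lemma int_periodic (T : Type) (f : int -> T) : (forall i, f (i + 1) = f i) -> forall i, f i = f 0.
Proof.
move=> fS; elim/int_ind => // n IH; first by rewrite -IH -[n.+1%:Z]/(Posz (n.+1)) -addn1 PoszD fS.
by rewrite -IH -(fS (- n.+1%:Z)); congr f; lia.
Qed.

Lemma int_alternate (f : int -> bool) : (forall i, f (i + 1) = ~~ f i) -> forall i, f (2 * i) = f 0.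
Proof.
move=> fS; apply: (@int_periodic _ (fun i => f (2 * i))) => i.
by rewrite (_ : 2 * (i + 1) = 2 * i + 1 + 1); [rewrite !fS negbK|lia].
Qed.

End IntInduction.

Section Tiles.
Local Open Scope ring_scope.

Variable D : finType.
Variables (Rh : rel D) (Phi : D -> D -> D -> bool) (init free : pred D).

(* The signal carried by an edge: direction of travel (true = right or up),
   whether it runs along a side of a square, the datum of the cross that
   emitted it, and the orientation of the row or column that it follows. *)
Definition edge := (bool * bool * D * bool)%type.
Definition dir (e : edge) := e.1.1.1.
Definition lab (e : edge) := e.1.1.2.
Definition dat (e : edge) := e.1.2.
Definition tag (e : edge) := e.2.

(** c and r are the orientations of the column and of the row: false for a left or bottom side, true
    for a right or top side. The labelled arms point towards the other corners, so those of four
    neighbouring crosses bound a square. *)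
Definition is_cross (W E S N : edge) :=
  let: (c, d, r) := (lab W, dat W, tag W) in
  [&& W == (false, c, d, r), E == (true, ~~ c, d, r),
      S == (false, r, d, c) & N == (true, ~~ r, d, c)].

(** Two vertical arms meet head on and a horizontal signal crosses them. On a side of a square this
    signal must leave the square: to the left on a left side, to the right on a right side. *)
Definition is_hcell (W E S N : edge) :=
  let: (t, d, c) := (lab S, dat S, tag S) in
  [&& W == E, S == (true, t, d, c), N == (false, t, d, c) & t ==> (dir W == c)].

(** Here the data of horizontal neighbours meet and are compared by [Rh]. On a side of a square, the
    vertical signal brings the datum of the cross at the centre, which [Phi] relates to the data of
    the two corners. *)
Definition is_vcell (W E S N : edge) :=
  let: (t, r) := (lab W, tag W) in
  [&& S == N, W == (true, t, dat W, r), E == (false, t, dat E, r), Rh (dat W) (dat E) &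
      t ==> (dir N == r) && Phi (dat W) (dat E) (dat N)].

Definition tile_ok W E S N := [|| is_cross W E S N, is_hcell W E S N | is_vcell W E S N].

Section Structure.
Variables hz vz : int -> int -> edge.
Hypothesis ok : forall x y, tile_ok (hz x y) (hz (x + 1) y) (vz x y) (vz x (y + 1)).

Definition cross_at x y := is_cross (hz x y) (hz (x + 1) y) (vz x y) (vz x (y + 1)).

(** As signals do not change between lattice points, the tiles at these points form again a tiling,
    at scale p. *)
Definition lattice (p a b : int) :=
  (forall i j t, 0 < t <= p -> hz (a + p * i + t) (b + p * j) = hz (a + p * i + 1) (b + p * j)) /\
  (forall i j t, 0 < t <= p -> vz (a + p * i) (b + p * j + t) = vz (a + p * i) (b + p * j + 1)).

Definition odd_crosses (p a b : int) :=
  forall i j, cross_at (a + p * (2 * i + 1)) (b + p * (2 * j + 1)).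

Lemma crossP x y : cross_at x y -> exists c d r,
  [/\ hz x y = (false, c, d, r), hz (x + 1) y = (true, ~~ c, d, r),
      vz x y = (false, r, d, c) & vz x (y + 1) = (true, ~~ r, d, c)].
Proof.
case/and4P => /eqP h1 /eqP h2 /eqP h3 /eqP h4.
by exists (lab (hz x y)), (dat (hz x y)), (tag (hz x y)).
Qed.

Section Level.
Variables (p a b : int).
Hypothesis p0 : 0 < p.
Hypothesis lat : lattice p a b.
Hypothesis crosses : odd_crosses p a b.

Let X i := a + p * (2 * i + 1).
Let Y j := b + p * (2 * j + 1).
Let c i := lab (hz (X i) (Y 0)).
Let d i := dat (hz (X i) (Y 0)).
Let r j := tag (hz (X 0) (Y j)).

(** Midway between two crosses of a column the vertical arms arrive from both ends, which rules out
    the other two kinds of tiles. *)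
Lemma hcell_between i j : let x := X i in let y := Y j + p in
  [/\ hz x y = hz (x + 1) y, lab (vz x (Y j + 1)) -> dir (hz x y) = tag (vz x (Y j + 1)) &
   vz x (Y (j + 1)) = (false, lab (vz x (Y j + 1)), dat (vz x (Y j + 1)), tag (vz x (Y j + 1)))].
Proof.
move=> x y; have [_ latv] := lat.
have [c1 [d1 [r1 [_ _ _ N1]]]] := crossP (crosses i j).
have [c2 [d2 [r2 [_ _ S2 _]]]] := crossP (crosses i (j + 1)).
rewrite -/(X i) -/(Y j) -/(Y (j + 1)) -/x in N1 S2.
have e1 : vz x y = vz x (Y j + 1) by apply: (latv (2 * i + 1) (2 * j + 1)); lia.
have e2 : vz x (y + 1) = vz x (Y (j + 1)).
  have := latv (2 * i + 1) (2 * j + 2) p; rewrite (_ : b + p * (2 * j + 2) = y); last by rewrite /y /Y; lia.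
  rewrite (_ : y + p = Y (j + 1)); last by rewrite /y /Y; lia.
  by move=> <- //; lia.
have := ok x y; rewrite e1 e2 N1 S2 /tile_ok.
case/or3P; first by case/and4P => _ _ /eqP.
  by case/and4P => /eqP wE _ /eqP[<- <- <-] /implyP h; split=> // /h/eqP.
by case/and4P.
Qed.

Lemma vcell_between i j : let x := X i + p in let y := Y j in
  let W := hz (X i + 1) y in
  [/\ vz x y = vz x (y + 1), Rh (dat W) (dat (hz (X (i + 1)) y)),
   lab W -> Phi (dat W) (dat (hz (X (i + 1)) y)) (dat (vz x (y + 1))) &
   exists d', hz (X (i + 1)) y = (false, lab W, d', tag W)].
Proof.
move=> x y W; have [lath _] := lat.
have [c1 [d1 [r1 [_ E1 _ _]]]] := crossP (crosses i j).
have [c2 [d2 [r2 [W2 _ _ _]]]] := crossP (crosses (i + 1) j).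
rewrite -/(X i) -/(Y j) -/(X (i + 1)) -/y in E1 W2.
have e1 : hz x y = W by apply: (lath (2 * i + 1) (2 * j + 1)); lia.
have e2 : hz (x + 1) y = hz (X (i + 1)) y.
  have := lath (2 * i + 2) (2 * j + 1) p; rewrite (_ : a + p * (2 * i + 2) = x); last by rewrite /x /X; lia.
  rewrite (_ : x + p = X (i + 1)); last by rewrite /x /X; lia.
  by move=> <- //; lia.
have := ok x y; rewrite e1 e2 /W E1 W2 /tile_ok.
case/or3P; first by case/and4P => /eqP.
  by case/and4P => /eqP.
case/and5P => /eqP sE _ /eqP[<- <-] rh /implyP h; split=> //; last by exists d2.
by move=> /h/andP[].
Qed.

(** Meeting arms have equal tags, so the orientation is constant along each line; so is the datum
    along each column, since [is_hcell] makes the vertical arms agree on it. *)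
Lemma level_data i j : [/\ hz (X i) (Y j) = (false, c i, d i, r j),
  hz (X i + 1) (Y j) = (true, ~~ c i, d i, r j), vz (X i) (Y j) = (false, r j, d i, c i) &
  vz (X i) (Y j + 1) = (true, ~~ r j, d i, c i)].
Proof.
have cE i' j' : lab (hz (X i') (Y j')) = c i'.
  rewrite /c; apply: (@int_periodic _ (fun j => lab (hz (X i') (Y j)))) => k.
  have [c1 [d1 [r1 [-> _ _ N1]]]] := crossP (crosses i' k).
  have [c2 [d2 [r2 [-> _ S2 _]]]] := crossP (crosses i' (k + 1)).
  by have [_ _] := hcell_between i' k; rewrite /X /Y N1 S2 => -[_ _ ->].
have dE i' j' : dat (hz (X i') (Y j')) = d i'.
  rewrite /d; apply: (@int_periodic _ (fun j => dat (hz (X i') (Y j)))) => k.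
  have [c1 [d1 [r1 [-> _ _ N1]]]] := crossP (crosses i' k).
  have [c2 [d2 [r2 [-> _ S2 _]]]] := crossP (crosses i' (k + 1)).
  by have [_ _] := hcell_between i' k; rewrite /X /Y N1 S2 => -[_ -> _].
have rE i' j' : tag (hz (X i') (Y j')) = r j'.
  rewrite /r; apply: (@int_periodic _ (fun i => tag (hz (X i) (Y j')))) => k.
  have [c1 [d1 [r1 [-> E1 _ _]]]] := crossP (crosses k j').
  have [c2 [d2 [r2 [W2 _ _ _]]]] := crossP (crosses (k + 1) j').
  have [_ _ _ [d']] := vcell_between k j'; rewrite /X /Y E1 W2 /=.
  by case=> _ _ ->.
have [c1 [d1 [r1 [h1 h2 h3 h4]]]] := crossP (crosses i j).
have := cE i j; have := dE i j; have := rE i j; rewrite /X /Y h1 /= => <- <- <-.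
by split.
Qed.

(** Meeting arms have equal labels, whereas the west and east arms of one cross have opposite
    labels. *)
Lemma c_alternate i : c (i + 1) = ~~ c i.
Proof.
have [_ _ _ [d']] := vcell_between i 0.
have [_ -> _ _] := level_data i 0; have [-> _ _ _] := level_data (i + 1) 0.
by case=> ->.
Qed.

Lemma r_alternate j : r (j + 1) = ~~ r j.
Proof.
have [_ _] := hcell_between 0 j.
have [_ _ _ ->] := level_data 0 j; have [_ _ -> _] := level_data 0 (j + 1).
by case=> ->.
Qed.

Lemma Rh_data i : Rh (d i) (d (i + 1)).
Proof.
have [_ + _ _] := vcell_between i 0.
by have [_ -> _ _] := level_data i 0; have [-> _ _ _] := level_data (i + 1) 0.
Qed.

(** On the row through the centre, signals leave the square on both sides, so they diverge at the
    centre; only a cross does that. *)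
Lemma center_cross i j : c i = false -> r j = false -> cross_at (X i + p) (Y j + p).
Proof.
move=> ci rj; set x := X i + p; set y := Y j + p.
have [lath _] := lat.
have rowE i' t : 0 < t <= p -> hz (a + p * i' + t) y = hz (a + p * i' + 1) y.
  have -> : y = b + p * (2 * j + 2) by rewrite /y /Y; lia.
  exact: lath.
have [w1 w2 _] := hcell_between i j; have [w3 w4 _] := hcell_between (i + 1) j.
have [_ _ _ N1] := level_data i j; have [_ _ _ N2] := level_data (i + 1) j.
rewrite N1 /= rj in w2; rewrite N2 /= rj c_alternate ci in w4.
have dW : dir (hz x y) = false.
  by rewrite -ci -w2 // w1; congr dir; apply: rowE; lia.
have dE : dir (hz (x + 1) y) = true.
  rewrite -[RHS]/(~~ false) -w4 //; congr dir; have := rowE (2 * i + 2) p.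
  rewrite (_ : a + p * (2 * i + 2) = x); last by rewrite /x /X; lia.
  by rewrite (_ : x + p = X (i + 1)); [move=> <- //; lia|rewrite /x /X; lia].
have := ok x y; rewrite /tile_ok -/(cross_at x y) => /or3P[//||].
  by case/and4P => /eqP e; rewrite e dE in dW.
by case/and5P => _ /eqP e; rewrite e in dW.
Qed.

Lemma center_Phi i j : c i = false -> r j = false ->
  Phi (d i) (d (i + 1)) (dat (vz (X i + p) (Y j + p))).
Proof.
move=> ci rj.
have [_ _ + _] := vcell_between i j.
have [_ -> _ _] := level_data i j; have [-> _ _ _] := level_data (i + 1) j.
rewrite /= ci => /(_ isT).
rewrite (_ : vz (X i + p) (Y j + p) = vz (X i + p) (Y j + 1)) //.
have -> : X i + p = a + p * (2 * i + 2) by rewrite /X; lia.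
by have [_ latv] := lat; apply: latv; lia.
Qed.

(** An even row passes the columns of crosses unchanged, since W = E in [is_hcell]; this glues the
    constant stretches in pairs. Columns behave likewise. *)
Lemma lattice_double : lattice (2 * p) a b.
Proof.
have [lath latv] := lat; split=> i j t t0.
  have -> : b + 2 * p * j = b + p * (2 * j) by lia.
  have [tp|tp] := leP t p.
    by have := lath (2 * i) (2 * j) t; rewrite (_ : p * (2 * i) = 2 * p * i); [apply; lia|lia].
  have [w1 _ _] := hcell_between i (j - 1).
  rewrite (_ : Y (j - 1) + p = b + p * (2 * j)) in w1; last by rewrite /Y; lia.
  have := lath (2 * i + 1) (2 * j) (t - p).
  rewrite -/(X i) -w1 => e.
  rewrite (_ : a + 2 * p * i + t = X i + (t - p)); last by rewrite /X; lia.
  rewrite e; last by lia.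
  have := lath (2 * i) (2 * j) p.
  rewrite (_ : a + p * (2 * i) + p = X i); last by rewrite /X; lia.
  by rewrite (_ : p * (2 * i) = 2 * p * i); [apply; lia|lia].
have -> : a + 2 * p * i = a + p * (2 * i) by lia.
have [tp|tp] := leP t p.
  by have := latv (2 * i) (2 * j) t; rewrite (_ : p * (2 * j) = 2 * p * j); [apply; lia|lia].
have [w1 _ _ _] := vcell_between (i - 1) j.
rewrite (_ : X (i - 1) + p = a + p * (2 * i)) in w1; last by rewrite /X; lia.
have := latv (2 * i) (2 * j + 1) (t - p).
rewrite -/(Y j) -w1 => e.
rewrite (_ : b + 2 * p * j + t = Y j + (t - p)); last by rewrite /Y; lia.
rewrite e; last by lia.
have := latv (2 * i) (2 * j) p.
rewrite (_ : b + p * (2 * j) + p = Y j); last by rewrite /Y; lia.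
by rewrite (_ : p * (2 * j) = 2 * p * j); [apply; lia|lia].
Qed.

(** s and t select the columns and rows of orientation false, the left and bottom sides of squares;
    the centres of these squares are the crosses of the next level. *)
Lemma next_level : exists s t : bool,
  [/\ lattice (2 * p) (a + 2 * p * s%:Z) (b + 2 * p * t%:Z),
      odd_crosses (2 * p) (a + 2 * p * s%:Z) (b + 2 * p * t%:Z),
      forall i, c (2 * i + s%:Z) = false & forall j, r (2 * j + t%:Z) = false].
Proof.
have [c0 ci] : exists c0 : bool, forall i, c (2 * i - c0%:Z) = false.
  exists (c 0) => i; have := int_alternate (c_alternate) i.
  case c0 : (c 0) => e; last by rewrite subr0.
  by have := c_alternate (2 * i - 1); rewrite subrK e; case: (c _).
have [r0 rj] : exists r0 : bool, forall j, r (2 * j - r0%:Z) = false.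
  exists (r 0) => j; have := int_alternate (r_alternate) j.
  case r0 : (r 0) => e; last by rewrite subr0.
  by have := r_alternate (2 * j - 1); rewrite subrK e; case: (r _).
have [lath latv] := lattice_double.
exists c0, r0; split.
- have ha i : a + 2 * p * (i + c0%:Z) = a + 2 * p * c0%:Z + 2 * p * i by lia.
  have hb j : b + 2 * p * (j + r0%:Z) = b + 2 * p * r0%:Z + 2 * p * j by lia.
  split=> i j t t0.
    by have := lath (i + c0%:Z) (j + r0%:Z) t t0; rewrite ha hb.
  by have := latv (i + c0%:Z) (j + r0%:Z) t t0; rewrite ha hb.
- move=> i j; have := center_cross (ci (i + c0%:Z)) (rj (j + r0%:Z)).
  rewrite (_ : X _ + p = a + 2 * p * c0%:Z + 2 * p * (2 * i + 1)); last by rewrite /X; lia.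
  by rewrite (_ : Y _ + p = b + 2 * p * r0%:Z + 2 * p * (2 * j + 1)) // /Y; lia.
- by move=> i; rewrite -(ci (i + c0%:Z)); congr c; lia.
- by move=> j; rewrite -(rj (j + r0%:Z)); congr r; lia.
Qed.

End Level.

Definition gridpt (p a i : int) := a + p * (2 * i + 1).
Definition lev_c p a b i := lab (hz (gridpt p a i) (gridpt p b 0)).
Definition lev_d p a b i := dat (hz (gridpt p a i) (gridpt p b 0)).
Definition lev_r p a b j := tag (hz (gridpt p a 0) (gridpt p b j)).

Definition level p a b := [/\ 0 < p, lattice p a b & odd_crosses p a b].

Lemma level_cross p a b i j : level p a b ->
  let x := gridpt p a i in let y := gridpt p b j in
  let: (c, d, r) := (lev_c p a b i, lev_d p a b i, lev_r p a b j) in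
  [/\ hz x y = (false, c, d, r), hz (x + 1) y = (true, ~~ c, d, r),
      vz x y = (false, r, d, c) & vz x (y + 1) = (true, ~~ r, d, c)].
Proof. by case=> *; apply: level_data. Qed.

Lemma lev_Rh p a b i : level p a b -> Rh (lev_d p a b i) (lev_d p a b (i + 1)).
Proof. by case=> *; apply: Rh_data. Qed.

Lemma level_next p a b : level p a b -> exists s t : bool,
  let a' := a + 2 * p * s%:Z in let b' := b + 2 * p * t%:Z in
  [/\ level (2 * p) a' b', forall i, lev_c p a b (2 * i + s%:Z) = false,
    forall j, lev_r p a b (2 * j + t%:Z) = false &
    forall i, Phi (lev_d p a b (2 * i + s%:Z)) (lev_d p a b (2 * i + s%:Z + 1)) (lev_d (2 * p) a' b' i)].
Proof.
case=> p0 lat cr; have [s [t [lat' cr' cs rt]]] := next_level p0 lat cr.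
have lev' : level (2 * p) (a + 2 * p * s%:Z) (b + 2 * p * t%:Z) by split=> //; lia.
exists s, t; split=> // i.
have := center_Phi p0 lat cr (cs i) (rt 0).
have [_ _ vE _] := level_cross i 0 lev'.
rewrite (_ : a + p * (2 * (2 * i + s%:Z) + 1) + p = gridpt (2 * p) (a + 2 * p * s%:Z) i);
  last by rewrite /gridpt; lia.
rewrite (_ : b + p * (2 * (2 * 0 + t%:Z) + 1) + p = gridpt (2 * p) (b + 2 * p * t%:Z) 0);
  last by rewrite /gridpt; lia.
by rewrite vE.
Qed.

Lemma row_arm p a b i j x : level p a b ->
  let X := gridpt p a i in X - p < x <= X + p ->
  hz x (gridpt p b j) = (X < x, (if X < x then ~~ lev_c p a b i else lev_c p a b i),
    lev_d p a b i, lev_r p a b j).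
Proof.
move=> lev X xP; have [p0 [lath _] _] := lev.
have [W E _ _] := level_cross i j lev.
have [Xx|xX] := ltP X x.
  rewrite -E -/X; have := lath (2 * i + 1) (2 * j + 1) (x - X).
  rewrite -/(gridpt p a i) -/X -/(gridpt p b j) => <-; last by lia.
  by congr hz; lia.
rewrite -W -/X; have := lath (2 * i) (2 * j + 1) (x - X + p).
have := lath (2 * i) (2 * j + 1) p; rewrite -/(gridpt p b j).
rewrite (_ : a + p * (2 * i) + p = X); last by rewrite /X /gridpt; lia.
move=> ->; last by lia.
by move=> <-; [congr hz; rewrite /X /gridpt|]; lia.
Qed.

Lemma col_arm p a b i j y : level p a b ->
  let Y := gridpt p b j in Y - p < y <= Y + p ->
  vz (gridpt p a i) y = (Y < y, (if Y < y then ~~ lev_r p a b j else lev_r p a b j),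
    lev_d p a b i, lev_c p a b i).
Proof.
move=> lev Y yP; have [p0 [_ latv] _] := lev.
have [_ _ S N] := level_cross i j lev.
have [Yy|yY] := ltP Y y.
  rewrite -N -/Y; have := latv (2 * i + 1) (2 * j + 1) (y - Y).
  rewrite -/(gridpt p a i) -/(gridpt p b j) -/Y => <-; last by lia.
  by congr vz; lia.
rewrite -S -/Y; have := latv (2 * i + 1) (2 * j) (y - Y + p).
have := latv (2 * i + 1) (2 * j) p; rewrite -/(gridpt p a i).
rewrite (_ : b + p * (2 * j) + p = Y); last by rewrite /Y /gridpt; lia.
move=> ->; last by lia.
by move=> <-; [congr vz; rewrite /Y /gridpt|]; lia.
Qed.

End Structure.
End Tiles.

(** * Registers as spacings of marks *)

Section Marks.
Local Open Scope ring_scope.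

Definition progression (mark : int -> bool) (c : nat) (e : int) :=
  forall x, mark x <-> exists q : int, x = e + q * (2 ^ c)%N%:Z.

Lemma progression_count (mark : int -> bool) (iota : int -> int) c e :
  progression mark c e ->
  (forall x : int, iota (x + 1) = ((iota x + (mark (x + 1))%:Z) %% 4)%Z) ->
  exists t : int, forall q : int, (iota (e + q * (2 ^ c)%N%:Z) = (q + t) %[mod 4])%Z.
Proof.
move=> mP iS; have m0 : (0 < 2 ^ c)%N by rewrite expn_gt0.
rewrite /progression in mP; move: (2 ^ c)%N m0 mP => m m0 mP.
have gap q (j : nat) : (j < m)%N -> (iota (e + q * m%:Z + j%:Z) = iota (e + q * m%:Z) %[mod 4])%Z.
  elim: j => [|j IH] jm; first by rewrite addr0.
  rewrite -IH ?(ltnW jm) // -addn1 PoszD addrA iS.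
  case: (boolP (mark _)) => [/mP[q' e']|_] /=; last by rewrite addr0 modz_mod.
  have uE : (q' - q) * m%:Z = j%:Z + 1 by lia.
  have [h|h] := lerP (q' - q) 0.
    have : (q' - q) * m%:Z <= 0 by apply: mulr_le0_ge0.
    by lia.
  have : m%:Z <= (q' - q) * m%:Z by apply: ler_peMl; lia.
  by lia.
have step q : (iota (e + (q + 1) * m%:Z) = iota (e + q * m%:Z) + 1 %[mod 4])%Z.
  have jm : (m.-1 < m)%N by lia.
  have := gap q _ jm; have -> : e + (q + 1) * m%:Z = e + q * m%:Z + m.-1%:Z + 1 by lia.
  rewrite iS; case: (boolP (mark _)) => [_|/negP[]] /=; first by lia.
  by apply/mP; exists (q + 1); lia.
exists (iota e) => q.
have := @int_periodic _ (fun q => ((iota (e + q * m%:Z) - q) %% 4)%Z).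
move=> /(_ _ q); rewrite mul0r addr0 subr0 => h.
have {}h := h (fun q => _); have : ((iota (e + q * m%:Z) - q) %% 4)%Z = (iota e %% 4)%Z.
  by apply: h => {}q; have := step q; lia.
by lia.
Qed.

(** Columns are halved in number from level to level, so keeping one mark out of 4, 2 or 1
    multiplies the spacing by 2, 1 or 1/2. *)
Definition modulus (d : option bool) : nat := if d is Some b then (if b then 4 else 1) else 2.

Lemma progression_next (mark mark' : int -> bool) (iota : int -> int) c e (s : int) (d : option bool) :
  progression mark c e ->
  (forall x : int, iota (x + 1) = ((iota x + (mark (x + 1))%:Z) %% 4)%Z) ->
  let sel (x : int) := mark x && ((iota x %% (modulus d)%:Z)%Z == 0) in
  (forall x : int, mark' x = sel (2 * x + s) || sel (2 * x + s + 1)) ->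
  exists e', progression mark' (shift_reg d c) e'.
Proof.
move=> mP iS sel m'P; have [t tP] := progression_count mP iS.
have selP x : sel x <-> exists q : int, x = (e - t * (2 ^ c)%N%:Z) + q * (2 ^ c * modulus d)%N%:Z.
  rewrite /sel PoszM; split.
    case/andP => /mP[q ->]; have := tP q; move: (iota _) => i h /eqP hi.
    have [u uE] : exists u : int, q + t = u * (modulus d)%:Z.
      case: d {sel m'P} h hi => [[]|] /= h hi;
        [exists ((q + t) %/ 4)%Z|exists (q + t)|exists ((q + t) %/ 2)%Z]; lia.
    exists u; have -> : q = u * (modulus d)%:Z - t by lia.
    by lia.
  case=> q xE; pose q0 := q * (modulus d)%:Z - t.
  have xE' : x = e + q0 * (2 ^ c)%N%:Z by rewrite xE /q0; lia.
  apply/andP; split; first by apply/mP; exists q0.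
  by rewrite xE'; have := tP q0; rewrite /q0; move: (iota _) => i; case: d {sel m'P xE q0 xE'} => [[]|] /=; lia.
(* Decrement at c = 0: all columns are marked and remain so, in accordance with 0.-1 = 0. *)
have [/eqP c1|c1] := boolP ((2 ^ c * modulus d)%N == 1%N).
  have [c0 dd] : c = 0%N /\ d = Some false.
    case: d {sel m'P selP} c1 => [[]|] /= h; [lia| |lia].
    by split=> //; case: c h {mP tP} => // c; rewrite expnS; have := expn_gt0 2 c; lia.
  exists 0 => x; rewrite m'P dd c0 /=; split=> [_|_]; first by exists x; rewrite mulr1 add0r.
  by apply/orP; left; apply/selP; exists (2 * x + s - (e - t * (2 ^ c)%N%:Z)); rewrite c1; lia.
have half : (2 ^ c * modulus d = 2 * 2 ^ shift_reg d c)%N.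
  case: d {sel m'P selP} c1 => [[]|] /=; rewrite ?expnS; try lia.
  by case: c {mP tP} => //= c; rewrite expnS; lia.
rewrite half PoszM in selP; set e0 := e - _ in selP.
rewrite /progression; move: (2 ^ shift_reg d c)%N selP => m selP.
exists ((e0 - s) %/ 2)%Z => x; rewrite m'P; split.
  by case/orP => /selP[q h]; exists q; lia.
case=> q h; apply/orP.
have qE : q * (2%:Z * m%:Z) = 2 * (q * m%:Z) by lia.
have [ev|od] : ((e0 - s) %% 2)%Z = 0 \/ ((e0 - s) %% 2)%Z = 1 by lia.
  by left; apply/selP; exists q; rewrite qE; lia.
by right; apply/selP; exists q; rewrite qE; lia.
Qed.

End Marks.

Section MachineTiles.
Local Open Scope ring_scope.
Variable m : machine.

(** State and zero flags are common to all columns of a level; the mark and the number of marks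
    modulo 4, one pair per register, vary with the column. *)
Definition datum := (mstate m * {ffun 'I_(mreg m) -> bool} * {ffun 'I_(mreg m) -> bool * 'I_4})%type.
Definition dq (d : datum) : mstate m := d.1.1.
Definition dz (d : datum) : 'I_(mreg m) -> bool := d.1.2.
Definition dmark (d : datum) i := (d.2 i).1.
Definition diota (d : datum) i : nat := (d.2 i).2.

(** The zero flag is checked on adjacent columns: both are marked if it is set, never both if it is
    not. At a marked column this ties the flag to the spacing. *)
Definition mRh (d d' : datum) :=
  [&& d.1 == d'.1 &
   [forall i, (diota d' i == (diota d i + dmark d' i) %% 4)%N &&
      (if dz d i then dmark d i && dmark d' i else ~~ (dmark d i && dmark d' i))]].

Definition dsel (d : datum) i := dmark d i && (diota d i %% modulus (mdelta (dq d) i) == 0)%N.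

Definition mPhi (d1 d2 d : datum) :=
  `[< mtrans (dz d1) (dq d1) (dq d) >] && [forall i, dmark d i == dsel d1 i || dsel d2 i].

Definition minit (d : datum) := (dq d == mstart m) && [forall i, dmark d i].

Definition mfree (d : datum) := mout (dq d).

(* A register of value c is represented at level k by a mark on one column of
   level k out of 2^c. *)
Lemma run_of_levels (d : nat -> int -> datum) (s : nat -> int) :
  (forall k x, mRh (d k x) (d k (x + 1))) ->
  (forall k x, mPhi (d k (2 * x + s k)) (d k (2 * x + s k + 1)) (d k.+1 x)) ->
  (forall x, minit (d 0 x)) ->
  exists q c, [/\ @mrun m q c & forall k x, dq (d k x) = q k].
Proof.
move=> dR dP di.
have d1E k x : (d k x).1 = (d k 0).1.
  by apply: (@int_periodic _ (fun x => (d k x).1)) => {}x; have /andP[/eqP ->] := dR k x.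
have iS k i x : (diota (d k (x + 1)) i)%:Z =
    (((diota (d k x) i)%:Z + (dmark (d k (x + 1)) i)%:Z) %% 4)%Z.
  by have /andP[_ /forallP /(_ i) /andP[/eqP -> _]] := dR k x; rewrite -PoszD modz_nat.
have step k i c : (exists e, progression (fun x => dmark (d k x) i) c e) ->
    exists e, progression (fun x => dmark (d k.+1 x) i) (shift_reg (mdelta (dq (d k 0)) i) c) e.
  case=> e eP; apply: (progression_next (s := s k) eP (iS k i)) => x.
  have /andP[_ /forallP /(_ i) /eqP ->] := dP k x.
  by rewrite /dsel /dq !d1E !modz_nat.
pose c k i := iteri k (fun j => shift_reg (mdelta (dq (d j 0)) i)) 0%N.
have cP k i : exists e, progression (fun x => dmark (d k x) i) (c k i) e.
  elim: k => [|k IH]; last exact: step.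
  exists 0 => x; have /andP[_ /forallP /(_ i) ->] := di x.
  by split=> // _; exists x; rewrite /= mulr1 add0r.
have zP k i : dz (d k 0) i = (c k i == 0%N).
  have [e eP] := cP k i; have /andP[_ /forallP /(_ i) /andP[_]] := dR k e.
  rewrite (_ : dz (d k e) i = dz (d k 0) i); last by rewrite /dz d1E.
  have m1 : dmark (d k e) i by apply/eP; exists 0; rewrite mul0r addr0.
  rewrite m1 /=; case: (dz _ _) => [/eP[q h]|/negP h]; apply/esym/eqP.
    have {h} : q * (2 ^ c k i)%N%:Z = 1 by lia.
    case: (c k i) => // n; rewrite expnS PoszM => h.
    have : 2 * (q * (2 ^ n)%N%:Z) = 1 by lia.
    lia.
  by move=> c0; apply: h; apply/eP; exists 1; rewrite c0; lia.
exists (fun k => dq (d k 0)), c; split; last by move=> k x; rewrite /dq d1E.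
split=> // [|k]; first by have /andP[/eqP] := di 0.
have /andP[/asboolP + _] := dP k 0; rewrite /dq !d1E -/(dq (d k 0)).
rewrite (_ : dz _ = fun i => c k i == 0%N) //.
by apply: funext => i; rewrite -zP /dz d1E.
Qed.

End MachineTiles.

Lemma dependent_choice_nat (S : Type) (P : nat -> S -> Prop) (Q : nat -> S -> S -> Prop) (x0 : S) :
  P 0 x0 -> (forall k x, P k x -> exists y, P k.+1 y /\ Q k x y) ->
  exists f : nat -> S, [/\ f 0 = x0, forall k, P k (f k) & forall k, Q k (f k) (f k.+1)].
Proof.
move=> P0 PS.
have /choice[g gP] : forall kx : nat * S, exists y, P kx.1 kx.2 -> P kx.1.+1 y /\ Q kx.1 kx.2 y.
  move=> [k x] /=; have [/PS[y yP]|nP] := pselect (P k x); first by exists y.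
  by exists x.
pose f := fix f k := if k is j.+1 then g (j, f j) else x0.
have fP k : P k (f k) by elim: k => [|k IH] //=; have [] := gP (k, f k) IH.
by exists f; split=> // k; have [] := gP (k, f k) (fP k).
Qed.

(** * Tilings with free bits, and their levels *)

Section Cells.
Local Open Scope ring_scope.
Variable D : finType.
Variables (Rh : rel D) (Phi : D -> D -> D -> bool) (init free : pred D).

(* West, east, south and north signals, a free bit, and the parities of the
   coordinates, which force a cross of level 0 at every other position. *)
Definition cell := (edge D * edge D * edge D * edge D * bool * bool * bool)%type.
Definition cW (q : cell) := q.1.1.1.1.1.1.
Definition cE (q : cell) := q.1.1.1.1.1.2.
Definition cS (q : cell) := q.1.1.1.1.2.
Definition cN (q : cell) := q.1.1.1.2.
Definition cbit (q : cell) := q.1.1.2.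
Definition cpx (q : cell) := q.1.2.
Definition cpy (q : cell) := q.2.

Definition cell_cross q := is_cross (cW q) (cE q) (cS q) (cN q).

Definition cell_ok q :=
  [&& tile_ok Rh Phi (cW q) (cE q) (cS q) (cN q),
      cbit q ==> cell_cross q && free (dat (cW q)) &
      cpx q && cpy q ==> cell_cross q && init (dat (cW q))].

Definition cell_h q q' :=
  [&& cell_ok q, cell_ok q', cE q == cW q', cpx q' == ~~ cpx q & cpy q == cpy q'].
Definition cell_v q q' :=
  [&& cell_ok q, cell_ok q', cN q == cS q', cpx q == cpx q' & cpy q' == ~~ cpy q].

Definition wang (w : int -> int -> cell) :=
  (forall x y, cell_h (w x y) (w (x + 1) y)) /\ (forall x y, cell_v (w x y) (w x (y + 1))).

Definition pow2 k : int := (2 ^ k)%N%:Z.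

Lemma pow2S k : pow2 k.+1 = 2 * pow2 k.
Proof. by rewrite /pow2 expnS PoszM. Qed.

Lemma pow2_gt0 k : 0 < pow2 k.
Proof. by rewrite /pow2 ltz_nat expn_gt0. Qed.

Lemma parity_alternate (f : int -> bool) : (forall i, f (i + 1) = ~~ f i) -> f 0 = false ->
  forall i, f i = ((i %% 2)%Z == 1).
Proof.
move=> fS f0 i; have := int_alternate fS (i %/ 2)%Z; rewrite f0 => e.
have [m|m] : ((i %% 2)%Z = 0) \/ ((i %% 2)%Z = 1) by lia.
  by have -> : f i = false; [rewrite -e; congr f; lia|rewrite m].
by have -> : f i = ~~ false; [rewrite -e -fS; congr f; lia|rewrite m].
Qed.

Variable w : int -> int -> cell.
Hypothesis wP : wang w.
Let hz x y := cW (w x y).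
Let vz x y := cS (w x y).

Lemma wang_E x y : cE (w x y) = hz (x + 1) y.
Proof. by have [/(_ x y)/and5P[_ _ /eqP]] := wP. Qed.

Lemma wang_N x y : cN (w x y) = vz x (y + 1).
Proof. by have [_ /(_ x y)/and5P[_ _ /eqP]] := wP. Qed.

Lemma wang_tile x y : tile_ok Rh Phi (hz x y) (hz (x + 1) y) (vz x y) (vz x (y + 1)).
Proof. by rewrite -wang_E -wang_N; have [/(_ x y)/and5P[/and3P[]]] := wP. Qed.

Lemma wang_ok x y : cell_ok (w x y).
Proof. by have [/(_ x y)/and5P[]] := wP. Qed.

Lemma wang_levels : exists (a b : nat -> int) (s t : nat -> bool), [/\
  [/\ forall k, level hz vz (pow2 k) (a k) (b k),
    forall k, a k.+1 = a k + 2 * pow2 k * (s k)%:Z & forall k, b k.+1 = b k + 2 * pow2 k * (t k)%:Z],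
  [/\ forall k i, lev_c hz (pow2 k) (a k) (b k) (2 * i + (s k)%:Z) = false,
      forall k j, lev_r hz (pow2 k) (a k) (b k) (2 * j + (t k)%:Z) = false,
      forall k i, Phi (lev_d hz (pow2 k) (a k) (b k) (2 * i + (s k)%:Z))
        (lev_d hz (pow2 k) (a k) (b k) (2 * i + (s k)%:Z + 1))
        (lev_d hz (pow2 k.+1) (a k.+1) (b k.+1) i) &
      forall i, init (lev_d hz (pow2 0%N) (a 0%N) (b 0%N) i)] &
  forall x y, cpx (w x y) = (((x - a 0%N) %% 2)%Z == 1) /\ cpy (w x y) = (((y - b 0%N) %% 2)%Z == 1)].
Proof.
have [wh wv] := wP.
have pxS x y : cpx (w (x + 1) y) = ~~ cpx (w x y) by have /and5P[_ _ _ /eqP] := wh x y.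
have pyS x y : cpy (w x (y + 1)) = ~~ cpy (w x y) by have /and5P[_ _ _ _ /eqP] := wv x y.
have px0 x y : cpx (w x y) = cpx (w x 0).
  by apply: (@int_periodic _ (fun y => cpx (w x y))) => {}y; have /and5P[_ _ _ /eqP] := wv x y.
have py0 x y : cpy (w x y) = cpy (w 0 y).
  by apply: (@int_periodic _ (fun x => cpy (w x y))) => {}x; have /and5P[_ _ _ _ /eqP] := wh x y.
have [a0 a0P] : exists a0, cpx (w a0 0) = false.
  by case e : (cpx (w 0 0)); [exists (0 + 1); rewrite pxS e|exists 0].
have [b0 b0P] : exists b0, cpy (w 0 b0) = false.
  by case e : (cpy (w 0 0)); [exists (0 + 1); rewrite pyS e|exists 0].
have pxE x y : cpx (w x y) = (((x - a0) %% 2)%Z == 1).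
  rewrite px0 -(@parity_alternate (fun i => cpx (w (a0 + i) 0))) ?addr0 //; first by congr (cpx (w _ _)); lia.
  by move=> i; rewrite addrA pxS.
have pyE x y : cpy (w x y) = (((y - b0) %% 2)%Z == 1).
  rewrite py0 -(@parity_alternate (fun i => cpy (w 0 (b0 + i)))) ?addr0 //; first by congr (cpy (w _ _)); lia.
  by move=> i; rewrite addrA pyS.
have cross0 i j : let q := w (a0 + (2 * i + 1)) (b0 + (2 * j + 1)) in
    cell_cross q && init (dat (cW q)).
  move=> q; have /and3P[_ _ /implyP] := wang_ok (a0 + (2 * i + 1)) (b0 + (2 * j + 1)).
  by apply; rewrite pxE pyE; apply/andP; split; apply/eqP; lia.
have lev0 : level hz vz (pow2 0%N) a0 b0.
  rewrite (_ : pow2 0%N = 1) //; split=> //; first by split=> i j t tP; (have -> : t = 1 by lia).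
  by move=> i j; rewrite !mul1r /cross_at -wang_E -wang_N; have /andP[] := cross0 i j.
pose P k (ab : int * int) := level hz vz (pow2 k) ab.1 ab.2.
pose Q k (ab ab' : int * int) := exists s t : bool, [/\
  ab' = (ab.1 + 2 * pow2 k * s%:Z, ab.2 + 2 * pow2 k * t%:Z),
  forall i, lev_c hz (pow2 k) ab.1 ab.2 (2 * i + s%:Z) = false,
  forall j, lev_r hz (pow2 k) ab.1 ab.2 (2 * j + t%:Z) = false &
  forall i, Phi (lev_d hz (pow2 k) ab.1 ab.2 (2 * i + s%:Z))
     (lev_d hz (pow2 k) ab.1 ab.2 (2 * i + s%:Z + 1)) (lev_d hz (pow2 k.+1) ab'.1 ab'.2 i)].
have [|f [f0 fP fQ]] := @dependent_choice_nat _ P Q (a0, b0) lev0.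
  move=> k [a b] /= lev; have [s [t /= [lev' hc hr hP]]] := level_next wang_tile lev.
  exists (a + 2 * pow2 k * s%:Z, b + 2 * pow2 k * t%:Z); rewrite /P /= pow2S; split=> //.
  by exists s, t; rewrite pow2S.
have /choice[s /choice[t stP]] := fQ.
exists (fun k => (f k).1), (fun k => (f k).2), s, t; split.
- by split=> // k; have [-> _ _ _] := stP k.
- split=> [k i|k j|k i|i]; try by have [_ ? ? ?] := stP k.
  rewrite f0 /lev_d /gridpt !mul1r; have := cross0 i 0.
  by case/andP.
- by move=> x y; rewrite f0.
Qed.

End Cells.

Section MachineRun.
Local Open Scope ring_scope.
Variable m : machine.

Definition mwang := wang (@mRh m) (@mPhi m) (@minit m) (@mfree m).

Lemma wang_run w (a b : nat -> int) (s t : nat -> bool) : mwang w ->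
  let hz x y := cW (w x y) in let vz x y := cS (w x y) in
  (forall k, level hz vz (pow2 k) (a k) (b k)) ->
  (forall k i, mPhi (lev_d hz (pow2 k) (a k) (b k) (2 * i + (s k)%:Z))
        (lev_d hz (pow2 k) (a k) (b k) (2 * i + (s k)%:Z + 1))
        (lev_d hz (pow2 k.+1) (a k.+1) (b k.+1) i)) ->
  (forall i, minit (lev_d hz (pow2 0%N) (a 0%N) (b 0%N) i)) ->
  exists2 beta, moutput m beta &
    forall k i, mfree (lev_d hz (pow2 k) (a k) (b k) i) = beta k.
Proof.
move=> wP hz vz lev hP hi.
have [|q [c [run qE]]] := @run_of_levels m (fun k => lev_d hz (pow2 k) (a k) (b k)) (fun k => (s k)%:Z) _ hP hi.
  by move=> k x; apply: (lev_Rh (wang_tile wP) _ (lev k)).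
exists (fun k => mout (q k)); first by exists q, c.
by move=> k i; rewrite /mfree qE.
Qed.

End MachineRun.

(** * Tilings from runs *)

Section Valuation.
Local Open Scope ring_scope.

(* The 2-adic valuation of x + 1/3; the centre -1/3 of the hierarchy is not an
   integer, so that every integer has a level. *)
Definition lev (x : int) : nat := logn 2 (absz (3 * x + 1)%R).

Lemma levE k x : lev x = k <-> exists o, 3 * x + 1 = pow2 k * (2 * o + 1).
Proof.
have nz : (0 < absz (3 * x + 1)%R)%N by lia.
rewrite /pow2; split=> [<-|[ o e]].
  have [u u1 uE] := pfactor_coprime (isT : prime 2) nz.
  have [v vE] : exists v : int, (u%:Z = 2 * v + 1).
    by exists (u %/ 2)%N%:Z; have := divn_eq u 2; rewrite modn2 -coprime2n u1; lia.
  rewrite -/(lev x) in uE *; rewrite mulnC in uE.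
  have := abszE (3 * x + 1); rewrite uE.
  have [h|h] := lerP 0 (3 * x + 1).
    by rewrite ger0_norm // PoszM vE => <-; exists v.
  rewrite ltr0_norm // PoszM vE => e; exists (- v - 1).
  have -> : 3 * x + 1 = - (- (3 * x + 1)) by lia.
  by rewrite -e; lia.
rewrite /lev e abszM absz_nat lognM ?expn_gt0 //; last by lia.
by rewrite pfactorK // lognE dvdn2 [odd _](_ : _ = true) ?andbF ?addn0 //; lia.
Qed.

Lemma lev_gt k x : (k < lev x)%N <-> exists o, 3 * x + 1 = pow2 k * (2 * o).
Proof.
split=> [kl|[ o e]].
  have [ o ->] := (levE _ x).1 erefl; exists (pow2 (lev x - k.+1) * (2 * o + 1)).
  have -> : pow2 (lev x) = pow2 k * 2 * pow2 (lev x - k.+1).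
    by rewrite [_ * 2]mulrC -pow2S /pow2 -PoszM -expnD subnKC.
  by lia.
have nz : (0 < absz (3 * x + 1)%R)%N by lia.
rewrite /lev -pfactor_dvdn // e abszM abszM absz_nat expnSr dvdn_mul //.
by rewrite dvdn_mulr.
Qed.

Lemma pow2_mod3 k : (pow2 k %% 3)%Z != 0.
Proof. by elim: k => // k; rewrite pow2S; lia. Qed.

Lemma lev_unique k x x' o o' : 3 * x + 1 = pow2 k * (2 * o + 1) ->
  3 * x' + 1 = pow2 k * (2 * o' + 1) -> exists u, x' = x + 2 * pow2 k * u /\ o' = o + 3 * u.
Proof.
have := pow2_mod3 k; have := pow2_gt0 k; move: (pow2 k) => p p0 p3 h h'.
have e : 3 * (x' - x) = 2 * (p * (o' - o)) by lia.
have o3 : ((o' - o) %% 3)%Z = 0.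
  have [t tE] : exists t, o' - o = 3 * t + ((o' - o) %% 3)%Z by exists ((o' - o) %/ 3)%Z; lia.
  have [m|[m|m]] : ((o' - o) %% 3)%Z = 0 \/ ((o' - o) %% 3)%Z = 1 \/ ((o' - o) %% 3)%Z = 2 by lia.
  - by [].
  - by rewrite m in tE; rewrite tE in e; lia.
  - by rewrite m in tE; rewrite tE in e; lia.
exists ((o' - o) %/ 3)%Z; have [u uE] : exists u, o' - o = 3 * u by exists ((o' - o) %/ 3)%Z; lia.
rewrite uE in e *; have -> : ((3 * u) %/ 3)%Z = u by lia.
by split; lia.
Qed.

Lemma lev_shift k x u : lev x = k -> lev (x + 2 * pow2 k * u) = k.
Proof. by move=> /levE[ o e]; apply/levE; exists (o + 3 * u); rewrite mulrDr; lia. Qed.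

Lemma lev_mid k x : lev x = k -> (k < lev (x + pow2 k)%R)%N /\ (k < lev (x - pow2 k)%R)%N.
Proof.
by move=> /levE[ o e]; split; apply/lev_gt; [exists (o + 2)|exists (o - 1)]; lia.
Qed.

Lemma lev_around k y : (k < lev y)%N -> lev (y + pow2 k) = k /\ lev (y - pow2 k) = k.
Proof.
by move=> /lev_gt[ o e]; split; apply/levE; [exists (o + 1)|exists (o - 2)]; lia.
Qed.

(** The orientation c of the tiling to be built: to the right of a left side, the midpoint to the
    next column of the same level has the next level, and carries centres of squares. *)
Definition right_side x := lev (x + pow2 (lev x)) != (lev x).+1.

Lemma right_sideE k x o : 3 * x + 1 = pow2 k * (2 * o + 1) -> right_side x = ((o %% 2)%Z == 0).
Proof.
move=> e; have lx : lev x = k by apply/levE; exists o.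
rewrite /right_side lx.
have e' : 3 * (x + pow2 k) + 1 = pow2 k.+1 * (o + 2) by rewrite pow2S; lia.
apply/idP/idP => [|/eqP o2].
  apply: contraNT => o2; apply/eqP/levE; exists ((o + 1) %/ 2)%Z; rewrite e'; congr (_ * _); lia.
apply/eqP => /levE[v]; rewrite e'; have := pow2_gt0 k.+1; move: (pow2 k.+1) => p p0 /(mulfI _).
by move=> /(_ (lt0r_neq0 p0)); lia.
Qed.

Lemma right_side_shift k x : lev x = k -> right_side (x + 2 * pow2 k) = ~~ right_side x.
Proof.
move=> /levE[ o e]; have e' : 3 * (x + 2 * pow2 k) + 1 = pow2 k * (2 * (o + 3) + 1) by lia.
by rewrite (right_sideE e) (right_sideE e'); lia.
Qed.

Lemma lev_exists n x : exists X, lev X = n /\ X - pow2 n < x <= X + pow2 n.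
Proof.
have half (o : int) : exists v, o = 2 * v \/ o = 2 * v + 1 by exists (o %/ 2)%Z; lia.
have ge (y : int) : exists Y, y <= Y < y + pow2 n /\ exists o, 3 * Y + 1 = pow2 n * o.
  elim: n => [|n [Y [yY [ o e]]]].
    by exists y; split; [rewrite /pow2; lia|exists (3 * y + 1); rewrite /pow2; lia].
  have [v [vE|vE]] := half o; rewrite pow2S vE in e *.
    by exists Y; split; [lia|exists v; lia].
  by exists (Y + pow2 n); split; [lia|exists (v + 2); lia].
have p0 := pow2_gt0 n.
have [Y [yY [ o e]]] := ge (x - pow2 n).
have [v [vE|vE]] := half o; rewrite vE in e.
  by exists (Y + pow2 n); split; [apply/levE; exists (v + 1); lia|lia].
by exists Y; split; [apply/levE; exists v|lia].
Qed.

Lemma lev_near_unique n x X X' : lev X = n -> lev X' = n ->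
  X - pow2 n < x <= X + pow2 n -> X' - pow2 n < x <= X' + pow2 n -> X = X'.
Proof.
move=> /levE[ o e] /levE[ o' e'] xX xX'; have [u [xE _]] := lev_unique e e'.
have p0 := pow2_gt0 n; have [u0|u0] : u = 0 \/ u <> 0 by lia.
  by rewrite xE u0 mulr0 addr0.
have : pow2 n <= pow2 n * `|u| by rewrite ler_peMr; lia.
have : pow2 n * u = pow2 n * `|u| \/ pow2 n * u = - (pow2 n * `|u|).
  by have [h|h] := lerP 0 u; [left; rewrite ger0_norm|right; rewrite ltr0_norm // mulrN opprK].
lia.
Qed.

End Valuation.

Section Build.
Local Open Scope ring_scope.
Variable D : finType.
Variables (Rh : rel D) (Phi : D -> D -> D -> bool) (init free : pred D).
Variable d : int -> D.
Hypothesis dR : forall k x, lev x = k -> Rh (d x) (d (x + 2 * pow2 k)).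
Hypothesis dP : forall k x, lev x = k -> right_side x = false ->
  Phi (d x) (d (x + 2 * pow2 k)) (d (x + pow2 k)).
Hypothesis di : forall x, lev x = 0 -> init (d x).

(** The cross of level n whose arm covers the edge between x - 1 and x, hence the half-open
    interval. By [lev_exists] there is always one, so the default 0 is never taken. *)
Definition near_lev (n : nat) (x : int) : int := xget 0 [set X | lev X = n /\ X - pow2 n < x <= X + pow2 n].

Lemma near_levE n x X : lev X = n -> X - pow2 n < x <= X + pow2 n -> near_lev n x = X.
Proof.
move=> lX xX; rewrite /near_lev; case: xgetP => [Y _ [lY xY]|nY].
  exact: lev_near_unique lY lX xY xX.
by case: (nY X).
Qed.

Definition arm (x X : int) (dd : D) (o : bool) : edge D :=
  (X < x, (if X < x then ~~ right_side X else right_side X), dd, o).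

Definition bh x y := let X := near_lev (lev y) x in arm x X (d X) (right_side y).
Definition bv x y := arm y (near_lev (lev x) y) (d x) (right_side x).

Definition bcell (f : int -> int -> bool) x y : cell D :=
  (bh x y, bh (x + 1) y, bv x y, bv x (y + 1),
   [&& f x y, lev x == lev y & free (d x)], lev x == 0%N, lev y == 0%N).

Lemma near_self n x : lev x = n -> near_lev n x = x /\ near_lev n (x + 1) = x.
Proof. by move=> lx; have := pow2_gt0 n; split; apply: near_levE => //; lia. Qed.

Lemma near_mid n x : (n < lev x)%N ->
  near_lev n x = x - pow2 n /\ near_lev n (x + 1) = x + pow2 n.
Proof.
move=> /lev_around[l1 l2]; have := pow2_gt0 n.
by split; apply: near_levE => //; lia.
Qed.

(** A row of level n passes column x inside a single arm. If x has level n - 1, it bounds the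
    squares centred on column X, and the last clause tells on which side. *)
Lemma near_below n x : (lev x < n)%N -> exists X,
  [/\ near_lev n x = X, near_lev n (x + 1) = X, (X < x) = (X < x + 1) &
   lev x = n.-1 -> X = if right_side x then x - pow2 n.-1 else x + pow2 n.-1].
Proof.
move=> xn; have [X [lX xX]] := lev_exists n x.
have p0 := pow2_gt0 n.
have nX : x <> X by move=> e; rewrite e lX ltnn in xn.
have nX' : x <> X + pow2 n by move=> e; have [] := lev_mid lX; rewrite -e; lia.
exists X; split; [exact: near_levE|apply: near_levE; lia|lia|].
move=> lx; apply: (lev_near_unique lX) xX _.
  have n0 : n = (lev x).+1 by lia.
  rewrite n0 in lx *; rewrite /= in lx *.
  case: ifP => r; last by move/negbFE: r => /eqP.
  have l2 : lev (x - 2 * pow2 (lev x)) = lev x by have := lev_shift (-1) (erefl (lev x)); rewrite mulrN1.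
  have := right_side_shift l2; rewrite subrK r => /esym/negbTE.
  by rewrite /right_side l2 => /negbFE/eqP <-; congr lev; lia.
have : pow2 n = 2 * pow2 n.-1 by rewrite -pow2S prednK //; lia.
by have := pow2_gt0 n.-1; case: ifP => _; lia.
Qed.

(** The levels decide the kind of tile: equal ones give a cross; otherwise the arms of the line of
    lower level meet at (x, y). *)
Lemma bcell_ok f x y : cell_ok Rh Phi init free (bcell f x y).
Proof.
have cross : lev x = lev y -> is_cross (bh x y) (bh (x + 1) y) (bv x y) (bv x (y + 1)).
  move=> e; rewrite /is_cross /bh /bv /arm e.
  have [-> ->] := near_self e; have [-> ->] := near_self (erefl (lev y)).
  have -> : (x < x + 1) by lia. have -> : (y < y + 1) by lia.
  by rewrite !ltxx /lab /dat /tag /= !eqxx.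
apply/and3P; split; rewrite /bcell /cW /cE /cS /cN /cbit /cpx /cpy /=; last 2 first.
- by apply/implyP => /and3P[_ /eqP e fd]; rewrite /cell_cross /cW /cE /cS /cN /= cross //= /bh -e /arm /dat /= (near_self (erefl (lev x))).1.
- apply/implyP => /andP[/eqP lx /eqP ly]; have e : lev x = lev y by rewrite lx ly.
  by rewrite /cell_cross /cW /cE /cS /cN /= cross //= /bh -e /arm /dat /= (near_self (erefl (lev x))).1 di.
rewrite /tile_ok; case: (ltngtP (lev x) (lev y)) => [xy|yx|e]; last by rewrite cross.
- apply/orP; right; apply/orP; left.
  have [n1 n2] := near_mid xy; have [X [n3 n4 dE XE]] := near_below xy.
  have p0 := pow2_gt0 (lev x).
  have [l1 l2] := lev_around xy.
  rewrite /is_hcell /bh /bv n1 n2 n3 n4 /arm /lab /dat /tag /dir /= -dE !eqxx /=.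
  have -> : (y - pow2 (lev x) < y) by lia.
  have -> : (y + pow2 (lev x) < y + 1) = false by lia.
  have -> : right_side (y + pow2 (lev x)) = ~~ right_side (y - pow2 (lev x)).
    by rewrite -(right_side_shift l2); congr right_side; lia.
  rewrite !eqxx /=; apply/implyP => r.
  have {r} ly : lev y = (lev x).+1.
    by move: (negbTE r); rewrite /right_side l2 subrK => /negbFE/eqP.
  by rewrite XE ly //=; case: (right_side x); lia.
- apply/orP; right; apply/orP; right.
  have [n1 n2] := near_mid yx; have [Y [n3 n4 dE YE]] := near_below yx.
  have p0 := pow2_gt0 (lev y).
  have [l1 l2] := lev_around yx.
  rewrite /is_vcell /bh /bv n1 n2 n3 n4 /arm /lab /dat /tag /dir /= -dE !eqxx /=.
  have -> : (x - pow2 (lev y) < x) by lia.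
  have -> : (x + pow2 (lev y) < x + 1) = false by lia.
  have xE : x + pow2 (lev y) = x - pow2 (lev y) + 2 * pow2 (lev y) by lia.
  have -> : right_side (x + pow2 (lev y)) = ~~ right_side (x - pow2 (lev y)).
    by rewrite -(right_side_shift l2) xE.
  rewrite !eqxx /= {1}xE dR //=; apply/implyP => r.
  have lx : lev x = (lev y).+1.
    by move: (negbTE r); rewrite /right_side l2 subrK => /negbFE/eqP.
  apply/andP; split; first by rewrite YE lx //=; case: (right_side y); lia.
  by have := dP l2 (negbTE r); rewrite -xE subrK.
Qed.

Lemma build_wang f : wang Rh Phi init free (bcell f).
Proof.
have l0 x : (lev x == 0%N) = ((x %% 2)%Z == 0).
  apply/eqP/eqP => [/levE[ o]|m]; first by rewrite /pow2; lia.
  by apply/levE; exists (3 * (x %/ 2)%Z); rewrite /pow2; lia.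
split=> x y; apply/and5P; split; rewrite ?bcell_ok //; rewrite /bcell /cE /cW /cN /cS /cpx /cpy //=.
  by rewrite !l0; lia.
by rewrite !l0; lia.
Qed.

End Build.

(** * Data of the levels computed from a run *)

Section MachineData.
Local Open Scope ring_scope.

Lemma dvdz_pow2_3 k u : (pow2 k %| 3 * u)%Z = (pow2 k %| u)%Z.
Proof.
apply: Gauss_dvdzr; rewrite /pow2 coprimezE !absz_nat coprimeXl //.
Qed.

Lemma dvdz_addl (a b x : int) : (x %| a)%Z -> (x %| a + b)%Z = (x %| b)%Z.
Proof. exact: rpredDl. Qed.

Lemma divz_succ (G u : int) : 0 < G -> ((u + 1) %/ G)%Z = (u %/ G)%Z + (G %| u + 1)%Z%:Z.
Proof.
move=> G0; have uE := divz_eq u G; have r0 := modz_ge0 u (lt0r_neq0 G0); have r1 := ltz_pmod u G0.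
move: (u %/ G)%Z (u %% G)%Z uE r0 r1 => a r -> r0 r1.
have [h|h] := ltP (r + 1) G.
  rewrite -addrA divzMDl ?lt0r_neq0 // divz_small; last by lia.
  rewrite (_ : (G %| _)%Z = false) //; apply/negP => /dvdzP[q e].
  have e' : (q - a) * G = r + 1 by lia.
  have [h'|h'] := lerP (q - a) 0.
    have : (q - a) * G <= 0 by apply: mulr_le0_ge0 => //; lia.
    lia.
  have : G <= (q - a) * G by apply: ler_peMl; lia.
  lia.
have -> : a * G + r + 1 = (a + 1) * G by lia.
by rewrite mulzK ?lt0r_neq0 // dvdz_mull.
Qed.

Variables (m : machine) (q : nat -> mstate m) (c : nat -> 'I_(mreg m) -> nat).
Hypothesis run : mrun q c.

Lemma base_exists k g : exists e, lev e = k /\ exists s, 3 * (e + pow2 k) + 1 = pow2 k.+1 * (4 * pow2 g * s).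
Proof.
have [X [lX _]] := lev_exists (k + 3 + g) 0.
have kX : (k < lev X)%N by rewrite lX; lia.
exists (X - pow2 k); split; first by have [] := lev_around kX.
have [ o oE] := (levE _ _).1 lX; exists (2 * o + 1); rewrite subrK oE.
have -> : pow2 (k + 3 + g) = pow2 k.+1 * (4 * pow2 g).
  rewrite /pow2 -[4]/(Posz (2 ^ 2)%N) -!PoszM -!expnD; congr (Posz (2 ^ _)%N); lia.
by rewrite !mulrA.
Qed.

(** Origin for numbering the marks of a register of value g on level k. The extra factor 4 makes the
    number of the mark correct modulo 4, so that the selection agrees with the marks of the next
    level. *)
Definition base k g : int := xget 0 [set e | lev e = k /\ exists s, 3 * (e + pow2 k) + 1 = pow2 k.+1 * (4 * pow2 g * s)].

Lemma baseP k g : lev (base k g) = k /\ exists s, 3 * (base k g + pow2 k) + 1 = pow2 k.+1 * (4 * pow2 g * s).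
Proof.
rewrite /base; case: xgetP => [e _ //|ne].
by have [e eP] := base_exists k g; case: (ne e).
Qed.

(** Marks are defined by a divisibility that refers to the centre -1/3, the same for all levels;
    this makes the marks of successive levels fit. *)
Definition has_mark k g (x : int) : bool := (pow2 (k.+1 + g) %| 3 * (x + pow2 k) + 1)%Z.
Definition count_mark k g (x : int) : 'I_4 := inord (absz (modz (divz (x - base k g) (pow2 (k.+1 + g))) 4)).

Definition mdata (x : int) : datum m := let k := lev x in
  (q k, [ffun i => c k i == 0%N], [ffun i => (has_mark k (c k i) x, count_mark k (c k i) x)]).

Lemma mark_coord k g x : lev x = k -> exists u s : int, [/\ x = base k g + 2 * pow2 k * u,
  3 * (x + pow2 k) + 1 = pow2 k.+1 * (4 * pow2 g * s + 3 * u),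
  has_mark k g x = (pow2 g %| u)%Z /\
    (nat_of_ord (count_mark k g x))%:Z = ((u %/ pow2 g)%Z %% 4)%Z &
  has_mark k g (x + 2 * pow2 k) = (pow2 g %| u + 1)%Z /\
    (nat_of_ord (count_mark k g (x + 2 * pow2 k)))%:Z = (((u + 1) %/ pow2 g)%Z %% 4)%Z].
Proof.
move=> lx; have [le [s sE]] := baseP k g.
have [ o1 h1] := (levE _ _).1 le; have [ o2 h2] := (levE _ _).1 lx.
have [u [xE _]] := lev_unique h1 h2.
have pE : pow2 (k.+1 + g) = pow2 k.+1 * pow2 g by rewrite /pow2 expnD PoszM.
have p0 := pow2_gt0 k.+1; have p0' := lt0r_neq0 p0.
have VE (v : int) : 3 * (base k g + 2 * pow2 k * v + pow2 k) + 1 = pow2 k.+1 * (4 * pow2 g * s + 3 * v).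
  by move: sE; rewrite pow2S; lia.
have mE (v : int) : has_mark k g (base k g + 2 * pow2 k * v) = (pow2 g %| v)%Z.
  rewrite /has_mark pE VE (dvdz_mul2l p0') -(dvdz_pow2_3 g v).
  by rewrite mulrAC dvdz_addl // dvdz_mull.
have cE (v : int) : (nat_of_ord (count_mark k g (base k g + 2 * pow2 k * v)))%:Z = ((v %/ pow2 g)%Z %% 4)%Z.
  rewrite /count_mark addrC addKr pE -pow2S divzMpl //.
  by rewrite inordK ?abszE ?ger0_norm; lia.
have x'E : x + 2 * pow2 k = base k g + 2 * pow2 k * (u + 1) by lia.
by exists u, s; rewrite x'E xE VE !mE !cE.
Qed.

Lemma mdata_Rh k x : lev x = k -> mRh (mdata x) (mdata (x + 2 * pow2 k)).
Proof.
move=> lx; have lx' : lev (x + 2 * pow2 k) = k by have := lev_shift 1 lx; rewrite mulr1.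
apply/andP; split; first by rewrite /mdata lx lx'.
apply/forallP => i; rewrite /dmark /diota /dz /mdata lx lx' /= !ffunE /=.
have [u [s [_ _ [-> c1] [-> c2]]]] := mark_coord (c k i) lx.
have G0 := pow2_gt0 (c k i).
apply/andP; split.
  rewrite -eqz_nat c2 divz_succ // -modz_nat PoszD c1; lia.
case: eqP => [->|c0]; first by rewrite /pow2 !dvd1z.
apply/negP => /andP[/dvdzP[a aE] /dvdzP[b bE]].
have G2 : pow2 (c k i) = 2 * pow2 (c k i).-1 by rewrite -pow2S prednK //; lia.
have : 2 * (b * pow2 (c k i).-1) - 2 * (a * pow2 (c k i).-1) = 1 by rewrite G2 in aE bE; lia.
by lia.
Qed.

Lemma sel_coord (G u : int) (n : nat) (i : int) (dl : option bool) : G != 0 -> (G %| u)%Z ->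
  n%:Z = ((u %/ G)%Z %% 4)%Z -> (n %% modulus dl == 0)%N = (G * (modulus dl)%:Z %| u)%Z.
Proof.
move=> G0 /dvdzP[v ->]; rewrite mulzK // => nE.
rewrite [v * G]mulrC (dvdz_mul2l G0).
apply/eqP/dvdzP; case: dl => [[]|] /=.
- by move=> h; exists (v %/ 4)%Z; lia.
- by move=> _; exists v; lia.
- by move=> h; exists (v %/ 2)%Z; lia.
- by case=> w h; lia.
- by rewrite modn1.
- by case=> w h; lia.
Qed.

Lemma mdata_Phi k x : lev x = k -> right_side x = false ->
  mPhi (mdata x) (mdata (x + 2 * pow2 k)) (mdata (x + pow2 k)).
Proof.
move=> lx rx; have lx' : lev (x + 2 * pow2 k) = k by have := lev_shift 1 lx; rewrite mulr1.
have ly : lev (x + pow2 k) = k.+1 by move: rx; rewrite /right_side lx => /negbFE/eqP.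
have [_ _ tr dl] := run.
apply/andP; split.
  apply/asboolP; have -> : dz (mdata x) = fun i => c k i == 0%N.
    by apply: funext => i; rewrite /dz /mdata lx /= ffunE.
  by rewrite /mdata lx ly /dq /=; apply: tr.
apply/forallP => i; rewrite /dsel /dmark /diota /dq /mdata lx lx' ly /= !ffunE /= dl.
set del := mdelta (q k) i; set g := c k i.
have [u [s [xE VE [m1 c1] [m2 c2]]]] := mark_coord g lx.
have G0 := lt0r_neq0 (pow2_gt0 g); have p0 := lt0r_neq0 (pow2_gt0 k.+1).
(* The midpoint x + 2^k has level exactly k + 1, so the cofactor in [VE] is odd. *)
have uodd : exists v, u = 2 * v + 1.
  have [v h] := (levE _ _).1 ly; have := mulfI p0 (etrans (esym VE) h) => e.
  by exists (u %/ 2)%Z; clear - e; lia.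
have s1 : has_mark k g x && (nat_of_ord (count_mark k g x) %% modulus del == 0)%N
    = (pow2 g * (modulus del)%:Z %| u)%Z.
  rewrite m1; case: (boolP (_ %| u)%Z) => h /=; first exact: sel_coord.
  by apply/esym/negbTE; apply: contra h => /dvdzP[v ->]; rewrite mulrCA dvdz_mulr.
have s2 : has_mark k g (x + 2 * pow2 k) && (nat_of_ord (count_mark k g (x + 2 * pow2 k)) %% modulus del == 0)%N
    = (pow2 g * (modulus del)%:Z %| u + 1)%Z.
  rewrite m2; case: (boolP (_ %| u + 1)%Z) => h /=; first exact: sel_coord.
  by apply/esym/negbTE; apply: contra h => /dvdzP[v ->]; rewrite mulrCA dvdz_mulr.
rewrite s1 s2.
have yE : 3 * (x + pow2 k + pow2 k.+1) + 1 = pow2 k.+1 * (4 * pow2 g * s + 3 * (u + 1)).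
  rewrite (_ : 4 * pow2 g * s + 3 * (u + 1) = 4 * pow2 g * s + 3 * u + 3); last by clear; lia.
  by rewrite [RHS]mulrDr -VE pow2S; clear; lia.
have pE : pow2 (k.+2 + shift_reg del g) = pow2 k.+1 * pow2 (shift_reg del g).+1.
  by rewrite /pow2 -PoszM -expnD addSnnS.
rewrite /has_mark yE pE (dvdz_mul2l p0).
have [v vE] := uodd.
have gd (n : nat) : (n <= g.+2)%N -> (pow2 n %| 4 * pow2 g * s + 3 * (u + 1))%Z = (pow2 n %| u + 1)%Z.
  move=> ng; rewrite -(dvdz_pow2_3 n (u + 1)) dvdz_addl // dvdz_mulr //.
  have -> : 4 * pow2 g = pow2 g.+2 by rewrite !pow2S mulrA.
  by rewrite /pow2 dvdzE !absz_nat dvdn_exp2l.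
have odd_no n : (pow2 n.+1 %| u)%Z = false.
  apply/negP => /dvdzP[w]; rewrite pow2S vE; move: (pow2 n); clear; lia.
have -> : pow2 g * (modulus del)%:Z = pow2 (g + (if del is Some b then (if b then 2 else 0) else 1))%N.
  by rewrite /pow2 expnD PoszM; case: (del) => [[]|].
(* As u is odd, only the right column x + 2^(k+1) can be selected, except for a decrement at 0,
   where both columns are. *)
case: (del) => [[]|] /=.
- by rewrite gd // addn2 odd_no.
- clearbody g; clear s1 s2 pE m1 c1 m2 c2 VE xE yE G0.
  case: g gd => [|g] gd /=; first last.
    by rewrite gd ?addn0 ?odd_no //; lia.
  rewrite gd // addn0 [pow2 0](_ : _ = 1) // !dvd1z.
  have -> // : (pow2 1 %| u + 1)%Z.
  by apply/dvdzP; exists (v + 1); rewrite vE pow2S /pow2 expn0; clear; lia.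
- by rewrite gd ?addn1 ?odd_no //; lia.
Qed.

Lemma mdata_init x : lev x = 0%N -> minit (mdata x).
Proof.
move=> lx; have [q0 c0 _ _] := run.
rewrite /minit /dq /dmark /mdata lx /= q0 eqxx; apply/forallP => i; rewrite !ffunE /= c0.
have [u [s [_ _ [-> _] _]]] := mark_coord 0 lx.
by rewrite dvd1z.
Qed.

End MachineData.

(** * Closed walks in strongly connected components *)

Section RelationPowers.
Local Open Scope nat_scope.
Variables (A : finType) (E : rel A).

Fixpoint rw n (x y : A) : Prop := if n is k.+1 then exists2 z, E x z & rw k z y else x = y.

Lemma rw_add m n x y : rw (m + n) x y <-> exists2 z, rw m x z & rw n z y.
Proof.
elim: m x => [|m IH] x /=; first by split=> [h|[z ->]] //; exists x.
split=> [[u xu /IH[z uz zy]]|[z [u xu uz] zy]]; first by exists z => //; exists u.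
by exists u => //; apply/IH; exists z.
Qed.

Lemma rw1 x y : rw 1 x y <-> E x y.
Proof. by split=> [[z xz <-]|xy] //; exists y. Qed.

(** There are finitely many relations on A, so the powers of E repeat; a multiple of the period
    beyond the preperiod serves both as period and as threshold. *)
Lemma rw_periodic : exists2 w, 0 < w & forall n x y, w <= n -> rw (n + w) x y <-> rw n x y.
Proof.
pose f n : {set A * A} := [set xy | `[< rw n xy.1 xy.2 >]].
have fE m n : f m = f n -> forall x y, rw m x y <-> rw n x y.
  by move=> /setP fmn x y; have := fmn (x, y); rewrite !inE /= => e; split=> /asboolP h; apply/asboolP; rewrite ?e // -e.
have [i [j [ij fij]]] : exists i j, i < j /\ f i = f j.
  pose N := #|{: {set A * A}}|; pose g (k : 'I_N.+1) := f k.
  have /injectivePn[a [b ab gab]] : ~~ injectiveb g.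
    apply/negP => /injectiveP/leq_card; by rewrite card_ord ltnn.
  case: (ltngtP a b) => [h|h|/val_inj e]; [by exists a, b|by exists b, a|by rewrite e eqxx in ab].
have st k x y : rw (i + k) x y <-> rw (j + k) x y.
  split=> /rw_add[z xz zy]; apply/rw_add; exists z => //.
    by apply/(fE _ _ fij).
  by apply/(fE _ _ fij).
have [d d0 jE] : exists2 d, 0 < d & j = i + d by exists (j - i); lia.
rewrite {}jE in st *; have per k n x y : i <= n -> rw (n + k * d) x y <-> rw n x y.
  move=> iN; elim: k => [|k IH]; first by rewrite mul0n addn0.
  rewrite -IH; have -> : n + k.+1 * d = i + d + (n + k * d - i) by rewrite mulSn; lia.
  by rewrite -st subnKC //; lia.
exists (i.+1 * d); first by rewrite muln_gt0.
move=> n x y h; apply: per; apply: leq_trans h.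
by apply: leq_trans (leqnSn i) _; rewrite leq_pmulr.
Qed.

Definition cwalk n (f : nat -> A) := (forall i, E (f i) (f i.+1)) /\ (forall i, f (i + n) = f i).

Lemma rw_path n x y : rw n x y -> exists g : nat -> A,
  [/\ g 0 = x, g n = y & forall i, i < n -> E (g i) (g i.+1)].
Proof.
elim: n x => [|n IH] x /=; first by move=> ->; exists (fun=> y).
case=> z xz /IH[g [g0 gn gE]]; exists (fun i => if i is k.+1 then g k else x).
by split=> // -[|i] /=; rewrite ?g0 //; apply: gE.
Qed.

Lemma path_rw n (g : nat -> A) i : (forall i, i < n -> E (g i) (g i.+1)) ->
  forall k, i + k <= n -> rw k (g i) (g (i + k)).
Proof.
move=> gE k; elim: k i => [|k IH] i ik /=; first by rewrite addn0.
by exists (g i.+1); [apply: gE; lia|rewrite -addSnnS; apply: IH; lia].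
Qed.

Lemma cwalk_exists n x k y : 0 < n -> k < n -> rw k x y -> rw (n - k) y x ->
  exists f, [/\ cwalk n f, f 0 = x & f k = y].
Proof.
move=> n0 kn /rw_path[g [g0 gk gE]] /rw_path[h [h0 hn hE]].
pose p i := if i < k then g i else h (i - k).
have pE i : i < n -> E (p i) (p (i.+1)).
  move=> i_n; rewrite /p; case: (ltngtP i.+1 k) => [ik|ki|ik].
  - by apply: gE; lia.
  - by rewrite (subSn (ki : k <= i)); apply: hE; lia.
  - by rewrite ik subnn h0 -gk -ik; apply: gE; lia.
have pn : p n = p 0.
  rewrite /p ifF; last by lia.
  rewrite hn; case: ifP => [_|k0]; first by rewrite g0.
  have k_0 : k = 0 by lia.
  by rewrite k_0 subnn h0 -gk k_0 g0.
have pk : p k = y by rewrite /p ltnn subnn h0.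
have p0 : p 0 = x by rewrite -pn /p ifF ?hn //; apply/negbTE; lia.
exists (fun i => p (i %% n)); split=> /=; [|by rewrite mod0n p0|by rewrite modn_small].
split=> i; last by rewrite modnDr.
have im : i %% n < n by rewrite ltn_mod.
have mE : i.+1 %% n = (i %% n).+1 %% n by rewrite -[in RHS]addn1 modnDml addn1.
have e := pE _ im; rewrite mE; case: (ltngtP (i %% n).+1 n) im => // h' im.
  by rewrite (modn_small h').
by rewrite h' modnn -pn -{2}h'.
Qed.

End RelationPowers.

Section Scc.
Local Open Scope nat_scope.
Variables (A : finType) (E : rel A) (w : nat).
Hypothesis w0 : 0 < w.
Hypothesis wP : forall n x y, w <= n -> rw E (n + w) x y <-> rw E n x y.
Notation rw := (rw E).

(** The last clause, a consequence of the maximality of a component, keeps walks between members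
    inside S. *)
Definition strong (S : A -> Prop) :=
  [/\ exists v, S v, forall u v, S u -> S v -> exists2 l, 0 < l & rw l u v &
      forall u v z k l, S u -> S v -> rw k u z -> rw l z v -> S z].

Lemma rw_congr n m x y : w <= n -> w <= m -> n = m %[mod w] -> rw n x y -> rw m x y.
Proof.
have up k n' : w <= n' -> rw (n' + k * w) x y <-> rw n' x y.
  by move=> h; elim: k => [|k IH]; rewrite ?addn0 // mulSn addnCA addnC wP ?IH //; lia.
move=> wn wm e; have [nm|mn] := leqP n m.
  have : m = n + (m - n) %/ w * w.
    by have /eqP := e; rewrite eq_sym eqn_mod_dvd // => /divnK ->; lia.
  by move=> ->; apply: (up _ _ wn).2.
have : n = m + (n - m) %/ w * w.
  by have /eqP := e; rewrite eqn_mod_dvd 1?ltnW // => /divnK ->; lia.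
by move=> ->; apply: (up _ _ wm).1.
Qed.

Lemma mod_add t a b : a = b + t * w -> a = b %[mod w].
Proof. by move=> ->; rewrite addnC modnMDl. Qed.

Ltac modw t := apply: (@mod_add t); move: (prednK w0); move: (w.-1) => ? <-; clear; lia.

Section InS.
Variable S : A -> Prop.
Hypothesis sS : strong S.

Lemma rw_loops k l v : rw l v v -> rw (k * l) v v.
Proof. by move=> h; elim: k => [|k IH] //; rewrite mulSn; apply/rw_add; exists v. Qed.

Lemma rw_w v k : S v -> rw (k.+1 * w) v v.
Proof.
move=> Sv; have [_ h _] := sS; have [l l0 lv] := h v v Sv Sv.
by apply: (@rw_congr (w * l)) (rw_loops w lv); rewrite ?leq_pmulr // ?leq_pmull // modnMr modnMl.
Qed.

Lemma rw_w1 v : S v -> rw w v v.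
Proof. by move=> Sv; have := rw_w 0 Sv; rewrite mul1n. Qed.

(** Go back from v to u by some walk of length l, then run w - 1 times through the loop of length n
    + l: the total is -n modulo w, and any length from w on in this class will do. *)
Lemma rw_return n m u v : S u -> S v -> rw n u v -> w <= m -> (n + m) %% w = 0 -> rw m v u.
Proof.
move=> Su Sv uv wm nm; have [_ h _] := sS; have [l l0 vu] := h v u Sv Su.
have loop : rw (n + l) u u by apply/rw_add; exists v.
have ret : rw (l + (w.-1 * (n + l) + 1 * w)) v u.
  apply/rw_add; exists u => //; apply/rw_add; exists u; first exact: rw_loops.
  exact: rw_w.
apply: rw_congr ret => //; first by rewrite mul1n addnA leq_addl.
have -> : l + (w.-1 * (n + l) + 1 * w) = w.-1 * n + l * w + w.
  by case: (w) w0 => // k _; rewrite /= !mul1n; clear; lia.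
rewrite modnDr addnC modnMDl.
apply/eqP; rewrite -(eqn_modDl n) nm.
have -> : n + w.-1 * n = n * w by rewrite -mulSn prednK // mulnC.
by rewrite modnMl.
Qed.

Lemma rw_any n m u v : S u -> S v -> rw n u v -> w <= m -> n = m %[mod w] -> rw m u v.
Proof.
move=> Su Sv uv wm nm.
pose r := w * n.+1 - n; have nr : n <= w * n.+1 by rewrite (leq_trans (leqnSn n)) // leq_pmull.
have rE : n + (r + w) = n.+2 * w by rewrite /r addnA subnKC // mulnC -mulSnr.
have vu : rw (r + w) v u by apply: (rw_return Su Sv uv); rewrite ?leq_addl // rE modnMl.
apply: (rw_return Sv Su vu wm).
by rewrite addnC -modnDml -nm modnDml rE modnMl.
Qed.

Lemma rw_in_S k l u v z : S u -> S v -> rw k u z -> rw l z v -> S z.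
Proof. by have [_ _ h] := sS; apply: h. Qed.

Lemma succ_in_S u : S u -> exists2 v, S v & E u v.
Proof.
move=> Su; have [_ h _] := sS; have [[|l] // _ [v uv vu]] := h u u Su Su.
by exists v => //; apply: (rw_in_S Su Su _ vu); apply/rw1; apply: uv.
Qed.

Lemma pred_in_S u : S u -> exists2 v, S v & E v u.
Proof.
move=> Su; have [_ h _] := sS; have [[|l] // _] := h u u Su Su.
rewrite -addn1 => /rw_add[v uv /rw1 vu].
by exists v => //; apply: (rw_in_S Su Su uv); apply/rw1; apply: vu.
Qed.

(** The obstruction to being a state-split cycle: the walk of length w puts y0 and y1 into one class
    of the period, yet x0 has an arc to only one of them. *)
Definition separated x0 x1 y0 y1 :=
  [/\ [/\ S x0, S x1, S y0 & S y1], E x0 y0, E x1 y1, ~ E x0 y1 & rw w y0 y1].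

(* The V i are the classes of S modulo its period. *)
Lemma state_split : (forall x0 x1 y0 y1, ~ separated x0 x1 y0 y1) ->
  exists p (V : 'I_p -> A -> Prop),
    [/\ 0 < p, forall i, exists v, V i v,
        forall i j v, V i v -> V j v -> i = j,
        forall v, S v <-> exists i, V i v &
        forall i v u, V i v -> S u -> (E v u <-> V (ordS i) u)].
Proof.
move=> nsep; have [[v0 Sv0] conn _] := sS.
have full x0 x1 y0 y1 : S x0 -> S x1 -> S y0 -> S y1 -> E x0 y0 -> E x1 y1 -> rw w y0 y1 -> E x0 y1.
  move=> *; apply: contrapT => h; apply: (nsep x0 x1 y0 y1); split=> //.
(* u is reached from v0 by a walk of length k modulo w; adding w to k passes the threshold of
   [rw_congr]. *)
pose C k u := S u /\ rw (k + w) v0 u.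
have Cmod k k' u : k = k' %[mod w] -> C k u -> C k' u.
  move=> kk [Su h]; split=> //; apply: rw_congr h; rewrite ?leq_addl //.
  by rewrite !modnDr.
have Cex u : S u -> exists k, C k u.
  move=> Su; have [l l0 h] := conn v0 u Sv0 Su; exists l; split=> //.
  by apply: (rw_any Sv0 Su h); rewrite ?leq_addl // modnDr.
have Cadd k j u : C k v0 -> C j u -> C (k + j) u.
  move=> [_ h] [Su h']; split=> //.
  have := (rw_add E (k + w) (j + w) v0 u).2 (ex_intro2 _ _ v0 h h').
  by apply: rw_congr; rewrite ?addnA ?leq_addl //; modw 1.
have Cdiff k j u : C k u -> C j u -> C (k + w.-1 * j) v0.
  move=> [Su h] [_ h']; split=> //.
  have ret : rw (w.-1 * (j + w) + w) u v0.
    apply: (rw_return Sv0 Su h'); rewrite ?leq_addl //.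
    by rewrite -(mod0n w); modw (j + w.+1).
  have := (rw_add E (k + w) _ v0 v0).2 (ex_intro2 _ _ u h ret).
  apply: rw_congr; rewrite ?leq_addl //; first by rewrite -addnA addnCA leq_addr.
  by modw w.
have C0 : C 0 v0 by split=> //; rewrite add0n; apply: rw_w1.
have Cmul a k : C k v0 -> C (a * k) v0.
  by move=> h; elim: a => [|a IH] //; rewrite mulSn; apply: Cadd.
have exp : exists k, (0 < k) && `[< C k v0 >].
  by exists w; rewrite w0 /=; apply/asboolP; apply: (Cmod 0); rewrite ?mod0n ?modnn.
(* p is the period of the component: modulo w, the closed walks at v0 have exactly the multiples of
   p as lengths. *)
have [p /andP[p0 /asboolP Cp] pmin] := ex_minnP exp.
have pdvd k : C k v0 -> p %| k.
  move=> Ck; apply: contrapT => /negP; rewrite /dvdn -lt0n => r0.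
  have Cr : C (k %% p) v0.
    apply: (Cmod (k + w.-1 * (k %/ p * p))); last by apply: Cadd => //; rewrite mulnA; apply: Cmul.
    by rewrite {1}(divn_eq k p); move: (k %/ p * p) (k %% p) => a r; modw a.
  by have := pmin (k %% p); rewrite r0 asboolT // => /(_ isT); rewrite leqNgt ltn_mod p0.
have Cp_mod k u : C k u <-> C (k %% p) u.
  split=> h.
    apply: (Cmod (w.-1 * (k %/ p * p) + k)); last by apply: Cadd => //; rewrite mulnA; apply: Cmul.
    by rewrite {2}(divn_eq k p); move: (k %/ p * p) (k %% p) => a r; modw a.
  by rewrite (divn_eq k p); apply: Cadd => //; apply: Cmul.
have Cinj k j u : C k u -> C j u -> k = j %[mod p].
  move=> h h'; have d1 := pdvd _ (Cdiff _ _ _ h h').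
  have d2 := pdvd _ (Cdiff _ _ _ h' h').
  apply/eqP; rewrite -(eqn_modDr (w.-1 * j)).
  by rewrite (eqP d1) (eqP d2).
have CE k v u : C k v -> S u -> E v u -> C k.+1 u.
  move=> [Sv h] Su vu; split=> //; rewrite addSn -addn1; apply/rw_add; exists v => //.
  exact/rw1.
exists p, (fun (i : 'I_p) u => C i u); split=> //.
- move=> i; have [_ _ btw] := sS.
  have [z z1 z2] : exists2 z, rw i v0 z & rw (i.+1 * w - i) z v0.
    by apply/rw_add; rewrite subnKC; [apply: rw_w|rewrite mulSn; nia].
  have Sz := btw _ _ _ _ _ Sv0 Sv0 z1 z2; exists z; split=> //.
  by apply: (rw_any Sv0 Sz z1); rewrite ?leq_addl // modnDr.
- move=> i j v h h'; apply: val_inj; have := Cinj _ _ _ h h'.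
  by rewrite !modn_small.
- move=> v; split=> [/Cex[k /Cp_mod h]|[i []]//].
  by exists (Ordinal (ltn_pmod k p0)).
move=> i v u Cv Su; split=> [vu|]; first exact: (Cp_mod i.+1 u).1 (CE _ _ _ Cv Su vu).
move=> /(Cp_mod i.+1 u).2 Cu; have [Sv _] := Cv.
(* v' and u lie in the same class; in the absence of a separated pattern, the arcs v -> v' and x ->
   u give an arc v -> u. *)
have [v' Sv' vv'] := succ_in_S Sv; have [x Sx xu] := pred_in_S Su.
apply: (full _ _ _ _ Sv Sx Sv' Su vv' xu).
have [_ h1] := CE _ _ _ Cv Sv' vv'; have [_ h2] := Cu.
have ret : rw (w.-1 * (i.+1 + w) + w) v' v0.
  apply: (rw_return Sv0 Sv' h1); rewrite ?leq_addl //.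
  by rewrite -(mod0n w); modw (i.+1 + w.+1).
have := (rw_add E _ (i.+1 + w) v' u).2 (ex_intro2 _ _ v0 ret h2).
apply: rw_congr => //; first by rewrite -addnA addnCA leq_addr.
have -> : w.-1 * (i.+1 + w) + w + (i.+1 + w) = (i.+1 + w.+1) * w.
  by case: (w) w0 => // k _; rewrite /=; clear; lia.
by rewrite modnMl modnn.
Qed.

Section Pattern.
Variables x0 x1 y0 y1 : A.
Hypothesis sep : separated x0 x1 y0 y1.

Lemma rw_x0_y1 k : 0 < k -> rw (1 + k * w) x0 y1.
Proof.
move=> k0; have [[_ _ _ Sy1] e0 _ _ p] := sep.
apply/rw_add; exists y0; first exact/rw1.
by apply: rw_congr p => //; [rewrite leq_pmull|rewrite modnn modnMl].
Qed.

(** If D-walks collapse to arcs, so do walks of length 1 + j (D - 1); for j = w there is such a walk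
    from x0 to y1. *)
Lemma arcs_not_powers D : 2 <= D -> (forall a b, S a -> S b -> rw D a b -> E a b) -> False.
Proof.
move=> D2 DE; have [[Sx0 _ _ Sy1] _ _ ne _] := sep.
suff Q j a b : S a -> S b -> rw (1 + j * D.-1) a b -> E a b.
  apply: ne; apply: (Q w) => //; rewrite mulnC; apply: rw_x0_y1; lia.
elim: j a b => [|j IH] a b Sa Sb; first by rewrite mul0n addn0 => /rw1.
rewrite (_ : 1 + j.+1 * D.-1 = D + j * D.-1); last by rewrite mulSn; lia.
move=> /rw_add[z az zb]; have Sz := rw_in_S Sa Sb az zb.
apply: IH => //; apply/rw_add; exists z => //.
by apply/rw1; apply: DE.
Qed.

(** Otherwise any d-walk that closes up to length n collapses to an arc. If n - d >= w, every d-walk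
    closes up. If not, walks of length e = n - d collapse to reversed arcs, and two reversals
    collapse walks of length e * e; both contradict [arcs_not_powers]. *)
Lemma closed_walk_witness n d : 2 * w <= n -> n %% w = 0 -> 2 <= d -> d.+2 <= n ->
  exists f, cwalk E n f /\ ~ E (f 0) (f d).
Proof.
move=> wn nw d2 dn; apply: contrapT => nf.
have all f : cwalk E n f -> E (f 0) (f d).
  by move=> cf; apply: contrapT => ne; apply: nf; exists f.
have n0 : 0 < n by lia.
have ext a b : rw d a b -> rw (n - d) b a -> E a b.
  move=> ab ba; have dn' : d < n by lia.
  have [f [cf f0 fd]] := cwalk_exists n0 dn' ab ba.
  by rewrite -f0 -fd; apply: all.
have [h|h] := leqP w (n - d).
  apply: (arcs_not_powers d2) => a b Sa Sb ab; apply: ext => //.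
  by apply: (rw_return Sa Sb ab); rewrite // subnKC //; lia.
have back a b : S a -> S b -> rw (n - d) b a -> E a b.
  move=> Sa Sb ba; apply: ext => //; apply: (rw_return Sb Sa ba); first by lia.
  by rewrite subnK //; lia.
pose e := n - d; have e2 : 2 <= e by rewrite /e; lia.
have chain k a b : S a -> S b -> rw (e * k) a b -> rw k b a.
  elim: k a => [|k IH] a Sa Sb; first by rewrite muln0 => ->.
  rewrite mulnS => /rw_add[z az zb]; have Sz := rw_in_S Sa Sb az zb.
  rewrite -addn1; apply/rw_add; exists z; first exact: IH.
  by apply/rw1; apply: back.
apply: (@arcs_not_powers (e * e)); first by nia.
by move=> a b Sa Sb /(chain _ _ _ Sa Sb) h'; apply: back.
Qed.

End Pattern.
End InS.
End Scc.

Section Walks.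
Local Open Scope nat_scope.
Variables (A : finType) (E : rel A) (w : nat).
Hypothesis w0 : 0 < w.
Hypothesis wP : forall n x y, w <= n -> rw E (n + w) x y <-> rw E n x y.
Notation rw := (rw E).
(** A multiple of 3 w * w, a period of the first walk of [clashing_walks], and at least 6 w, enough
    for [bit_gadget]: at most w steps to merge, at most 3 w - 1 to branch, and at least w in
    between. *)
Notation n := (6 * w * w).

Let nw : n %% w = 0. Proof. by rewrite modnMl. Qed.
Let wn : 6 * w <= n. Proof. by rewrite leq_pmulr. Qed.
Let n6 : 6 <= n. Proof. by rewrite -mulnA leq_pmulr // muln_gt0 w0. Qed.

Lemma shift_witness (S1 S2 S3 : A -> Prop) v1 v2 w2 x0 x1 y0 y1 :
  strong E S1 -> strong E S2 -> strong E S3 -> S1 v1 -> ~ E v1 v1 ->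
  S2 v2 -> S2 w2 -> E v2 w2 -> ~ E w2 v2 -> separated E w S3 x0 x1 y0 y1 ->
  forall d, d < n -> d != 1 -> exists f, cwalk E n f /\ ~ E (f 0) (f d).
Proof.
move=> sS1 sS2 sS3 Sv1 nv1 Sv2 Sw2 e2 ne2 sep d dn d1.
have n0 : 0 < n by apply: leq_trans n6.
have [->|d0] := eqVneq d 0.
  have h : rw n v1 v1 by have := rw_w w0 wP sS1 (6 * w).-1 Sv1; rewrite prednK // muln_gt0 w0.
  have [f [cf f0 _]] := cwalk_exists n0 n0 (erefl : rw 0 v1 v1) (eq_ind_r (fun k => rw k v1 v1) h (subn0 n)).
  by exists f; rewrite f0.
have [->|dn1] := eqVneq d n.-1.
  have h : rw n.-1 w2 v2.
    by apply: (rw_return w0 wP sS2 Sv2 Sw2 ((rw1 E v2 w2).2 e2)); [lia|rewrite add1n prednK].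
  have h1 : rw (n - n.-1) v2 w2 by rewrite (_ : n - n.-1 = 1); [apply/rw1|lia].
  have [|f [cf f0 fd]] := cwalk_exists n0 _ h h1; first by lia.
  by exists f; rewrite f0 fd.
apply: (closed_walk_witness w0 wP sS3 sep) => //; lia.
Qed.

Lemma concat_loops (B : nat) (g : nat -> nat -> A) x : 0 < B -> (forall r, g r 0 = x) ->
  (forall r, g r B = x) -> (forall r i, i < B -> E (g r i) (g r i.+1)) ->
  forall i, E (g (i %/ B) (i %% B)) (g (i.+1 %/ B) (i.+1 %% B)).
Proof.
move=> B0 g0 gB gE i; have im : i %% B < B by rewrite ltn_mod.
have := gE (i %/ B) _ im; have [h|h] := ltnP (i %% B).+1 B.
  have -> : i.+1 %/ B = i %/ B by rewrite {1}(divn_eq i B) -addnS divnMDl // (divn_small h) addn0.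
  by have -> : i.+1 %% B = (i %% B).+1 by rewrite {1}(divn_eq i B) -addnS modnMDl modn_small.
have e : (i %% B).+1 = B by lia.
have -> : i.+1 %% B = 0 by rewrite {1}(divn_eq i B) -addnS e modnMDl modnn.
by rewrite e g0 gB.
Qed.

(** c' runs through y1 with period w. c consists of loops at x0 of length 3 w, and its r-th loop
    visits x0 at time w + r whenever possible. Given d, some loop has this visit while c' is at y1,
    and there is no arc x0 -> y1. If that visit is impossible, then the start of the loop clashes:
    an arc from x0 to c' there would continue through y1 and y0 back to x0 in a length congruent to
    r, and make it possible. *)
Lemma clashing_walks S x0 x1 y0 y1 : strong E S -> separated E w S x0 x1 y0 y1 ->
  exists c c', [/\ cwalk E n c, cwalk E n c' & forall d, exists i, ~ E (c i) (c' (i + d))].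
Proof.
move=> sS [[Sx0 Sx1 Sy0 Sy1] e0 e1 ne p].
have [l [[lE lw] l0 _]] := cwalk_exists w0 w0 (erefl : rw 0 y1 y1)
  (eq_ind_r (fun k => rw k y1 y1) (rw_w1 w0 wP sS Sy1) (subn0 w)).
have lwk k i : l (i + k * w) = l i by elim: k => [|k IH]; rewrite ?addn0 // mulSn addnCA addnC lw.
have B0 : 0 < 3 * w by rewrite muln_gt0.
have w3 : rw (3 * w) x0 x0 by exact: (rw_w w0 wP sS 2 Sx0).
have gex r : exists g, [/\ g 0 = x0, g (3 * w) = x0, forall i, i < 3 * w -> E (g i) (g i.+1) &
    r < w -> rw (w + r) x0 x0 -> g (w + r) = x0].
  have [[rw_ h]|nh] := pselect (r < w /\ rw (w + r) x0 x0); last first.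
    have [g [g0 gB gE]] := rw_path w3; exists g; split=> // rw_ h; by case: nh.
  have h' : rw (3 * w - (w + r)) x0 x0.
    by apply: (rw_return w0 wP sS Sx0 Sx0 h); [lia|rewrite subnKC ?modnMl //; lia].
  have [|f [[fE fn] f0 fr]] := cwalk_exists B0 _ h h'; first by lia.
  by exists f; split=> //; rewrite -f0 -{1}[3 * w]add0n fn.
have /choice[g gP] := gex.
pose c i := g ((i %/ (3 * w)) %% w) (i %% (3 * w)).
exists c, (fun j => l (j + w.-1)); split.
- split=> i.
    by apply: (@concat_loops (3 * w) (fun r => g (r %% w)) x0) => // r; have [] := gP (r %% w).
  have nE : n = (2 * w) * (3 * w) by lia.
  by rewrite /c nE [i + _]addnC modnMDl divnMDl // modnMDl.
- split=> i; first by rewrite addSn.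
  by rewrite addnAC lwk.
(* Chosen so that r + d + w - 1 is a multiple of w. *)
move=> d; pose r := (d * w.-1 + 1) %% w.
have rw_ : r < w by rewrite ltn_mod.
have [R|nR] := pselect (rw (w + r) x0 x0).
  have [_ _ _ /(_ rw_ R) gr] := gP r.
  exists (r * (3 * w) + (w + r)).
  have lt : w + r < 3 * w by lia.
  rewrite /c divnMDl // modnMDl (divn_small lt) addn0 (modn_small lt) (modn_small rw_) gr.
  suff -> : l (r * (3 * w) + (w + r) + d + w.-1) = y1 by [].
  pose k := (d * w.-1 + 1) %/ w.
  have rE : d * w.-1 + 1 = k * w + r by apply: divn_eq.
  have [j jE] : exists j, r * (3 * w) + (w + r) + d + w.-1 = 0 + j * w.
    have : (r + d + w.-1) %% w = 0.
      rewrite -(modnMDl k) !addnA -rE.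
      have -> : d * w.-1 + 1 + d + w.-1 = d.+1 * w by rewrite -{3}(prednK w0) mulnS; lia.
      by rewrite modnMl.
    move/eqP/dvdnP => [j jE]; exists (3 * r + 1 + j).
    by rewrite !mulnDl -jE; lia.
  by rewrite jE lwk l0.
exists (r * (3 * w)).
have [g0 _ _ _] := gP (r %% w).
rewrite /c mulnK // modnMl g0 => x0u; apply: nR.
set u := l _ in x0u.
have uy1 : rw r u y1.
  have lr k i : rw k (l i) (l (i + k)).
    elim: k i => [|k IH] i /=; first by rewrite addn0.
    by exists (l i.+1); [apply: lE|rewrite -addSnnS; apply: IH].
  have := lr r (r * (3 * w) + d + w.-1); rewrite -/u.
  suff -> : l (r * (3 * w) + d + w.-1 + r) = y1 by [].
  pose k := (d * w.-1 + 1) %/ w.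
  have rE : d * w.-1 + 1 = k * w + r by apply: divn_eq.
  have [j jE] : exists j, r * (3 * w) + d + w.-1 + r = 0 + j * w.
    have : (r + d + w.-1) %% w = 0.
      rewrite -(modnMDl k) !addnA -rE.
      have -> : d * w.-1 + 1 + d + w.-1 = d.+1 * w by rewrite -{3}(prednK w0) mulnS; lia.
      by rewrite modnMl.
    move/eqP/dvdnP => [j jE]; exists (3 * r + j).
    by rewrite !mulnDl -jE; lia.
  by rewrite jE lwk l0.
have y1y0 : rw w y1 y0 by apply: (rw_return w0 wP sS Sy0 Sy1 p) => //; rewrite addnn -mul2n modnMl.
have y0x0 : rw (2 * w - 1) y0 x0.
  by apply: (rw_return w0 wP sS Sx0 Sy0 ((rw1 E x0 y0).2 e0)); [lia|rewrite subnKC ?modnMl //; lia].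
have : rw (1 + (r + (w + (2 * w - 1)))) x0 x0.
  apply/rw_add; exists u; first exact/rw1.
  apply/rw_add; exists y1 => //; apply/rw_add; by exists y0.
apply: (rw_congr w0 wP); [lia|lia|].
have -> : 1 + (r + (w + (2 * w - 1))) = 2 * w + (w + r) by lia.
by rewrite modnMDl.
Qed.

(* The walks start at x0, x1 and then y0, y1, are shortest possible until they merge,
   and branch as late as possible: no arc joins one to the other in between. *)
Lemma bit_gadget S x0 x1 y0 y1 : strong E S -> separated E w S x0 x1 y0 y1 ->
  exists (g : nat -> bool -> A) (cut : nat), [/\ [/\ 0 < cut, cut.+2 <= n & forall b, g n b = g 0 b],
    forall i b, i < n -> E (g i b) (g i.+1 b), ~ E (g 0 false) (g 1 true),
    forall b b', E (g cut b) (g cut.+1 b') &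
    (forall i b b', 0 < i < cut -> E (g i b) (g i.+1 b') -> g i.+1 b' = g i.+1 b) /\
    (forall i b b', cut < i < n -> E (g i b) (g i.+1 b') -> g i b = g i b')].
Proof.
move: nw wn n6; move: (6 * w * w) => N nw' wn' n6' sS [[Sx0 Sx1 Sy0 Sy1] e0 e1 ne p].
pose x b := if b then x1 else x0; pose y b := if b then y1 else y0.
have Sx b : S (x b) by case: b.
have Sy b : S (y b) by case: b.
have exy b : E (x b) (y b) by case: b.
pose m1 k := `[< exists2 z, S z & forall b, rw k (y b) z >].
pose m2 k := `[< exists2 z, S z & forall b, rw k z (x b) >].
have ex1 : exists k, m1 k.
  by exists w; apply/asboolP; exists y1 => // -[] //=; apply: (rw_w1 w0 wP sS).
have m2w : m2 (3 * w - 1).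
  apply/asboolP; exists y0 => // b.
  have yx b' m : w <= m -> (1 + m) %% w = 0 -> rw m (y b') (x b').
    by apply: (rw_return w0 wP sS (Sx b') (Sy b') ((rw1 E _ _).2 (exy b'))).
  case: b; last by apply: (yx false); [lia|rewrite subnKC ?modnMl //; lia].
  rewrite (_ : 3 * w - 1 = w + (2 * w - 1)); last by lia.
  apply/rw_add; exists y1 => //; apply: (yx true); first by lia.
  by rewrite subnKC ?modnMl //; lia.
have [M1 /asboolP[z Sz yz] M1min] := ex_minnP ex1.
have [M2 /asboolP[z' Sz' zx] M2min] := ex_minnP (ex_intro (fun k => m2 k) _ m2w).
have M1w : M1 <= w by apply: M1min; apply/asboolP; exists y1 => // -[] //=; apply: (rw_w1 w0 wP sS).
have M2w : M2 <= 3 * w - 1 by apply: M2min.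
pose e := N - 1 - M1 - M2.
have eE : 1 + M1 + e + M2 = N by rewrite /e; lia.
have ew : w <= e by rewrite /e; lia.
have zz' : rw e z z'.
  apply: (rw_return w0 wP sS Sz' Sz (n := M2 + (1 + M1))) => //.
    apply/rw_add; exists (x true) => //; apply/rw_add; exists (y true) => //; exact/rw1.
  by rewrite (_ : M2 + (1 + M1) + e = N) //; lia.
have /choice[p1 p1P] := fun b => rw_path (yz b).
have [p2 [p20 p2e p2E]] := rw_path zz'.
have /choice[p3 p3P] := fun b => rw_path (zx b).
pose g i b := if i == 0 then x b else if i <= 1 + M1 then p1 b (i - 1)
  else if i <= 1 + M1 + e then p2 (i - (1 + M1)) else p3 b (i - (1 + M1 + e)).
have M10 : 0 < M1.
  case: (M1) yz => // yz0; have := yz0 true; have := yz0 false => /= <- h.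
  by case: ne; rewrite h.
have g1 i b : 0 < i -> i <= 1 + M1 -> g i b = p1 b (i - 1).
  by move=> i0 i1; rewrite /g eqn0Ngt i0 /= i1.
have g2 i b : 1 + M1 <= i -> i <= 1 + M1 + e -> g i b = p2 (i - (1 + M1)).
  move=> i1 i2; have [h|h] := leqP i (1 + M1).
    by rewrite g1 ?(leq_trans _ i1) // (_ : i = 1 + M1) ?subnn ?addKn ?p20; [have [] := p1P b|lia].
  by rewrite /g i2 (leqNgt i (1 + M1)) h (gtn_eqF (leq_ltn_trans (leq0n _) h)).
have g3 i b : 1 + M1 + e <= i -> i <= N -> g i b = p3 b (i - (1 + M1 + e)).
  move=> i1 i2; have [h|h] := leqP i (1 + M1 + e).
    have -> : i = 1 + M1 + e by lia.
    by rewrite g2 ?leq_addr // subnn addKn p2e; have [] := p3P b.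
  by rewrite /g (leqNgt i (1 + M1 + e)) (leqNgt i (1 + M1)) h (gtn_eqF (leq_ltn_trans (leq0n _) h)) (leq_ltn_trans (leq_addr _ _) h).
have gn b : g N b = x b.
  rewrite g3 //; last by lia.
  have -> : N - (1 + M1 + e) = M2 by lia.
  by have [] := p3P b.
have gE i b : i < N -> E (g i b) (g i.+1 b).
  move=> i_n; have [i0|i0] := posnP i.
    by rewrite i0 (g1 1) // subnn; have [-> _ _] := p1P b; apply: exy.
  have [h1|h1] := ltnP i (1 + M1).
    rewrite !g1 ?(ltnW h1) // subSn //; have [_ _ h] := p1P b; rewrite subn1 -[X in E _ (_ _ X)]prednK ?prednK //.
    by have := h i.-1; rewrite prednK //; apply; lia.
  have [h2|h2] := ltnP i (1 + M1 + e).
    by rewrite !g2 ?(ltnW h2) ?(leqW h1) // subSn //; apply: p2E; lia.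
  rewrite !g3 ?(ltnW i_n) ?(leqW h2) // subSn //; have [_ _ h] := p3P b.
  by apply: h; lia.
have gS1 i b : 0 < i -> i <= 1 + M1 -> rw (i - 1) (y b) (g i b) /\ rw (1 + M1 - i) (g i b) z.
  move=> i0 i1; rewrite g1 //; have [q0 qM qE] := p1P b.
  split; first by rewrite -[X in rw _ X]q0; apply: (path_rw qE); lia.
  have := path_rw qE (i := i - 1) (k := 1 + M1 - i); rewrite (_ : i - 1 + _ = M1) ?qM; last by lia.
  exact.
have gS3 i b : 1 + M1 + e <= i -> i <= N -> rw (i - (1 + M1 + e)) z' (g i b) /\ rw (N - i) (g i b) (x b).
  move=> i0 i1; rewrite g3 //; have [q0 qM qE] := p3P b.
  split; first by rewrite -[X in rw _ X]q0; apply: (path_rw qE); lia.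
  have := path_rw qE (i := i - (1 + M1 + e)) (k := N - i); rewrite (_ : _ - _ + _ = M2) ?qM; last by lia.
  by apply; lia.
have {}M1min k z1 : S z1 -> (forall b, rw k (y b) z1) -> M1 <= k.
  by move=> Sz1 h; apply: M1min; apply/asboolP; exists z1.
have {}M2min k z1 : S z1 -> (forall b, rw k z1 (x b)) -> M2 <= k.
  by move=> Sz1 h; apply: M2min; apply/asboolP; exists z1.
have g0 b : g 0 b = x b by [].
clear ex1 m2w m1 m2; clearbody g e.
exists g, (1 + M1); split=> //.
- by split=> [||b]; [lia|lia|rewrite gn g0].
- by rewrite g0 (g1 1) // subnn; have [-> _ _] := p1P true.
- move=> b b'; have -> : g (1 + M1) b = g (1 + M1) b' by rewrite !g2 //; lia.
  by apply: gE; lia.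
split=> i b b' iP h.
  (* Before the merging point, an arc between the two walks would take both y0 and y1 to one vertex
     in i < M1 steps. *)
  have [<- //|bb'] := eqVneq b b'.
  have [h1|h1] := leqP i.+1 M1; last by rewrite !g2 //; lia.
  have : M1 <= i; last by lia.
  have [a1 _] := gS1 i b ltac:(lia) ltac:(lia).
  have [a2 a3] := gS1 i.+1 b' ltac:(lia) ltac:(lia).
  apply: (M1min _ (g i.+1 b')).
    exact: (rw_in_S sS (Sy b') Sz a2 a3).
  move=> b''; have [->|nb] := eqVneq b'' b'; first by move: a2; rewrite subn1.
  have -> : b'' = b by case: (b) bb'; case: (b') nb; case: (b'').
  by rewrite (_ : i = (i - 1) + 1); [apply/rw_add; exists (g i b) => //; apply/rw1; rewrite addn1 subn1 prednK //; lia|lia].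
(* Dually, an arc between the walks after branching would lead from one vertex to both x0 and x1 in
   N - i < M2 steps. *)
have [<- //|bb'] := eqVneq b b'.
have [h1|h1] := leqP i (1 + M1 + e); first by rewrite !g2 //; lia.
have : M2 <= N - i; last by lia.
have [a1 a3] := gS3 i b ltac:(lia) ltac:(lia).
have [_ a2] := gS3 i.+1 b' ltac:(lia) ltac:(lia).
apply: (M2min _ (g i b)).
  exact: (rw_in_S sS Sz' (Sx b) a1 a3).
move=> b''; have [->//|nb] := eqVneq b'' b.
have -> : b'' = b' by case: (b) bb' nb; case: (b'); case: (b'').
by rewrite (_ : N - i = 1 + (N - i.+1)); [apply/rw_add; exists (g i.+1 b') => //; apply/rw1|lia].
Qed.

End Walks.

Section Components.
Local Open Scope nat_scope.
Local Open Scope classical_set_scope.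
Variables (A : finType) (H : set (int -> A)).
Notation G := (rauzy_graph H).
Notation E := (Defs.arc G).

Lemma reachable_rw u v : reachable G u v <-> exists2 l, 0 < l & rw E l u v.
Proof.
split=> [[p [pn pp pl]]|[l l0 h]].
  exists (size p); first by case: p pn {pp pl}.
  elim: p u pp pl {pn} => [|z p IH] u /= => [_ ->//|/andP[uz zp] zl].
  by exists z => //; apply: IH.
have [p [pl pp lp]] : exists p, [/\ size p = l, path E u p & last u p = v].
  elim: l u h {l0} => [|l IH] u /=; first by move=> ->; exists [::].
  by case=> z uz /IH[p [<- zp pl]]; exists (z :: p); rewrite /= uz.
by exists p; split=> //; case: p pl {pp lp} l0 => // <-.
Qed.

Lemma arc_vertex u v : E u v -> vertex G u /\ vertex G v.
Proof.
move=> /asboolP[x Hx [i]]; rewrite /word_at /= => -[xu xv].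
split; exists x => //; first by exists i; congr [:: _].
by exists (i + 1)%R; congr [:: _]; rewrite -xv; congr x; lia.
Qed.

Lemma rw_vertex k u v : 0 < k -> rw E k u v -> vertex G u /\ vertex G v.
Proof.
case: k => // k _ [z uz zv]; have [vu vz] := arc_vertex uz; split=> //.
elim: k z {uz} zv vz => [|k IH] z /=; first by move=> <-.
by case=> z' zz' h _; apply: (IH z') => //; have [] := arc_vertex zz'.
Qed.

Lemma scc_strong S : is_scc G S -> strong E S.
Proof.
move=> [[v0 Sv0] [SV conn] Smax]; split; first by exists v0.
  by move=> u v Su Sv; apply/reachable_rw; apply: conn.
move=> u v z k l Su Sv uz zv.
have vu : exists m, rw E m v u by have /reachable_rw[m _ h] := conn v u Sv Su; exists m.
pose S' := [set t | (exists k, rw E k u t) /\ exists l, rw E l t u].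
have uS t : S t -> S' t.
  move=> St; have /reachable_rw[m _ h] := conn _ _ Su St.
  by have /reachable_rw[m' _ h'] := conn _ _ St Su; split; [exists m|exists m'].
have [m0 m00 uu] : exists2 m, 0 < m & rw E m u u by apply/reachable_rw; apply: conn.
suff <- : S' = S.
  split; first by exists k.
  by have [m h] := vu; exists (l + m); apply/rw_add; exists v.
apply: Smax => //; split.
  move=> t [[i ut] _]; have [i0|i0] := posnP i; first by move: ut; rewrite i0 => /= <-; apply: SV.
  by have [] := rw_vertex i0 ut.
move=> t t' [_ [i tu]] [[j ut'] _]; apply/reachable_rw; exists (i + (m0 + j)); first by lia.
by apply/rw_add; exists u => //; apply/rw_add; exists u.
Qed.

Lemma not_condition_D w : 0 < w -> (forall n x y, w <= n -> rw E (n + w) x y <-> rw E n x y) ->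
  ~ condition_D G ->
  exists S1 S2 S3 v1 v2 w2 x0 x1 y0 y1,
    [/\ [/\ strong E S1, strong E S2 & strong E S3], S1 v1 /\ ~ E v1 v1,
      S2 v2 /\ S2 w2, E v2 w2 /\ ~ E w2 v2 & separated E w S3 x0 x1 y0 y1].
Proof.
move=> w0 wP nD.
have [S1 [sS1 [v1 [Sv1 nv1]]]] : exists S, is_scc G S /\ exists v, S v /\ ~ E v v.
  apply: contrapT => h; apply: nD; apply: Or31 => S sS v Sv.
  by apply: contrapT => nv; apply: h; exists S; split=> //; exists v.
have [S2 [sS2 [v2 [w2 [Sv2 Sw2 e2 ne2]]]]] : exists S, is_scc G S /\
    exists v u, [/\ S v, S u, E v u & ~ E u v].
  apply: contrapT => h; apply: nD; apply: Or32 => S sS v u Sv Su _ vu.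
  by apply: contrapT => nv; apply: h; exists S; split=> //; exists v, u.
have [S3 [sS3 nS3]] : exists S, is_scc G S /\ ~ state_split_cycle_type G S.
  apply: contrapT => h; apply: nD; apply: Or33 => S sS.
  by apply: contrapT => nv; apply: h; exists S.
have [[x0 [x1 [y0 [y1 sep]]]]|nsep] := pselect (exists x0 x1 y0 y1, separated E w S3 x0 x1 y0 y1).
  exists S1, S2, S3, v1, v2, w2, x0, x1, y0, y1; split=> //; split; exact: scc_strong.
case: nS3.
have [|p [V [p0 Vn Vt VS VE]]] := state_split w0 wP (scc_strong sS3).
  by move=> x0 x1 y0 y1 h; apply: nsep; exists x0, x1, y0, y1.
exists p, V; split=> //.
- by move=> i j _ _ [v [vi vj]]; apply: Vt vi vj.
- by apply/seteqP; split=> v => [[i _ vi]|/VS[i vi]]; [apply/VS; exists i|exists i].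
Qed.

End Components.

(** * The walks assembled into tracks *)

Section Kits.
Local Open Scope ring_scope.

(* Track r of a column is the walk i |-> kT r i b along a row, where b may depend on
   the tile read there; kbit codes tiles by these bits.  Up to the index kcut the bit is
   transported forward along the row, from there on backward. *)
Record kit (A : finType) (E : rel A) (Q : finType) := Kit {
  kM : int; kn : int; kcut : int; kT : int -> int -> bool -> A; kbit : int -> Q -> bool;
  kM0 : 0 < kM; kcut0 : 0 < kcut; kcutn : kcut + 2 <= kn;
  kper : forall r i b, kT r (i + kn) b = kT r i b;
  karc : forall r i b, E (kT r i b) (kT r (i + 1) b);
  kmerge : forall r b b', E (kT r kcut b) (kT r (kcut + 1) b');
  kfwd : forall r i b b', 0 < i < kcut -> E (kT r i b) (kT r (i + 1) b') ->
    kT r (i + 1) b' = kT r (i + 1) b;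
  kbwd : forall r i b b', kcut < i < kn -> E (kT r i b) (kT r (i + 1) b') -> kT r i b = kT r i b';
  (* Transfer of a tile to the next column: arcs from index 0 to index 1 on all tracks force the two
     codes to be equal. *)
  kclaim : forall q q', (forall r, 0 <= r < kM -> E (kT r 0 (kbit r q)) (kT r 1 (kbit r q'))) -> q = q';
  (* The shift is forced: for a shift by M d + r0 other than M modulo M n, some track meets a letter
     to which it has no arc, whatever the bits. *)
  kkill : forall r0 d, 0 <= r0 < kM -> r0 <> 0 \/ ((d - 1) %% kn)%Z <> 0 ->
    exists r i, 0 <= r < kM /\
      forall b b', ~ E (kT r i b) (kT ((r + r0) %% kM)%Z (i + d + ((r + r0) %/ kM)%Z) b') }.

Variables (A : finType) (E : rel A) (Q : finType).

Definition zwalk (n : nat) (f : nat -> A) (i : int) := f (absz (modz i n%:Z)).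

Lemma zwalk_per n f i k : zwalk n f (i + k * n%:Z) = zwalk n f i.
Proof. by rewrite /zwalk addrC modzMDl. Qed.

Lemma zwalk_small n f (i : nat) : (i < n)%N -> zwalk n f i%:Z = f i.
Proof. by move=> h; rewrite /zwalk modz_small ?absz_nat //; lia. Qed.

Lemma zwalk_arc (n : nat) (f f' : nat -> A) (i : int) : (0 < n)%N -> f' n = f' 0%N ->
  E (f (absz (modz i n%:Z))) (f' (absz (modz i n%:Z)).+1) -> E (zwalk n f i) (zwalk n f' (i + 1)).
Proof.
move=> n0 fn; rewrite /zwalk; have m : modz i n%:Z < n%:Z by rewrite ltz_pmod //; lia.
have m0 : 0 <= modz i n%:Z by rewrite modz_ge0 //; lia.
have : modz (i + 1) n%:Z = modz (modz i n%:Z + 1) n%:Z by rewrite modzDml.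
move=> ->; move: (modz i n%:Z) m m0 => j m m0 h.
have [e|jn] := eqVneq (j + 1) n%:Z.
  have jn : (absz j).+1 = n by lia.
  by rewrite e modzz absz0 -fn -jn.
have -> : modz (j + 1) n%:Z = j + 1 by apply: modz_small; lia.
by have -> : absz (j + 1)%R = (absz j).+1 by lia.
Qed.

Lemma cwalk_zwalk n f (i : nat) : (0 < n)%N -> cwalk E n f -> zwalk n f i%:Z = f i.
Proof.
move=> n0 [_ fn]; rewrite /zwalk modz_nat absz_nat {2}(divn_eq i n).
by elim: (i %/ n)%N => [|k IH] //; rewrite mulSn -addnA addnC fn.
Qed.

Lemma cwalk_zwalk_arc n f i : (0 < n)%N -> cwalk E n f -> E (zwalk n f i) (zwalk n f (i + 1)).
Proof. by move=> n0 [fE fn]; apply: zwalk_arc => //; rewrite -(fn 0%N). Qed.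

(** Tracks 0 and a + 1 carry c', tracks 1 to a carry c, the next n tracks the witnesses, and the
    last |Q| tracks the bits of a one-hot code of tiles. A shift by r0 <= a takes a track with c to
    track a + 1, a larger one takes a track with c to track 0; the latter needs D + 1 <= a, whence
    the value of a. *)
Lemma kit_exists n (wit : nat -> nat -> A) c c' (g : nat -> bool -> A) cut :
  (forall d, (d < n)%N -> d != 1%N -> cwalk E n (wit d) /\ ~ E (wit d 0%N) (wit d d)) ->
  cwalk E n c -> cwalk E n c' -> (forall d, exists i, ~ E (c i) (c' (i + d)%N)) ->
  (0 < cut)%N -> (cut.+2 <= n)%N -> (forall b, g n b = g 0%N b) ->
  (forall i b, (i < n)%N -> E (g i b) (g i.+1 b)) -> ~ E (g 0%N false) (g 1%N true) ->
  (forall b b', E (g cut b) (g cut.+1 b')) ->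
  (forall i b b', (0 < i < cut)%N -> E (g i b) (g i.+1 b') -> g i.+1 b' = g i.+1 b) ->
  (forall i b b', (cut < i < n)%N -> E (g i b) (g i.+1 b') -> g i b = g i b') ->
  inhabited (kit E Q).
Proof.
move=> witP cc cc' kill cut0 cutn gn gE g01 gc gf gb.
have n0 : (0 < n)%N by lia.
pose a := (n + #|Q|).+1%N.
pose D := (n + #|Q|)%N.
have wit' : exists wit', forall d, cwalk E n (wit' d) /\ ((d < n)%N -> d != 1%N -> ~ E (wit' d 0%N) (wit' d d)).
  exists (fun d => if (d < n)%N && (d != 1%N) then wit d else c) => d.
  by case: ifP => [/andP[h1 h2]|h]; [have [] := witP d h1 h2|split=> // h1 h2; rewrite h1 h2 in h].
move: wit' => {wit witP} [wit witP].
pose T (r i : int) (b : bool) : A :=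
  if (r == 0) || (r == a%:Z + 1) then zwalk n c' i else if r <= a%:Z then zwalk n c i
  else if r < a%:Z + 2 + n%:Z then zwalk n (wit (absz (r - a%:Z - 2)%R)) i else zwalk n (g^~ b) i.
have TP (P : (bool -> int -> A) -> Prop) (r : int) : (forall f, cwalk E n f -> P (fun=> zwalk n f)) -> P (fun b => zwalk n (g^~ b)) -> P (fun (b : bool) (i : int) => T r i b).
  move=> h1 h2; rewrite /T; case: ((r == 0) || (r == a%:Z + 1)); first exact: h1.
  case: (r <= a%:Z); first exact: h1.
  case: (r < a%:Z + 2 + n%:Z); [by apply: h1; have [] := witP (absz (r - a%:Z - 2)%R)|exact: h2].
have zg i b : (0 <= i < n%:Z) -> zwalk n (g^~ b) i = g (absz i) b by move=> h; rewrite /zwalk modz_small.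
have zg1 i b : (0 <= i < n%:Z) -> zwalk n (g^~ b) (i + 1) = g (absz i).+1 b.
  move=> h; have [e|ne] := eqVneq (i + 1) n%:Z.
    by rewrite /zwalk e modzz absz0 -gn; congr g; lia.
  rewrite zg; last by lia.
  by have -> : absz (i + 1)%R = (absz i).+1 by lia.
constructor; refine (@Kit A E Q (a + 2 + D)%:Z n%:Z cut%:Z T (fun r q => r == (a + 2 + n + enum_rank q)%:Z) _ _ _ _ _ _ _ _ _ _).
- by lia.
- by lia.
- by lia.
- move=> r i b; pose P (F : bool -> int -> A) := F b (i + n%:Z) = F b i.
  by apply: (TP P) => [f cf|]; rewrite /P -{1}[n%:Z]mul1r zwalk_per.
- move=> r i b; pose P (F : bool -> int -> A) := E (F b i) (F b (i + 1)).
  apply: (TP P) => [f cf|]; first exact: cwalk_zwalk_arc.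
  apply: zwalk_arc => //; apply: gE; have := ltz_pmod i (_ : 0 < n%:Z); have := modz_ge0 i (_ : n%:Z != 0); lia.
- move=> r b b'; pose P (F : bool -> int -> A) := E (F b cut%:Z) (F b' (cut%:Z + 1)).
  apply: (TP P) => [f cf|]; first exact: cwalk_zwalk_arc.
  by rewrite /P zg ?zg1 ?absz_nat //; lia.
- move=> r i b b' iP; pose P (F : bool -> int -> A) := E (F b i) (F b' (i + 1)) -> F b' (i + 1) = F b (i + 1).
  apply: (TP P) => [//|]; rewrite /P zg ?zg1 //; try lia.
  by apply: gf; lia.
- move=> r i b b' iP; pose P (F : bool -> int -> A) := E (F b i) (F b' (i + 1)) -> F b i = F b' i.
  apply: (TP P) => [//|]; rewrite /P zg1 ?[zwalk n _ i]zg //; try lia.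
  by apply: gb; lia.
(* If q and q' differ, the track of q' has bit false for q and true for q', which [g01] forbids. *)
- move=> q q' h; have rq : (enum_rank q' < #|Q|)%N := ltn_ord (enum_rank q').
  have := h (a + 2 + n + enum_rank q')%:Z; rewrite eqxx /T !ifF; try (move: rq; rewrite /D; lia).
  rewrite zg ?(zg1 0) //; try lia.
  case: eqP => [e _|_ h']; last by case: g01; apply: h'; rewrite -/D; move: rq; rewrite /D; move: (nat_of_ord (enum_rank q')) => er; clear -er; lia.
  apply: enum_rank_inj; apply: val_inj => /=; case: e => /eqP.
  by rewrite eqn_add2l => /eqP.
move=> r0 d r0P; have [->|r0n] := eqVneq r0 0.
  case=> // dP; pose d' := absz (modz d n%:Z).
  have dE : d'%:Z = modz d n%:Z by rewrite gez0_abs // modz_ge0 //; lia.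
  have dn : (d' < n)%N by have := ltz_pmod d (_ : 0 < n%:Z); lia.
  have d1 : d' != 1%N.
    by apply/eqP => e; apply: dP; rewrite -modzDml -dE e subrr mod0z.
  exists (a%:Z + 2 + d'%:Z), 0; split; first by rewrite /D; lia.
  move=> b b'; rewrite addr0 modz_small ?divz_small //; try (rewrite /D; lia).
  have TE i b0 : T (a%:Z + 2 + d'%:Z) i b0 = zwalk n (wit d') i.
    have d'E : absz (a%:Z + 2 + d'%:Z - a%:Z - 2)%R = d' by lia.
    rewrite /T d'E ifF; last by lia.
    rewrite ifF; last by lia.
    by rewrite ifT //; lia.
  rewrite !TE (zwalk_small _ n0) addr0 add0r.
  have -> : zwalk n (wit d') d = wit d' d' by [].
  by have [_] := witP d'; apply.
move=> _.
have cz (i : nat) (e : int) : zwalk n c' (i%:Z + e) = c' (i + absz (modz e n%:Z))%N.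
  rewrite -(cwalk_zwalk _ n0 cc') PoszD gez0_abs; last by rewrite modz_ge0 //; lia.
  rewrite -[RHS](zwalk_per _ _ _ (divz e n%:Z)); congr zwalk.
  by rewrite -addrA; congr (_ + _); rewrite addrC -divz_eq.
have [h|h] := lerP r0 a%:Z.
  have [i iP] := kill (absz (modz d n%:Z)).
  exists (a%:Z + 1 - r0), i%:Z; split; first by rewrite /D; lia.
  move=> b b'; rewrite subrK modz_small ?divz_small //; try (rewrite /D; lia).
  rewrite {1}/T ifF ?ifT; try lia.
  by rewrite /T eqxx orbT addr0 cz (cwalk_zwalk _ n0 cc).
have [i iP] := kill (absz (modz (d + 1) n%:Z)).
have M0 : (a + 2 + D)%:Z != 0 by rewrite /a; lia.
exists ((a + 2 + D)%:Z - r0), i%:Z; split; first by move: h r0P; rewrite /a /D; lia.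
move=> b b'; rewrite subrK modzz divzz M0.
rewrite {1}/T ifF ?ifT; try (move: h r0P; rewrite /a /D; lia).
by rewrite /T eqxx -addrA cz (cwalk_zwalk _ n0 cc).
Qed.

End Kits.

Lemma rauzy_kit (A : finType) (H : set (int -> A)) (Q : finType) :
  ~ condition_D (rauzy_graph H) -> inhabited (kit (Defs.arc (rauzy_graph H)) Q).
Proof.
move=> nD; have [w w0 wP] := rw_periodic (Defs.arc (rauzy_graph H)).
have [S1 [S2 [S3 [v1 [v2 [w2 [x0 [x1 [y0 [y1]]]]]]]]]] := not_condition_D w0 wP nD.
case=> [[sS1 sS2 sS3] [Sv1 nv1] [Sv2 Sw2] [e2 ne2] sep].
have sw := shift_witness w0 wP sS1 sS2 sS3 Sv1 nv1 Sv2 Sw2 e2 ne2 sep.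
have [c [c' [cc cc' kill]]] := clashing_walks w0 wP sS3 sep.
have [g [cut [[cut0 cutn gn] gE g01 gc [gf gb]]]] := bit_gadget w0 wP sS3 sep.
have /choice[wit witP] : forall d, exists f, (d < 6 * w * w)%N -> d != 1%N ->
    cwalk (Defs.arc (rauzy_graph H)) (6 * w * w) f /\ ~ Defs.arc (rauzy_graph H) (f 0%N) (f d).
  move=> d; have [h|] := pselect ((d < 6 * w * w)%N /\ d != 1%N); last by exists c => *; tauto.
  by have [f fP] := sw d h.1 h.2; exists f.
exact: (kit_exists Q witP cc cc' kill cut0 cutn gn gE g01 gc gf gb).
Qed.

(** * The vertical subshift *)

Section LocalRules.
Local Open Scope ring_scope.
Local Open Scope classical_set_scope.
Variable A : finType.

Lemma local_rule_sft (a0 : A) (P : (int -> A) -> Prop) (N : nat) :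
  (forall x y : int -> A, (forall k : nat, (k < N)%N -> x k = y k) -> P x -> P y) ->
  is_sft [set x : int -> A | forall i, P (fun h => x (i + h))].
Proof.
move=> PN; pose ext (t : seq A) (h : int) := nth a0 t (absz h).
exists (map (@tval N A) [seq t : N.-tuple A <- enum {: N.-tuple A} | ~~ `[< P (ext t) >]]).
apply/seteqP; split=> x /= h.
  move=> u /mapP[t]; rewrite mem_filter => /andP[/asboolPn nP _] -> [i ei]; apply: nP.
  apply: PN (h i) => k kN; rewrite /ext absz_nat -[in RHS]ei.
  by rewrite size_tuple nth_mkseq.
move=> i; apply: contrapT => nP.
pose t := mkseq (fun k : nat => x (i + k%:Z)) N.
have ts : size t == N by rewrite size_mkseq.
apply: (h (Tuple ts)); last by exists i; rewrite /word_at size_tuple.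
apply/mapP; exists (Tuple ts) => //; rewrite mem_filter mem_enum andbT.
apply/asboolPn => h'; apply: nP; apply: PN h' => k kN.
by rewrite /ext absz_nat nth_mkseq.
Qed.

Variable H : set (int -> A).
Notation E := (Defs.arc (rauzy_graph H)).

Lemma rauzy_arc x k : H x -> E (x k) (x (k + 1)).
Proof.
by move=> Hx; apply/asboolP; exists x => //; exists k; congr [:: _; _]; congr x; lia.
Qed.

Lemma nearest_neighbor_arcs x : is_nearest_neighbor H -> (forall k, E (x k) (x (k + 1))) -> H x.
Proof.
case=> F F2 HF h; rewrite HF => u uF [i]; have := F2 u uF.
case: u uF => [|a [|b []]] // uF _ [xa xb]; have := h i.
rewrite -[i in x i]addr0 xa xb => /asboolP[y Hy oc].
by move: Hy; rewrite HF => /(_ _ uF).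
Qed.

End LocalRules.

Section Columns.
Local Open Scope ring_scope.
Local Open Scope classical_set_scope.
Variables (A : finType) (E : rel A) (Q : finType) (K : kit E Q) (hR vR : rel Q).
Notation M := (kM K).
Notation n := (kn K).
Notation cut := (kcut K).
Notation T := (kT K).
Notation bit := (kbit K).
Notation L := (M * n).

Let M0 : 0 < M := kM0 K.
Let c0 : 0 < cut := kcut0 K.
Let cn : cut + 2 <= n := kcutn K.
Let L0 : 0 < L. Proof. by rewrite mulr_gt0 //; lia. Qed.
Let L3 : 3 * M <= L. Proof. by rewrite mulrC ler_pM2l //; lia. Qed.

(* Column k is cut into blocks of height L = M * n, and block j, which stands for the cell
   (k, j), starts at height j * L - s - M * k.  The letter of the block at height M * i + r is
   in track r, at index i: along a row the track is constant and the index increases by 1. *)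
Definition letter (s : int) (w : int -> int -> Q) (k h : int) : A :=
  let u := h + s + M * k in let r := modz u M in let i := modz (divz u M) n in
  let j := divz (divz u M) n in
  T r i (bit r (if i <= cut then w (k - i) j else w (k + n - i) (j + 1))).

Definition fits (u : int) (a : A) := exists b, a = T (modz u M) (divz u M) b.

(** Index 0 shows the tile q of the cell and index 1, one step further along the rows, the tile c of
    the left neighbour; q' is the tile above. Both tile relations thus become rules on a single
    column. *)
Definition block_ok (z : int -> A) := exists c q q',
  [/\ forall r : int, 0 <= r < M -> z r = T r 0 (bit r q), forall r : int, 0 <= r < M -> z (M + r) = T r 1 (bit r c),
      forall r : int, 0 <= r < M -> z (L + r) = T r 0 (bit r q'), hR c q & vR q q'].

Definition column_ok (i m s : int) (x : int -> A) :=
  (forall h : int, i <= h < i + m -> fits (h + s) (x h)) /\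
  forall j : int, i <= j * L - s -> (j + 2) * L - s <= i + m -> block_ok (fun u => x (j * L - s + u)).

(** A window of length 3 L contains two successive full blocks, and windows overlap enough for their
    offsets s to agree modulo L. *)
Definition column_shift : set (int -> A) :=
  [set x | forall i, exists s, column_ok 0 (3 * L) s (fun h => x (i + h))].

Lemma kper_mul r i b z : T r (i + z * n) b = T r i b.
Proof.
have nat_per i' (k : nat) : T r (i' + k%:Z * n) b = T r i' b.
  elim: k => [|k IH]; first by rewrite mul0r addr0.
  by rewrite -[RHS]IH -(kper K r (i' + k%:Z * n)); congr T; lia.
have [k [->|->]] : exists k : nat, z = k%:Z \/ z = - k%:Z by exists (absz z); lia.
  exact: nat_per.
by rewrite -(nat_per (i + - k%:Z * n) k); congr T; lia.
Qed.

Lemma coords (r v : int) : 0 <= r < M -> modz (M * v + r) M = r /\ divz (M * v + r) M = v.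
Proof.
move=> rM; rewrite mulrC modzMDl modz_small // divzMDl ?gt_eqF // divz_small ?addr0 //.
by move: rM; lia.
Qed.

Lemma fits_per u z a : fits (u + z * L) a <-> fits u a.
Proof.
have -> : u + z * L = (z * n) * M + u by lia.
rewrite /fits modzMDl divzMDl ?gt_eqF // [z * n + _]addrC.
by split=> -[b ->]; exists b; rewrite kper_mul.
Qed.

Lemma fits_mod u u' a : (u' = u %[mod L])%Z -> fits u a <-> fits u' a.
Proof.
move=> e; rewrite [in X in X <-> _](divz_eq u L) [in X in _ <-> X](divz_eq u' L) e.
by rewrite ![_ * L + _]addrC !fits_per.
Qed.

Lemma shift_clash (t : int) : (modz (t - M) L <> 0)%Z -> exists u, forall a b, fits u a -> fits (u + t) b -> ~ E a b.
Proof.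
move=> tP; have tE := divz_eq t M.
have r0P : 0 <= modz t M < M by rewrite modz_ge0 ?ltz_pmod //; lia.
have [|r [i [rM iP]]] := kkill (k := K) (d := divz t M) r0P.
  have [r0|] := eqVneq (modz t M) 0; last by left; apply/eqP.
  right=> d1; apply: tP; rewrite tE r0 addr0 -[X in _ - X]mul1r -mulrBl.
  by rewrite (divz_eq (divz t M - 1) n) d1 addr0 -mulrA [n * M]mulrC modzMl.
exists (M * i + r) => a b [c ->] [c' ->].
have [-> ->] := coords i rM.
have -> : M * i + r + t = (i + divz t M) * M + (r + modz t M) by lia.
by rewrite modzMDl divzMDl ?gt_eqF.
Qed.

Lemma fits_pred u a : fits (u + M) a -> exists2 b, fits u b & E b a.
Proof.
have -> : u + M = 1 * M + u by lia.
rewrite /fits modzMDl divzMDl ?gt_eqF // => -[c ->].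
exists (T (modz u M) (divz u M) c); first by exists c.
by rewrite addrC; apply: karc.
Qed.

Lemma window_residue (i u : int) : exists2 h : int, i <= h < i + L & (modz h L = modz u L)%Z.
Proof.
exists (i + modz (u - i) L); first by rewrite lerDl ltrD2l modz_ge0 ?ltz_pmod //; lia.
by rewrite modzDmr addrC subrK.
Qed.

(** A letter that fits a phase has a predecessor that fits the phase lower by M. If the letters also
    fitted another phase, these arcs would realise a shift other than M, against [shift_clash]. *)
Lemma offset_unique i s s' x : (forall h : int, i <= h < i + L -> fits (h + s) (x h)) ->
  (forall h : int, i <= h < i + L -> fits (h + s') (x h)) -> (modz (s' - s) L = 0)%Z.
Proof.
move=> h h'; apply: contrapT => ne.
have [|u uP] := @shift_clash (s' - s + M); first by rewrite addrK.
have [y yi yu] := window_residue i (u + M - s).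
have [|b ub ba] := @fits_pred u (x y).
  have e : modz (y + s) L = modz (u + M) L by rewrite -modzDml yu modzDml subrK.
  exact: (fits_mod (x y) e).2 (h _ yi).
have e : modz (y + s') L = modz (u + (s' - s + M)) L.
  by rewrite -modzDml yu modzDml; congr modz; lia.
by apply: uP ub _ ba; apply: (fits_mod (x y) e).2 (h' _ yi).
Qed.

Lemma offset_step s s' x y : (forall h : int, fits (h + s) (x h)) -> (forall h : int, fits (h + s') (y h)) ->
  (forall h, E (x h) (y h)) -> (modz (s' - s - M) L = 0)%Z.
Proof.
move=> h h' xy; apply: contrapT => ne.
have [u uP] := shift_clash ne.
apply: uP (xy (u - s)); first by rewrite -{1}(subrK s u).
by have := h' (u - s); congr fits; lia.
Qed.

Lemma column_ok_shift i m s x z : column_ok i m s x -> column_ok i m (s + z * L) x.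
Proof.
move=> [h1 h2]; split=> [h hi|j j1 j2]; first by rewrite addrA; apply/fits_per/h1.
have := h2 (j - z); rewrite (_ : (j - z) * L - s = j * L - (s + z * L)); last by lia.
by apply=> //; lia.
Qed.

Lemma column_ok_mod i m s s' x : (modz (s' - s) L = 0)%Z -> column_ok i m s x -> column_ok i m s' x.
Proof.
move=> e; have := divz_eq (s' - s) L; rewrite e addr0 => e'.
by move/(@column_ok_shift _ _ _ _ (divz (s' - s) L)); rewrite -e' addrC subrK.
Qed.

Lemma column_ok_translate i m s x :
  column_ok 0 m s (fun h => x (i + h)) -> column_ok i m (s - i) x.
Proof.
move=> [h1 h2]; split=> [h hi|j j1 j2].
  have e1 : i + (h - i) = h by lia.
  have e2 : h - i + s = h + (s - i) by lia.
  by have := h1 (h - i); rewrite e1 e2; apply; lia.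
have := h2 j; have -> : (fun u => x (i + (j * L - s + u))) = (fun u => x (j * L - (s - i) + u)).
  by apply/funext => u; congr x; lia.
by apply; lia.
Qed.

Definition good_column s x := (forall h : int, fits (h + s) (x h)) /\
  forall j : int, block_ok (fun u => x (j * L - s + u)).

Lemma column_shiftP x : column_shift x <-> exists s, good_column s x.
Proof.
split=> [h|[s [h1 h2]] i]; last first.
  exists (s + i); split=> [u _|j _ _]; first by have := h1 (i + u); congr fits; lia.
  by have := h2 j; congr block_ok; apply/funext => u; congr x; lia.
have /choice[s sP] : forall i, exists s, column_ok i (3 * L) s x.
  by move=> i; have [s /column_ok_translate hs] := h i; exists (s - i).
have sE i : (modz (s i - s 0) L = 0)%Z.
  suff e : modz (s i) L = modz (s 0) L by rewrite -modzDml e modzDml subrr mod0z.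
  apply: (@int_periodic _ (fun i => modz (s i) L)) => {}i.
  have := @offset_unique (i + 1) (s i) (s (i + 1)) x.
  have [h1 _] := sP i; have [h2 _] := sP (i + 1).
  move=> /(_ _ _)e; rewrite -[s (i + 1)](subrK (s i)) -modzDml e ?add0r //.
    by move=> u uP; apply: h1; lia.
  by move=> u uP; apply: h2; lia.
have ok i : column_ok i (3 * L) (s 0) x.
  apply: column_ok_mod (sP i); have := sE i; rewrite -[s 0 - s i]opprB => e.
  by rewrite -modzNm e oppr0 mod0z.
exists (s 0); split=> [u|j]; first by have [h1 _] := ok u; apply: h1; lia.
by have [_ h2] := ok (j * L - s 0); apply: h2; lia.
Qed.

Lemma column_shift_sft : is_sft column_shift.
Proof.
apply: (@local_rule_sft _ (T 0 0 false) (fun z => exists s, column_ok 0 (3 * L) s z) (absz (3 * L)%R)).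
move=> x y xy [s [h1 h2]]; exists s.
have {}xy (h : int) : 0 <= h < 3 * L -> x h = y h.
  by move=> hP; have := xy (absz h); rewrite gez0_abs; [apply; lia|lia].
split=> [h hP|j j1 j2]; first by rewrite -xy; [apply: h1|lia].
have [c [q [q' [b1 b2 b3 b4 b5]]]] := h2 j j1 j2.
by exists c, q, q'; split=> // r rM; rewrite -?b1 -?b2 -?b3 //; apply/esym/xy; lia.
Qed.

End Columns.

Section Configurations.
Local Open Scope ring_scope.
Local Open Scope classical_set_scope.
Variables (A : finType) (H : set (int -> A)) (Q : finType).
Hypothesis nnH : is_nearest_neighbor H.
Notation E := (Defs.arc (rauzy_graph H)).
Variables (K : kit E Q) (hR vR : rel Q).
Notation M := (kM K).
Notation n := (kn K).
Notation cut := (kcut K).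
Notation T := (kT K).
Notation bit := (kbit K).
Notation L := (M * n).
Notation X := (combined_subshift H (column_shift K hR vR)).

Let M0 : 0 < M := kM0 K.
Let c0 : 0 < cut := kcut0 K.
Let cn : cut + 2 <= n := kcutn K.

Definition tiling (w : int -> int -> Q) :=
  (forall x y, hR (w x y) (w (x + 1) y)) /\ (forall x y, vR (w x y) (w x (y + 1))).

Lemma letterE s w (k j i r : int) : 0 <= r < M -> 0 <= i < n ->
  letter K s w k (j * L + M * i + r - s - M * k) =
  T r i (bit r (if i <= cut then w (k - i) j else w (k + n - i) (j + 1))).
Proof.
move=> rM iP; rewrite /letter.
have -> : j * L + M * i + r - s - M * k + s + M * k = M * (n * j + i) + r by lia.
have [-> ->] := coords (n * j + i) rM.
have -> : modz (n * j + i) n = i by rewrite mulrC modzMDl modz_small.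
have -> // : divz (n * j + i) n = j.
rewrite mulrC divzMDl; last by lia.
by rewrite divz_small ?addr0 //; lia.
Qed.

Lemma int_coords s (k h : int) : exists j i r : int,
  [/\ 0 <= r < M, 0 <= i < n & h = j * L + M * i + r - s - M * k].
Proof.
pose u := h + s + M * k; exists (divz (divz u M) n), (modz (divz u M) n), (modz u M).
split; [by rewrite modz_ge0 ?ltz_pmod //; lia|by rewrite modz_ge0 ?ltz_pmod //; lia|].
have e1 := divz_eq u M; have e2 := divz_eq (divz u M) n.
have : u = divz (divz u M) n * L + M * modz (divz u M) n + modz u M.
  by rewrite {1}e1 {1}e2; lia.
by move: (divz (divz u M) n) => d1; rewrite /u; lia.
Qed.

Lemma kper1 r b : T r n b = T r 0 b.
Proof. by rewrite -[n in LHS]add0r kper. Qed.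

(** Along a row, the bit belongs to the last cell met at index 0 up to [cut], and to the next such
    cell after it; at the switch [kmerge] gives the arc whatever the two bits are. *)
Lemma letter_combined s w : tiling w -> X (fun kh => letter K s w kh.1 kh.2).
Proof.
move=> [wh wv].
have row k h0 : E (letter K s w k h0) (letter K s w (k + 1) h0).
  have [j [i [r [rM iP hE]]]] := int_coords s k h0.
  rewrite {1}hE (letterE _ _ _ _ rM iP).
  have [i1|i1] := ltrP (i + 1) n.
    have -> : h0 = j * L + M * (i + 1) + r - s - M * (k + 1) by lia.
    rewrite letterE //; last by lia.
    have [ic|ci] := lerP (i + 1) cut.
      rewrite ifT; last by lia.
      have -> : k + 1 - (i + 1) = k - i by lia.
      exact: karc.
    have [ic|ic] := lerP i cut.
      have -> : i = cut by lia.
      exact: kmerge.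
    have -> : k + 1 + n - (i + 1) = k + n - i by lia.
    exact: karc.
  have iE : i = n - 1 by lia.
  have -> : h0 = (j + 1) * L + M * 0 + r - s - M * (k + 1) by rewrite hE iE; lia.
  rewrite letterE //; last by lia.
  rewrite ifF; last by lia.
  rewrite ifT; last by lia.
  have -> : k + n - i = k + 1 - 0 by lia.
  by rewrite -kper1 -[n in X in E _ X](subrK 1) -iE; apply: karc.
move=> k0 h0; split; first by apply: nearest_neighbor_arcs => // k; apply: row.
apply/column_shiftP; exists (s + M * k0); split=> [h|j] /=.
  have [j [i [r [rM iP hE]]]] := int_coords s k0 h.
  rewrite {2}hE (letterE _ _ _ _ rM iP); set b := bit _ _; exists b.
  have -> : h + (s + M * k0) = M * (i + j * n) + r by rewrite hE; lia.
  by have [-> ->] := coords (i + j * n) rM; rewrite kper_mul.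
exists (w (k0 - 1) j), (w k0 j), (w k0 (j + 1)); split.
- move=> r rM; have -> : j * L - (s + M * k0) + r = j * L + M * 0 + r - s - M * k0 by lia.
  by rewrite letterE ?subr0 ?ifT //; lia.
- move=> r rM; have -> : j * L - (s + M * k0) + (M + r) = j * L + M * 1 + r - s - M * k0 by lia.
  by rewrite letterE ?ifT //; lia.
- move=> r rM; have -> : j * L - (s + M * k0) + (L + r) = (j + 1) * L + M * 0 + r - s - M * k0 by lia.
  by rewrite letterE ?subr0 ?ifT //; lia.
- by have := wh (k0 - 1) j; rewrite subrK.
- exact: wv.
Qed.

(** By [offset_step] successive offsets differ by M, so a single s serves all columns. Tiles are
    read at index 0, and all other letters follow from there along the rows. *)
Lemma combined_letter x : X x -> exists s w, tiling w /\ forall k h, x (k, h) = letter K s w k h.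
Proof.
move=> Xx.
have xE k h : E (x (k, h)) (x (k + 1, h)) by have [Hx _] := Xx k h; apply: (rauzy_arc _ Hx).
have /choice[s0 s0P] : forall k, exists s, good_column K hR vR s (fun h => x (k, h)).
  by move=> k; have [_ /column_shiftP] := Xx k 0.
pose s := s0 0; exists s.
have sE k : modz (s + M * k - s0 k) L = 0.
  have e : modz (M * k - s0 k) L = modz (M * 0 - s0 0) L.
    apply: (@int_periodic _ (fun k => modz (M * k - s0 k) L)) => {}k.
    have := offset_step (s0P k).1 (s0P (k + 1)).1 (xE k) => e.
    have -> : M * k - s0 k = (M * (k + 1) - s0 (k + 1)) + (s0 (k + 1) - s0 k - M) by lia.
    by rewrite -[in RHS]modzDmr e addr0.
  have -> : s + M * k - s0 k = s + (M * k - s0 k) by lia.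
  by rewrite -modzDmr e modzDmr /s mulr0 sub0r subrr mod0z.
have gc k : good_column K hR vR (s + M * k) (fun h => x (k, h)).
  have := sE k; have := divz_eq (s + M * k - s0 k) L => /[swap] -> dE.
  have [h1 h2] := s0P k; set z := divz _ _ in dE.
  have -> : s + M * k = s0 k + z * L by lia.
  split=> [h|j]; first by rewrite addrA; apply/fits_per.
  by have := h2 (j - z); congr block_ok; apply/funext => u; congr (x (_, _)); ring.
have /choice[c /choice[q /choice[q' bP]]] : forall kj : int * int, exists c q q',
  [/\ forall r : int, 0 <= r < M -> x (kj.1, kj.2 * L - (s + M * kj.1) + r) = T r 0 (bit r q),
      forall r : int, 0 <= r < M -> x (kj.1, kj.2 * L - (s + M * kj.1) + (M + r)) = T r 1 (bit r c),
      forall r : int, 0 <= r < M -> x (kj.1, kj.2 * L - (s + M * kj.1) + (L + r)) = T r 0 (bit r q'),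
      hR c q & vR q q'].
  by move=> [k j]; have [_ /(_ j)] := gc k.
pose w k j := q (k, j); exists w.
pose at_ (k j i r : int) := x (k, j * L + M * i + r - s - M * k).
have own k j (r : int) : 0 <= r < M -> at_ k j 0 r = T r 0 (bit r (w k j)).
  by move=> rM; have [/(_ r rM)/= <- _ _ _ _] := bP (k, j); congr (x (_, _)); ring.
have claim k j (r : int) : 0 <= r < M -> at_ k j 1 r = T r 1 (bit r (c (k, j))).
  by move=> rM; have [_ /(_ r rM)/= <- _ _ _] := bP (k, j); congr (x (_, _)); ring.
have step k j i r : E (at_ k j i r) (at_ (k + 1) j (i + 1) r).
  by have := xE k (j * L + M * i + r - s - M * k); congr (E _ (x (_, _))); ring.
have cE k j : c (k + 1, j) = w k j.
  apply: esym; apply: (@kclaim _ _ _ K) => r rM; rewrite -own // -claim //.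
(* Both tiles have the same letters at index 0, so [karc] provides the arcs that [kclaim] asks
   for. *)
have q'E k j : q' (k, j) = w k (j + 1).
  apply: (@kclaim _ _ _ K) => r rM.
  have -> : T r 0 (bit r (q' (k, j))) = T r 0 (bit r (w k (j + 1))).
    rewrite -own //; have [_ _ /(_ r rM)/= <- _ _] := bP (k, j); congr (x (_, _)); ring.
  exact: karc.
split.
  split=> k j; first by have [_ _ _] := bP (k + 1, j); rewrite cE.
  by have [_ _ _ _] := bP (k, j); rewrite q'E.
have fit k j (i r : int) : 0 <= r < M -> exists b, at_ k j i r = T r i b.
  move=> rM; have [/(_ (j * L + M * i + r - s - M * k)) h _] := gc k.
  move: h; have -> : j * L + M * i + r - s - M * k + (s + M * k) = M * (i + j * n) + r by ring.
  by rewrite /fits; have [-> ->] := coords (i + j * n) rM => -[b]; rewrite kper_mul; exists b.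
have fwd (r : int) (i : nat) : 0 <= r < M -> i%:Z <= cut ->
    forall k j, at_ k j i%:Z r = T r i%:Z (bit r (w (k - i%:Z) j)).
  move=> rM; elim: i => [|i IH] ic k j; first by rewrite subr0 own.
  have [->|i0] := eqVneq i 0%N.
    by have := claim k j r rM; have := cE (k - 1) j; rewrite subrK => ->.
  have iE : i.+1%:Z = i%:Z + 1 by lia.
  have [b bE] := fit k j i.+1%:Z r rM; rewrite bE.
  have := step (k - 1) j i%:Z r; rewrite IH ?subrK -?iE; last by lia.
  rewrite bE iE => /kfwd ->; last by lia.
  by congr (T r _ (bit r (w _ _))); lia.
have bwd (r : int) (d : nat) : 0 <= r < M -> d%:Z < n - cut ->
    forall k j, at_ k j (n - d%:Z) r = T r (n - d%:Z) (bit r (w (k + d%:Z) (j + 1))).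
  move=> rM; elim: d => [|d IH] dc k j.
    rewrite subr0 addr0 kper1 -own //; congr (x (_, _)); ring.
  have dE : n - d.+1%:Z + 1 = n - d%:Z by lia.
  have [b bE] := fit k j (n - d.+1%:Z) r rM; rewrite bE.
  have := step k j (n - d.+1%:Z) r; rewrite dE IH; last by lia.
  rewrite bE -dE => /kbwd ->; last by lia.
  by congr (T r _ (bit r (w _ _))); lia.
move=> k h; have [j [i [r [rM iP hE]]]] := int_coords s k h.
rewrite hE (letterE _ _ _ _ rM iP) -/(at_ k j i r); case: ifP => ic.
  have := @fwd r (absz i) rM; rewrite gez0_abs; last by lia.
  by move=> /(_ ic k j).
have := @bwd r (absz (n - i)%R) rM; rewrite gez0_abs; last by lia.
move=> /(_ _ k j); have -> : n - (n - i) = i by lia.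
by move=> -> //; [congr (T r _ (bit r (w _ _))); lia|lia].
Qed.

End Configurations.

(** * Counting patterns *)

Section Levels.
Local Open Scope ring_scope.
Variable m : machine.
Notation D := (datum m).
Notation Q := (cell D).

Definition on_level (a : nat -> int) (k : nat) (x : int) := exists i, x = gridpt (pow2 k) (a k) i.

Definition nested (a : nat -> int) := forall k, exists z : int, a k.+1 = a k + 2 * pow2 k * z.

Lemma nested_above a k k' : nested a -> (k <= k')%N -> exists z : int, a k' = a k + pow2 k * (2 * z).
Proof.
move=> na; elim: k' => [|k' IH]; first by rewrite leqn0 => /eqP->; exists 0; lia.
rewrite leq_eqVlt => /orP[/eqP->|]; first by exists 0; lia.
rewrite ltnS => kk; have [z zE] := IH kk; have [z' ->] := na k'; rewrite zE.
have -> : pow2 k' = pow2 k * pow2 (k' - k) by rewrite /pow2 -PoszM -expnD subnKC.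
by exists (z + pow2 (k' - k) * z'); lia.
Qed.

Lemma on_level_unique a k k' x : nested a -> on_level a k x -> on_level a k' x -> k = k'.
Proof.
suff H k1 k2 : nested a -> (k1 < k2)%N -> on_level a k1 x -> on_level a k2 x -> False.
  by move=> na h h'; case: (ltngtP k k') => // /(H _ _ na); [move/(_ h h')|move/(_ h' h)].
move=> na kk [i ->] [j]; have [z ->] := nested_above na (ltnW kk); rewrite /gridpt.
have -> : pow2 k2 = pow2 k1 * (2 * pow2 (k2 - k1.+1)).
  by rewrite /pow2 -!PoszM -expnS -expnD; congr (Posz (2 ^ _)); lia.
move=> e; have : pow2 k1 * (2 * i + 1) = pow2 k1 * (2 * z + 2 * pow2 (k2 - k1.+1) * (2 * j + 1)) by lia.
have /mulfI h : pow2 k1 != 0 by rewrite gt_eqF ?pow2_gt0.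
by move/h; lia.
Qed.

(** The lines without a level below K have density 2^-K, even when some of them lie on no level
    whatsoever. *)
Lemma level_or_grid a K x : nested a -> (exists2 k, (k < K)%N & on_level a k x) \/ exists z, x = a K + pow2 K * z.
Proof.
move=> na; elim: K => [|K [[k kK h]|[z xE]]]; first by right; exists (x - a 0%N); rewrite /pow2; lia.
  by left; exists k => //; lia.
have [z1|z0] : (modz z 2 = 1 \/ modz z 2 = 0) by lia.
  by left; exists K => //; exists (divz z 2); rewrite /gridpt xE {1}(divz_eq z 2) z1; lia.
have [z' aE] := na K; right; exists (divz z 2 - z').
by rewrite aE xE pow2S {1}(divz_eq z 2) z0; lia.
Qed.

Lemma near_gridpt p b y : 0 < p -> exists j, gridpt p b j - p < y <= gridpt p b j + p.
Proof.
move=> p0; exists (divz (y - 1 - b) (2 * p)); rewrite /gridpt.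
have := divz_eq (y - 1 - b) (2 * p); have := ltz_pmod (y - 1 - b) (_ : 0 < 2 * p).
have := modz_ge0 (y - 1 - b) (_ : 2 * p != 0).
move: (divz _ _) (modz _ _) => q r h1 h2 e.
have {}h1 := h1 ltac:(lia); have {}h2 := h2 ltac:(lia).
have -> : p * (2 * q + 1) = q * (2 * p) + p by lia.
by move: (q * (2 * p)) e => u; lia.
Qed.

Definition leveled (w : int -> int -> Q) (a b : nat -> int) (beta : nat -> bool) := [/\ mwang w,
  nested a /\ nested b,
  forall k, level (fun x y => cW (w x y)) (fun x y => cS (w x y)) (pow2 k) (a k) (b k),
  moutput m beta /\ (forall k i, mfree (lev_d (fun x y => cW (w x y)) (pow2 k) (a k) (b k) i) = beta k) &
  forall x y, cpx (w x y) = cpx (w x 0) /\ cpy (w x y) = cpy (w 0 y)].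

Lemma leveled_exists w : mwang w -> exists a b beta, leveled w a b beta.
Proof.
move=> wP; have [a [b [s [t [[lev aS bS] [_ _ hP hi] par]]]]] := wang_levels wP.
have [beta bout bE] := wang_run t wP lev hP hi.
exists a, b, beta; split=> //.
- by split=> k; [exists (s k)%:Z|exists (t k)%:Z].
- by move=> x y; have [-> ->] := par x y; have [-> _] := par x 0; have [_ ->] := par 0 y.
Qed.

Section Leveled.
Variables (w : int -> int -> Q) (a b : nat -> int) (beta : nat -> bool).
Hypothesis lw : leveled w a b beta.

Definition col_tag x := tag (cS (w x 0)).
Definition col_dat x := dat (cS (w x 0)).
Definition row_tag y := tag (cW (w 0 y)).

Lemma col_tagE k i : col_tag (gridpt (pow2 k) (a k) i) = lev_c (fun x y => cW (w x y)) (pow2 k) (a k) (b k) i /\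
  col_dat (gridpt (pow2 k) (a k) i) = lev_d (fun x y => cW (w x y)) (pow2 k) (a k) (b k) i.
Proof.
have [_ _ lev _ _] := lw; have [j jP] := near_gridpt (b k) 0 (pow2_gt0 k).
by rewrite /col_tag /col_dat (col_arm (wang_tile (let: And5 h _ _ _ _ := lw in h)) i (lev k) jP).
Qed.

Lemma row_tagE k j : row_tag (gridpt (pow2 k) (b k) j) = lev_r (fun x y => cW (w x y)) (pow2 k) (a k) (b k) j.
Proof.
have [_ _ lev _ _] := lw; have [i iP] := near_gridpt (a k) 0 (pow2_gt0 k).
by rewrite /row_tag (row_arm (wang_tile (let: And5 h _ _ _ _ := lw in h)) j (lev k) iP).
Qed.

Lemma free_level k x : on_level a k x -> mfree (col_dat x) = beta k.
Proof. by case=> i ->; rewrite (col_tagE k i).2; have [_ _ _ [_ ->]] := lw. Qed.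

Lemma hz_value k X x y : on_level a k X -> on_level b k y -> X - pow2 k < x <= X + pow2 k ->
  cW (w x y) = (X < x, (if X < x then ~~ col_tag X else col_tag X), col_dat X, row_tag y).
Proof.
case=> i -> [j ->] h; have [_ _ lev _ _] := lw.
rewrite (col_tagE k i).1 (col_tagE k i).2 row_tagE.
exact: (row_arm (wang_tile (let: And5 h _ _ _ _ := lw in h)) j (lev k) h).
Qed.

Lemma vz_value k Y x y : on_level a k x -> on_level b k Y -> Y - pow2 k < y <= Y + pow2 k ->
  cS (w x y) = (Y < y, (if Y < y then ~~ row_tag Y else row_tag Y), col_dat x, col_tag x).
Proof.
case=> i -> [j ->] h; have [_ _ lev _ _] := lw.
rewrite (col_tagE k i).1 (col_tagE k i).2 row_tagE.
exact: (col_arm (wang_tile (let: And5 h _ _ _ _ := lw in h)) i (lev k) h).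
Qed.

(** A bit requires a cross tile, and on a row of level k' the signals diverge only at the columns of
    level k'. *)
Lemma bit_level k k' x y : on_level a k x -> on_level b k' y -> cbit (w x y) -> k = k' /\ beta k.
Proof.
move=> kx ky bt; have [wP [na nb] _ _ _] := lw.
have /and3P[_ /implyP/(_ bt)/andP[cr fr] _] := wang_ok wP x y.
have {cr} /and4P[/eqP cW_ /eqP cE_ _ _] := cr.
rewrite (wang_E wP) in cE_.
have [i iP] := near_gridpt (a k') x (pow2_gt0 k').
have kX : on_level a k' (gridpt (pow2 k') (a k') i) by exists i.
have xX : gridpt (pow2 k') (a k') i = x.
  move: (gridpt _ _ _) kX iP => X kX iP.
  have := hz_value kX ky iP; rewrite {1}cW_ => -[xX _ _ _].
  have [xX'|] := ltrP x X; last by lia.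
  have iP' : X - pow2 k' < x + 1 <= X + pow2 k' by lia.
  by have := hz_value kX ky iP'; rewrite cE_ => -[e _ _]; move: e; lia.
rewrite xX in kX; have kk := on_level_unique na kx kX; split=> //.
rewrite -(free_level kx); move: fr; rewrite (hz_value kX ky (x := x)) //.
by have := pow2_gt0 k'; lia.
Qed.

End Leveled.

Variable K : nat.

Definition lev_below (a : nat -> int) x : option 'I_K := [pick k : 'I_K | `[< on_level a k x >]].

Lemma lev_belowP a k x : nested a -> lev_below a x = Some k <-> on_level a k x.
Proof.
move=> na; rewrite /lev_below; case: pickP => [k' /asboolP k'x|nx].
  by split=> [[<-]//|kx]; congr Some; apply: val_inj; apply: on_level_unique k'x kx.
by split=> // kx; have /asboolP := nx k.
Qed.

Definition col_info w a x := (lev_below a x, col_tag w x, col_dat w x, cpx (w x 0)).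
Definition row_info w b y := (lev_below b y, row_tag w y, cpy (w 0 y)).

Lemma pow2_le k : (k < K)%N -> pow2 k <= pow2 K.
Proof. by move=> kK; rewrite /pow2 lez_nat leq_exp2l // ltnW. Qed.

(** On a line of level below K, each edge belongs to an arm of a cross at distance at most 2^K, and
    its signal consists of the orientations and the datum of the lines through that cross. So
    one-dimensional information determines the cell. *)
Lemma same_edges w w' a a' b b' beta beta' x y k k' :
  leveled w a b beta -> leveled w' a' b' beta' ->
  (forall X, x - pow2 K <= X <= x + 1 + pow2 K -> col_info w a X = col_info w' a' X) ->
  (forall Y, y - pow2 K <= Y <= y + 1 + pow2 K -> row_info w b Y = row_info w' b' Y) ->
  lev_below a x = Some k -> lev_below b y = Some k' ->
  [/\ cW (w x y) = cW (w' x y), cE (w x y) = cE (w' x y), cS (w x y) = cS (w' x y),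
      cN (w x y) = cN (w' x y) & cpx (w x y) = cpx (w' x y) /\ cpy (w x y) = cpy (w' x y)].
Proof.
move=> lw lw' hc hr xk yk; have [wP [na nb] _ _ par] := lw.
have [wP' [na' nb'] _ _ par'] := lw'.
have K0 := pow2_gt0 K.
have hx X : x - pow2 K <= X <= x + 1 + pow2 K -> [/\ lev_below a X = lev_below a' X,
    col_tag w X = col_tag w' X, col_dat w X = col_dat w' X & cpx (w X 0) = cpx (w' X 0)].
  by move=> h; have := hc X h; rewrite /col_info => -[? ? ? ?].
have hy Y : y - pow2 K <= Y <= y + 1 + pow2 K -> [/\ lev_below b Y = lev_below b' Y,
    row_tag w Y = row_tag w' Y & cpy (w 0 Y) = cpy (w' 0 Y)].
  by move=> h; have := hr Y h; rewrite /row_info => -[? ? ?].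
have {hc hr} hz z : x <= z <= x + 1 -> cW (w z y) = cW (w' z y).
  move=> zP; have [i iP] := near_gridpt (a k') z (pow2_gt0 k').
  have kX : on_level a k' (gridpt (pow2 k') (a k') i) by exists i.
  move: (gridpt _ _ _) kX iP => X kX iP; have k'K := pow2_le (ltn_ord k').
  have [|e1 e2 e3 _] := hx X; first by lia.
  have [|f1 f2 _] := hy y; first by lia.
  rewrite (hz_value lw kX _ iP); last by apply/(lev_belowP _ _ nb).
  rewrite (hz_value lw' (k := k') (X := X)) //; first by rewrite e2 e3 f2.
    by apply/(lev_belowP _ _ na'); rewrite -e1; apply/lev_belowP.
  by apply/(lev_belowP _ _ nb'); rewrite -f1.
have vz z : y <= z <= y + 1 -> cS (w x z) = cS (w' x z).
  move=> zP; have [i iP] := near_gridpt (b k) z (pow2_gt0 k).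
  have kY : on_level b k (gridpt (pow2 k) (b k) i) by exists i.
  move: (gridpt _ _ _) kY iP => Y kY iP; have kK := pow2_le (ltn_ord k).
  have [|e1 e2 e3 _] := hx x; first by lia.
  have [|f1 f2 _] := hy Y; first by lia.
  rewrite (vz_value lw _ kY iP); last by apply/(lev_belowP _ _ na).
  rewrite (vz_value lw' (k := k) (Y := Y)) //; first by rewrite e2 e3 f2.
    by apply/(lev_belowP _ _ na'); rewrite -e1.
  by apply/(lev_belowP _ _ nb'); rewrite -f1; apply/lev_belowP.
rewrite (wang_E wP) (wang_E wP') (wang_N wP) (wang_N wP'); split; try (by apply: hz; lia); try (by apply: vz; lia).
have [-> ->] := par x y; have [-> ->] := par' x y.
have [|_ _ _ ->] := hx x; first by lia.
by have [|_ _ ->] := hy y; first by lia.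
Qed.

End Levels.

HB.instance Definition _ (D : finType) := Finite.copy (edge D) (bool * bool * D * bool)%type.
HB.instance Definition _ (D : finType) := Finite.copy (cell D)
  (edge D * edge D * edge D * edge D * bool * bool * bool)%type.

Section Counting.
Local Open Scope nat_scope.

Lemma card_family_leq (C Q : finType) (P : pred {ffun C -> Q}) (F : C -> {pred Q}) (B : C -> nat) :
  (forall u c, P u -> u c \in F c) -> (forall c, #|F c| <= B c) -> #|P| <= \prod_c B c.
Proof.
move=> PF FB; have : #|P| <= #|family F|.
  by apply/subset_leq_card/fintype.subsetP => u Pu; apply/familyP => c; apply: PF.
move/leq_trans; apply; rewrite card_family.
have -> : foldr muln 1 [seq #|F x| | x : C] = \prod_(x : C) #|F x|.
  by rewrite foldrE big_map -big_enum.
by apply: leq_prod.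
Qed.

Lemma card_cover (T U : finType) (P : pred U) (Pt : T -> pred U) :
  (forall u, P u -> exists t, Pt t u) -> #|P| <= \sum_t #|Pt t|.
Proof.
have cE (R : pred U) : #|R| = \sum_u (R u : nat).
  by rewrite -sum1_card big_mkcond /=; apply: eq_bigr => u _; rewrite unfold_in; case: (R u).
move=> PPt; rewrite cE (eq_bigr (fun t => \sum_u (Pt t u : nat))) => [|t _]; last exact: cE.
rewrite exchange_big /=; apply: leq_sum => u _.
by case Pu : (P u) => //; have [t tu] := PPt u Pu; rewrite (bigD1 t) //= tu.
Qed.

Lemma sum_multiples (G y0 : int) (l : nat) : (0 < G)%R ->
  Posz (\sum_(t < l) (dvdz G (y0 + t%:Z)%R : nat)) = (divz (y0 + l%:Z - 1)%R G - divz (y0 - 1)%R G)%R.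
Proof.
move=> G0; elim: l => [|l IH]; first by rewrite big_ord0 addr0 subrr.
rewrite big_ord_recr /= PoszD IH.
have := divz_succ (y0 + l%:Z - 1)%R G0; rewrite subrK => h.
by have -> : (y0 + l.+1%:Z - 1 = y0 + l%:Z)%R; [lia|rewrite h; lia].
Qed.

Lemma count_multiples (G : nat) (y0 : int) (l : nat) : 0 < G ->
  let S := \sum_(t < l) (dvdz G (y0 + t%:Z)%R : nat) in S * G <= l + G /\ l <= S * G + G.
Proof.
move=> G0 S; have := @sum_multiples (Posz G) y0 l; rewrite -/S => /(_ G0) SE.
have e1 := divz_eq (y0 + l%:Z - 1)%R (Posz G); have e0 := divz_eq (y0 - 1)%R (Posz G).
have G0' : ((Posz G) != 0)%R by lia. have G0'' : (0 < (Posz G))%R by lia.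
have := modz_ge0 (y0 + l%:Z - 1)%R G0'; have := modz_ge0 (y0 - 1)%R G0'.
have := ltz_pmod (y0 + l%:Z - 1)%R G0''; have := ltz_pmod (y0 - 1)%R G0''.
move: (modz (y0 + l%:Z - 1)%R (Posz G)) (modz (y0 - 1)%R (Posz G)) (divz (y0 + l%:Z - 1)%R (Posz G)) (divz (y0 - 1)%R (Posz G)) e1 e0 SE => r1 r0 q1 q0 e1 e0 SE h1 h2 h3 h4.
have q1E : q1 = (S%:Z + q0)%R by rewrite SE subrK.
rewrite q1E mulrDl in e1; clear SE q1E q1; move: (q0 * (Posz G))%R e1 e0 => u e1 e0.
by rewrite -!lez_nat !PoszD PoszM; clear -e1 e0 h1 h2 h3 h4; split; lia.
Qed.

Variables (K : nat) (a : nat -> int).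
Hypothesis na : nested a.

Lemma on_level_dvdz k x : on_level a k x <-> dvdz (Posz (2 ^ k.+1)%N) (x - a k - pow2 k)%R.
Proof.
have e : Posz (2 ^ k.+1)%N = (2 * pow2 k)%R by rewrite -pow2S.
rewrite e; split=> [[i ->]|/dvdzP[q qE]]; first by apply/dvdzP; exists i; rewrite /gridpt; lia.
by exists q; rewrite /gridpt; lia.
Qed.

Lemma lev_belowE (k : 'I_K) x : (lev_below K a x == Some k) = dvdz (Posz (2 ^ k.+1)%N) (x - a k - pow2 k)%R.
Proof. by apply/eqP/idP => [/(lev_belowP _ _ na)/on_level_dvdz|/on_level_dvdz/lev_belowP->]. Qed.

Lemma lev_below_none x : lev_below K a x = None -> dvdz (Posz (2 ^ K)%N) (x - a K)%R.
Proof.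
move=> xN; have [[k kK h]|[z ->]] := level_or_grid K x na; last first.
  by apply/dvdzP; exists z; rewrite /pow2; lia.
by have := (lev_belowP (Ordinal kK) x na).2 h; rewrite xN.
Qed.

Lemma level_count (k : 'I_K) y0 l : let S := \sum_(t < l) (lev_below K a (y0 + t%:Z)%R == Some k) in
  S * 2 ^ k.+1 <= l + 2 ^ k.+1 /\ l <= S * 2 ^ k.+1 + 2 ^ k.+1.
Proof.
move=> S; have := @count_multiples (2 ^ k.+1) (y0 - a k - pow2 k)%R l; rewrite expn_gt0 => /(_ isT).
suff -> : S = \sum_(t < l) (dvdz (Posz (2 ^ k.+1)%N) (y0 - a k - pow2 k + t%:Z)%R : nat) by [].
apply: eq_bigr => t _; rewrite lev_belowE; congr (nat_of_bool (dvdz _ _)); lia.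
Qed.

Lemma no_level_count y0 l :
  (\sum_(t < l) (lev_below K a (y0 + t%:Z)%R == None)) * 2 ^ K <= l + 2 ^ K.
Proof.
have := (@count_multiples (2 ^ K) (y0 - a K)%R l _).1; rewrite expn_gt0 => /(_ isT).
apply: leq_trans; rewrite leq_mul2r; apply/orP; right; apply: leq_sum => t _.
case: eqP => // /lev_below_none; rewrite (_ : y0 + t%:Z - a K = y0 - a K + t%:Z)%R; last by lia.
by move=> ->.
Qed.

End Counting.

(** The lower border varies with the column because the blocks of successive columns are shifted by
    M. *)
Definition window (Q : Type) (p l : nat) (base : nat -> int) (w : int -> int -> Q) :
    {ffun 'I_p * 'I_l -> Q} :=
  [ffun kt : 'I_p * 'I_l => w (Posz kt.1) (base kt.1 + Posz kt.2)%R].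

(** * Few tile patterns for given levels *)

Section UpperBound.
Local Open Scope nat_scope.
Variable m : machine.
Notation D := (datum m).
Notation Q := (cell D).
Variables (K p l h : nat) (base : nat -> int) (y0 : int).
Hypothesis baseP : forall k, k < p -> (y0 <= base k)%R /\ (base k + l%:Z <= y0 + h%:Z)%R.

Notation restr := (window p l base).

(** One entry for each row and column: their number is exponential in the perimeter only, so they do
    not contribute to the entropy. *)
Definition params := ({ffun 'I_(p + 2 * 2 ^ K).+1 -> option 'I_K * bool * D * bool} *
  {ffun 'I_(h + 2 * 2 ^ K).+1 -> option 'I_K * bool * bool})%type.

Definition param (w : int -> int -> Q) (a b : nat -> int) : params :=
  ([ffun i : 'I_(p + 2 * 2 ^ K).+1 => col_info K w a (Posz i - pow2 K)%R],
   [ffun i : 'I_(h + 2 * 2 ^ K).+1 => row_info K w b (y0 - pow2 K + Posz i)%R]).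

Definition set_bit (q : Q) b : Q := (q.1.1.1, b, q.1.2, q.2).

Lemma cell_eq (q q' : Q) : [/\ cW q = cW q', cE q = cE q', cS q = cS q', cN q = cN q' & cpx q = cpx q' /\ cpy q = cpy q'] ->
  q = set_bit q' (cbit q).
Proof.
case: q => [[[[[[? ?] ?] ?] ?] ?] ?]; case: q' => [[[[[[? ?] ?] ?] ?] ?] ?].
by rewrite /set_bit /cW /cE /cS /cN /cpx /cpy /cbit /= => -[-> -> -> -> [-> ->]].
Qed.

Lemma same_cell w w' a a' b b' beta beta' (c : 'I_p * 'I_l) k k' :
  leveled w a b beta -> leveled w' a' b' beta' -> param w a b = param w' a' b' ->
  lev_below K a (Posz c.1) = Some k -> lev_below K b (base c.1 + Posz c.2)%R = Some k' ->
  restr w c = set_bit (restr w' c) (cbit (restr w c)) /\ (cbit (restr w c) -> k = k' /\ beta' k).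
Proof.
move=> lw lw' [/ffunP cI /ffunP rI] ck rk; set x := Posz c.1 in ck; set y := (base c.1 + Posz c.2)%R in rk.
have [b1 b2] := baseP (ltn_ord c.1).
have [_ [na nb] _ _ _] := lw; have [_ [na' nb'] _ _ _] := lw'.
have hc X : (x - pow2 K <= X <= x + 1 + pow2 K)%R -> col_info K w a X = col_info K w' a' X.
  move=> XP; have iP : absz (X + pow2 K)%R < (p + 2 * 2 ^ K).+1.
    by have := ltn_ord c.1; move: XP; rewrite /x /pow2; lia.
  have := cI (Ordinal iP); rewrite !ffunE /=.
  have -> // : (Posz (absz (X + pow2 K)%R) - pow2 K = X)%R.
  by move: XP; rewrite /x; clear; lia.
have hr Y : (y - pow2 K <= Y <= y + 1 + pow2 K)%R -> row_info K w b Y = row_info K w' b' Y.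
  move=> YP; have iP : absz (Y - y0 + pow2 K)%R < (h + 2 * 2 ^ K).+1.
    by have := ltn_ord c.2; move: YP b1 b2; rewrite /y /pow2; lia.
  have := rI (Ordinal iP); rewrite !ffunE /=.
  have -> // : (y0 - pow2 K + Posz (absz (Y - y0 + pow2 K)%R) = Y)%R.
  by move: YP b1; rewrite /y; clear; lia.
have same := same_edges lw lw' hc hr ck rk.
split; first by rewrite !ffunE; apply: cell_eq.
have kx := (lev_belowP _ _ na).1 ck; have ky := (lev_belowP _ _ nb).1 rk.
rewrite ffunE => /(bit_level lw kx ky)[/val_inj kk bk]; split=> //.
have [e1 e2 e3] : [/\ lev_below K a x = lev_below K a' x, col_tag w x = col_tag w' x & col_dat w x = col_dat w' x].
  have xP : (x - pow2 K <= x <= x + 1 + pow2 K)%R by have := pow2_gt0 K; lia.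
  by have := hc x xP; rewrite /col_info => -[? ? ? _]; split.
have kx' : on_level a' k x by apply/(lev_belowP _ _ na'); rewrite -e1.
by rewrite -(free_level lw' kx') -e3 (free_level lw kx).
Qed.

Definition is_bad a b (c : 'I_p * 'I_l) :=
  (lev_below K a (Posz c.1) == None) || (lev_below K b (base c.1 + Posz c.2)%R == None).
Definition is_free a b (beta : nat -> bool) (c : 'I_p * 'I_l) :=
  [exists k : 'I_K, [&& beta k, lev_below K a (Posz c.1) == Some k &
    lev_below K b (base c.1 + Posz c.2)%R == Some k]].

Definition fibre (t : params) : pred {ffun 'I_p * 'I_l -> Q} :=
  [pred u | `[< exists w a b beta, [/\ leveled w a b beta, param w a b = t & u = restr w] >]].

(** The parameters determine a cell with known levels up to its bit, which is free only at crosses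
    of levels with output 1; the cells in [is_bad] are left arbitrary. *)
Lemma fibre_card w0 a0 b0 beta0 : leveled w0 a0 b0 beta0 ->
  #|fibre (param w0 a0 b0)| <= #|{: Q}| ^ (\sum_c is_bad a0 b0 c) * 2 ^ (\sum_c is_free a0 b0 beta0 c).
Proof.
move=> lw0; have Q0 : 0 < #|{: Q}| by apply/card_gt0P; exists (w0 0%R 0%R).
rewrite !expn_sum -big_split /=.
pose F c := [pred q | [exists u, (u \in fibre (param w0 a0 b0)) && (u c == q)]].
apply: (@card_family_leq _ _ _ F) => [u c Pu|c].
  by rewrite inE; apply/existsP; exists u; rewrite eqxx andbT.
have [bad|] := boolP (is_bad a0 b0 c).
  by rewrite expn1; apply: leq_trans (max_card _) _; rewrite leq_pmulr // expn_gt0.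
rewrite negb_or expn0 mul1n => /andP[].
case ck : (lev_below _ _ _) => [k|//] _; case rk : (lev_below _ _ _) => [k'|//] _.
pose q0 := restr w0 c.
have Fq q : q \in F c -> q = set_bit q0 (cbit q) /\ (cbit q -> is_free a0 b0 beta0 c).
  rewrite inE => /existsP[u /andP[uf /eqP <-]]; move: uf; rewrite inE => -[w [a [b [beta [lw tE ->]]]]].
  have [/ffunP cI /ffunP rI] := tE.
  have [b1 b2] := baseP (ltn_ord c.1).
  have ck' : lev_below K a (Posz c.1) = Some k.
    have iP : absz (Posz c.1 + pow2 K)%R < (p + 2 * 2 ^ K).+1.
      by have := ltn_ord c.1; rewrite /pow2; lia.
    have := cI (Ordinal iP); rewrite !ffunE /=.
    have -> : (Posz (absz (Posz c.1 + pow2 K)%R) - pow2 K = Posz c.1)%R by rewrite /pow2; lia.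
    by rewrite /col_info ck => -[-> _ _ _].
  have rk' : lev_below K b (base c.1 + Posz c.2)%R = Some k'.
    have iP : absz (base c.1 + Posz c.2 - y0 + pow2 K)%R < (h + 2 * 2 ^ K).+1.
      by have := ltn_ord c.2; rewrite /pow2; lia.
    have := rI (Ordinal iP); rewrite !ffunE /=.
    have -> : (y0 - pow2 K + Posz (absz (base c.1 + Posz c.2 - y0 + pow2 K)%R) = base c.1 + Posz c.2)%R.
      by have := pow2_gt0 K; move: b1; clear; lia.
    by rewrite /row_info rk => -[-> _ _].
  have [e fr] := same_cell lw lw0 tE ck' rk'; split=> // /fr[kk bk].
  by apply/existsP; exists k; rewrite bk ck rk kk !eqxx.
case fr : (is_free a0 b0 beta0 c).
  rewrite expn1; apply: (@leq_trans #|[set set_bit q0 true; set_bit q0 false]|); last by rewrite cards2 ltnS leq_b1.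
  apply/subset_leq_card/fintype.subsetP => q /Fq[-> _]; rewrite !inE.
  by case: (cbit q); rewrite eqxx ?orbT.
rewrite expn0; apply: (@leq_trans #|[set set_bit q0 false]|); last by rewrite cards1.
apply/subset_leq_card/fintype.subsetP => q /Fq[-> h']; rewrite !inE.
by case: (cbit q) h' => // /(_ isT); rewrite fr.
Qed.

End UpperBound.

(** * From tile patterns to patterns of letters *)

Section PatternCounts.
Local Open Scope ring_scope.
Variables (A : finType) (H : set (int -> A)) (Q : finType) (hR vR : rel Q).
Hypothesis nnH : is_nearest_neighbor H.
Notation E := (Defs.arc (rauzy_graph H)).
Variable kt : kit E Q.
Notation M := (kM kt).
Notation n := (kn kt).
Notation cut := (kcut kt).
Notation T := (kT kt).
Notation bit := (kbit kt).
Notation L := (M * n).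
Notation X := (combined_subshift H (column_shift kt hR vR)).

Let M0 : 0 < M := kM0 kt.
Let c0 : 0 < cut := kcut0 kt.
Let cn : cut + 2 <= n := kcutn kt.
Let L0 : 0 < L. Proof. by rewrite mulr_gt0 //; lia. Qed.
Let L3 : 3 * M <= L. Proof. by rewrite mulrC ler_pM2l //; lia. Qed.

Lemma tiling_shift w (a b : int) : tiling hR vR w -> tiling hR vR (fun x y => w (x + a) (y + b)).
Proof.
case=> wh wv; split=> x y.
  by have -> : x + 1 + a = x + a + 1 by lia.
by have -> : y + 1 + b = y + b + 1 by lia.
Qed.

Lemma letter_shift s (w : int -> int -> Q) (i j k h : int) :
  letter kt s w (i + k) (j + h) = letter kt (s + j + M * i) (fun x y => w (x + i) y) k h.
Proof.
rewrite /letter; have -> : j + h + s + M * (i + k) = h + (s + j + M * i) + M * k by lia.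
congr (T _ _ (bit _ _)); case: ifP => _; congr w; lia.
Qed.

Lemma letter_per s z (w : int -> int -> Q) (k h : int) :
  letter kt (s + z * L) w k h = letter kt s (fun x y => w x (y + z)) k h.
Proof.
have [j [i [r [rM iP ->]]]] := int_coords kt s k h; rewrite (letterE _ _ _ _ rM iP).
have -> : j * L + M * i + r - s - M * k = (j + z) * L + M * i + r - (s + z * L) - M * k by lia.
rewrite (letterE _ _ _ _ rM iP); congr (T _ _ (bit _ _)); case: ifP => _; congr w; lia.
Qed.

Lemma letter_box x (i j : int) : X x -> exists s w, [/\ 0 <= s < L, tiling hR vR w &
  forall k h, x (i + k, j + h) = letter kt s w k h].
Proof.
move=> /(combined_letter)[s [w [wP xE]]].
pose s' := s + j + M * i; pose z := divz s' L.
exists (modz s' L), (fun x y => w (x + i) (y + z)); split.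
- by rewrite modz_ge0 ?ltz_pmod //; lia.
- exact: (@tiling_shift w i z wP).
move=> k h; rewrite xE letter_shift -/s' {1}(divz_eq s' L) addrC.
exact: letter_per.
Qed.

(** A letter of column k depends on a tile of column k - i or k + n - i, so n further columns on
    either side are needed. *)
Definition ncols (N : nat) := (N + 2 * absz n).+1%N.
Definition nrows (N : nat) := (N %/ absz L + 2).+1%N.
Lemma ncolsE N : (ncols N)%:Z = N%:Z + 2 * n + 1.
Proof. have : Posz (absz n) = n by lia. by rewrite /ncols; lia. Qed.

Definition row_base (s : int) (k : nat) : int := divz (s + M * (k%:Z - n)) L.

Lemma row_baseP s N (k : nat) : (k < ncols N)%N ->
  row_base s 0 <= row_base s k /\ row_base s k + (nrows N)%:Z <= row_base s 0 + (ncols N + nrows N)%:Z.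
Proof.
move=> kN; have L1 : 1 <= L by lia.
have ML : M * k%:Z <= L * k%:Z by apply: ler_wpM2r; lia.
have kM0 : 0 <= M * k%:Z by rewrite mulr_ge0 //; lia.
have e1 := divz_eq (s + M * (0%:Z - n)) L; have e2 := divz_eq (s + M * (k%:Z - n)) L.
have h1 := ltz_pmod (s + M * (0%:Z - n)) L0; have h2 := ltz_pmod (s + M * (k%:Z - n)) L0.
have h3 := modz_ge0 (s + M * (0%:Z - n)) (lt0r_neq0 L0).
have h4 := modz_ge0 (s + M * (k%:Z - n)) (lt0r_neq0 L0).
rewrite /row_base; move: (divz (s + M * (0%:Z - n)) L) (modz (s + M * (0%:Z - n)) L) e1 h1 h3 => q1 r1 e1 h1 h3.
move: (divz (s + M * (k%:Z - n)) L) (modz (s + M * (k%:Z - n)) L) e2 h2 h4 => q2 r2 e2 h2 h4.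
have d1 : -1 * L < (q2 - q1) * L by lia.
have d2 : (q2 - q1) * L < (k%:Z + 1) * L by lia.
by move: d1 d2; rewrite !ltr_pM2r // => d1 d2; split; lia.
Qed.

Definition box_pattern N (s : int) (v : {ffun 'I_(ncols N) * 'I_(nrows N) -> Q}) : {ffun 'I_N * 'I_N -> A} :=
  [ffun kh : 'I_N * 'I_N => let k := Posz kh.1 in let u := Posz kh.2 + s + M * k in
    let r := modz u M in let i := modz (divz u M) n in let j := divz (divz u M) n in
    let c := absz (if i <= cut then k + n - i else k + n - i + n)%R in
    T r i (bit r (v (inord c, inord (absz ((if i <= cut then j else j + 1) - row_base s c)%R))))].

Lemma box_patternE N s w (u : {ffun 'I_N * 'I_N -> A}) : (forall k h, u (k, h) = letter kt s w (Posz k) (Posz h)) ->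
  u = box_pattern s (window (ncols N) (nrows N) (row_base s) (fun x y => w (x - n) y)).
Proof.
move=> uE; apply/ffunP => -[k h]; rewrite uE ffunE /letter; lazy beta zeta iota delta [fst snd].
have [j [i [r [rM iP hE]]]] := int_coords kt s (Posz k) (Posz h).
have -> : Posz h + s + M * Posz k = M * (n * j + i) + r by rewrite hE; lia.
have [-> ->] := coords (n * j + i) rM.
have -> : modz (n * j + i) n = i by rewrite mulrC modzMDl modz_small.
have -> : divz (n * j + i) n = j.
  by rewrite mulrC divzMDl; [rewrite divz_small ?addr0 //; lia|lia].
have kN := ltn_ord k; have hN := ltn_ord h.
set c := if i <= cut then Posz k + n - i else _; set j' := if i <= cut then j else _.
have [c_0 cN] : 0 <= c /\ c < (ncols N)%:Z.
  by rewrite ncolsE /c; clear c j'; case: ifP => _; lia.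
have sE : s + M * (c - n) = j' * L + (r - Posz h).
  by rewrite /c /j' hE; case: ifP => _; ring.
have cE : (absz c)%:Z = c by rewrite gez0_abs.
have [d1 d2] : 0 <= j' - row_base s (absz c) /\ j' - row_base s (absz c) < (nrows N)%:Z.
  rewrite /row_base cE sE divzMDl; last by lia.
  have e1 := divz_eq (r - Posz h) L; have e2 := ltz_pmod (r - Posz h) L0.
  have e3 := modz_ge0 (r - Posz h) (lt0r_neq0 L0).
  move: (divz (r - Posz h) L) (modz (r - Posz h) L) e1 e2 e3 => q t e1 e2 e3.
  have q1 : q * L < 1 * L by lia.
  have NL : Posz N < (Posz (N %/ absz L)%N + 1) * L.
    have -> : L = Posz (absz L) by lia.
    have := divn_eq N (absz L); have := ltn_pmod N (_ : 0 < absz L)%N; move: (N %/ _)%N (N %% _)%N => a b h1 ->.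
    have {}h1 := h1 ltac:(lia).
    by rewrite PoszD PoszM mulrDl mul1r; lia.
  have q2 : (- (Posz (N %/ absz L)%N + 2)) * L < q * L by lia.
  by move: q1 q2; rewrite !ltr_pM2r // /nrows => q1 q2; lia.
rewrite /window ffunE; lazy beta zeta iota delta [fst snd]; rewrite !inordK; try (rewrite /ncols /nrows in cN d1 d2 *; lia).
have -> : row_base s (absz c) + Posz (absz (j' - row_base s (absz c))%R) = j' by lia.
rewrite cE /c /j'; congr (T _ _ (bit _ _)); case: ifP => _; congr w; lia.
Qed.

Definition tile_patterns N s : {pred {ffun 'I_(ncols N) * 'I_(nrows N) -> Q}} :=
  [pred v | `[< exists2 w, tiling hR vR w & v = window (ncols N) (nrows N) (row_base s) w >]].

Lemma pattern_count_upper N :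
  (pattern_count X N N <= \sum_(s < absz L) #|@tile_patterns N (Posz s)|)%N.
Proof.
pose Pt (s : 'I_(absz L)) : pred {ffun 'I_N * 'I_N -> A} :=
  [pred u | u \in fintype.image (@box_pattern N (Posz s)) (@tile_patterns N (Posz s))].
apply: (@leq_trans (\sum_s #|Pt s|)); last first.
  apply: leq_sum => s _; apply: leq_trans (leq_image_card (@box_pattern N (Posz s)) _).
  by apply/subset_leq_card/fintype.subsetP => u.
apply: card_cover => u; rewrite /= => /asboolP[x Xx [i [j uE]]].
have [s [w [sL wP xE]]] := letter_box i j Xx.
have sL' : (absz s < absz L)%N by lia.
exists (Ordinal sL'); rewrite /Pt /=.
have -> : u = box_pattern s (window (ncols N) (nrows N) (row_base s) (fun x y => w (x - n) y)).
  by apply: box_patternE => k h; rewrite uE xE.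
have -> : Posz (absz s) = s by lia.
apply/fintype.imageP; eexists; last reflexivity.
rewrite inE; exists (fun x y => w (x - n) y) => //.
have -> : (fun x' y => w (x' - n) y) = (fun x' y => w (x' + - n) (y + 0)).
  by apply/funext => z; apply/funext => y; rewrite addr0.
exact: tiling_shift.
Qed.

(* The letters of index 0 of the cells involved all lie in the box. *)
Lemma pattern_count_lower N (I : finType) (w : {set I} -> int -> int -> Q) (S : {set I})
    (c : I -> 'I_N * 'I_(N %/ absz L - 2)) :
  (forall B, tiling hR vR (w B)) ->
  (forall B B' : {set I}, B \subset S -> B' \subset S ->
    (forall i, i \in S -> let x := Posz (c i).1 in let y := divz (M * x) L + 1 + Posz (c i).2 in
      w B x y = w B' x y) -> B = B') ->
  (2 ^ #|S| <= pattern_count X N N)%N.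
Proof.
move=> wP inj.
pose x B (kh : int * int) := letter kt 0 (w B) kh.1 kh.2.
pose u B := [ffun kh : 'I_N * 'I_N => x B (Posz kh.1, Posz kh.2)].
have uX B : pattern_appears X (u B).
  exists (x B); first exact: letter_combined.
  by exists 0, 0 => k h; rewrite ffunE !add0r.
rewrite -card_powerset -(card_in_imset (f := u)).
  apply/subset_leq_card/fintype.subsetP => v /imsetP[B _ ->].
  by rewrite inE; exact: uX.
move=> B B'; rewrite !inE => BS BS' /ffunP e; apply: inj => // i iS X0 Y0.
have kN := ltn_ord (c i).1; have tN := ltn_ord (c i).2.
(* The letters at index 0 agree, so the letters of one tile have the arcs of the other. *)
apply: (@kclaim _ _ _ kt) => r rM.
have hE : 0 <= Y0 * L + M * 0 + r - 0 - M * X0 /\ Y0 * L + M * 0 + r - 0 - M * X0 < Posz N.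
  have e1 := divz_eq (M * X0) L; have e2 := ltz_pmod (M * X0) L0.
  have e3 := modz_ge0 (M * X0) (lt0r_neq0 L0).
  rewrite /Y0; move: (divz (M * X0) L) (modz (M * X0) L) e1 e2 e3 => q z -> e2 e3.
  have NL : (Posz (N %/ absz L)%N) * L <= Posz N.
    have LE : L = Posz (absz L) by lia.
    by rewrite [X in _ * X]LE -PoszM lez_nat leq_trunc_div.
  have tL : 0 <= Posz (c i).2 * L by rewrite mulr_ge0 //; lia.
  have tL' : Posz (c i).2 * L <= (Posz (N %/ absz L)%N - 3) * L by rewrite ler_pM2r //; lia.
  rewrite !mulrDl mul1r in tL' *.
  by move: (Posz (c i).2 * L) (q * L) (Posz (N %/ absz L)%N * L) tL tL' NL => a b d *; split; lia.
have [h0 h1] := hE; have hN : (absz (Y0 * L + M * 0 + r - 0 - M * X0)%R < N)%N by lia.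
have := e ((c i).1, Ordinal hN); rewrite !ffunE /x; lazy beta zeta iota delta [fst snd nat_of_ord].
rewrite gez0_abs // -/X0.
have n0 : 0 <= (0 : int) < n by lia.
have cut0 : (0 <= cut) = true by lia.
rewrite !(letterE _ _ _ _ rM n0) cut0 !subr0.
by move=> ->; exact: (karc kt r 0 (bit r (w B' X0 Y0))).
Qed.

End PatternCounts.

Section Sums.
Local Open Scope nat_scope.
Variables (K p l : nat) (base : nat -> int).

Lemma bad_sum a b : nested a -> nested b ->
  (\sum_c is_bad K (p := p) (l := l) base a b c) * 2 ^ K <= (p + 2 ^ K) * l + p * (l + 2 ^ K).
Proof.
move=> na nb.
pose bx (x : nat) : nat := lev_below K a (Posz x) == None.
pose by_ (x t : nat) : nat := lev_below K b (base x + Posz t)%R == None.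
have -> : \sum_c is_bad K (p := p) (l := l) base a b c = \sum_(x < p) \sum_(t < l) is_bad K base a b (x, t).
  by rewrite pair_bigA /=; apply: eq_bigr => -[].
have le1 : \sum_(x < p) \sum_(t < l) is_bad K base a b (x, t) <= \sum_(x < p) bx x * l + \sum_(x < p) \sum_(t < l) by_ x t.
  rewrite -big_split /=; apply: leq_sum => x _.
  have -> : bx x * l = \sum_(t < l) bx x by rewrite sum_nat_const card_ord mulnC.
  rewrite -big_split /=; apply: leq_sum => t _.
  by rewrite /is_bad /bx /by_ /=; do 2 case: (_ == _).
apply: leq_trans (leq_mul le1 (leqnn _)) _; rewrite mulnDl leq_add //.
  rewrite -big_distrl /= -mulnA [l * _]mulnC mulnA leq_mul2r; apply/orP; right.
  suff -> : \sum_(x < p) bx x = \sum_(t < p) (lev_below K a (0 + Posz t)%R == None) by apply: no_level_count.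
  by apply: eq_bigr => t _; rewrite add0r.
rewrite big_distrl /=; apply: (@leq_trans (\sum_(x < p) (l + 2 ^ K))); last by rewrite sum_nat_const card_ord.
by apply: leq_sum => x _; apply: no_level_count.
Qed.

Definition level_cells a b (k : 'I_K) : nat :=
  \sum_(x < p) \sum_(t < l) (lev_below K a (Posz x) == Some k) * (lev_below K b (base x + Posz t)%R == Some k).

Lemma free_sum a b beta : \sum_c is_free K (p := p) (l := l) base a b beta c <=
  \sum_(k < K) beta k * level_cells a b k.
Proof.
have -> : \sum_c is_free K (p := p) (l := l) base a b beta c = \sum_(x < p) \sum_(t < l) is_free K base a b beta (x, t).
  by rewrite pair_bigA /=; apply: eq_bigr => -[].
under [X in _ <= X]eq_bigr => k _ do rewrite /level_cells big_distrr /=.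
rewrite [X in _ <= X]exchange_big /=; apply: leq_sum => x _.
under [X in _ <= X]eq_bigr => k _ do rewrite big_distrr /=.
rewrite [X in _ <= X]exchange_big /=; apply: leq_sum => t _.
rewrite /is_free; case: existsP => // -[k /and3P[bk ak tk]].
by rewrite (bigD1 k) //= bk ak tk.
Qed.

Lemma level_cells_leq a b k : nested a -> nested b ->
  level_cells a b k * (2 ^ k.+1 * 2 ^ k.+1) <= (p + 2 ^ k.+1) * (l + 2 ^ k.+1).
Proof.
move=> na nb; set G := 2 ^ k.+1; rewrite mulnA.
have px : (\sum_(x < p) (lev_below K a (Posz x) == Some k)) * G <= p + G.
  suff -> : \sum_(x < p) (lev_below K a (Posz x) == Some k) = \sum_(t < p) (lev_below K a (0 + Posz t)%R == Some k).
    by have [] := level_count na k 0%R p.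
  by apply: eq_bigr => t _; rewrite add0r.
have le1 : level_cells a b k * G <= (\sum_(x < p) (lev_below K a (Posz x) == Some k)) * (l + G).
  rewrite /level_cells !big_distrl /=; apply: leq_sum => x _.
  rewrite -big_distrr /= -mulnA leq_mul2l; apply/orP; right.
  by have [] := level_count nb k (base x) l.
apply: leq_trans (leq_mul le1 (leqnn G)) _.
by rewrite mulnAC leq_mul2r px orbT.
Qed.

End Sums.

(** * Weights of outputs in base 4 *)

Section Reals.
Local Open Scope ring_scope.
Variable R : realType.

Definition half_pow (k : nat) : R := 2 ^- k.

Lemma half_powE k : (2 ^ k)%N%:R * half_pow k = 1.
Proof. by rewrite /half_pow natrX mulfV // expf_neq0 // pnatr_eq0. Qed.

Lemma half_pow_ge0 k : 0 <= half_pow k.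
Proof. by rewrite /half_pow invr_ge0 exprn_ge0. Qed.

Lemma half_powS k : half_pow k = 2 * half_pow k.+1.
Proof. by rewrite /half_pow exprS invfM mulrA mulfV ?mul1r // pnatr_eq0. Qed.

Lemma half_pow_le1 k : half_pow k <= 1.
Proof. by rewrite /half_pow invf_le1 ?exprn_gt0 // exprn_ege1 // ler1n. Qed.

Variable beta : nat -> bool.

Definition partial_sum (b : nat -> bool) (K : nat) : R :=
  \sum_(k < K) (b k)%:R * half_pow k.+1 ^+ 2.

Lemma partial_sumS b K : partial_sum b K.+1 = partial_sum b K + (b K)%:R * half_pow K.+1 ^+ 2.
Proof. by rewrite /partial_sum big_ord_recr. Qed.

Lemma partial_sum_step b K : partial_sum b K <= partial_sum b K.+1 <= partial_sum b K + half_pow K.+1 ^+ 2.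
Proof.
rewrite partial_sumS; have := sqr_ge0 (half_pow K.+1).
by case: (b K) => h; rewrite ?mul1r ?mul0r; lra.
Qed.

(* The sum of 4^-(k+1) over k >= K is 4^-K / 3. *)
Lemma partial_sum_tail b K K' : (K <= K')%N ->
  partial_sum b K <= partial_sum b K' <= partial_sum b K + (half_pow K ^+ 2 - half_pow K' ^+ 2) / 3.
Proof.
elim: K' => [|K' IH]; first by rewrite leqn0 => /eqP ->; lra.
rewrite leq_eqVlt => /orP[/eqP -> |]; first by lra.
rewrite ltnS => /IH; have := partial_sum_step b K'; have := half_powS K'.
move: (half_pow K') (half_pow K'.+1) => u v -> ; nra.
Qed.

(** The digit gained at t weighs 4^-(t+1), three times as much as any tail after it. *)
Lemma partial_sum_lex b K : (b = beta \/ exists t, [/\ forall u, (u < t)%N -> b u = beta u, b t = false & beta t]) ->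
  partial_sum b K <= partial_sum beta K.
Proof.
case=> [->//|[t [bu bt betat]]].
have eqs k : (k <= t)%N -> partial_sum b k = partial_sum beta k.
  by move=> kt; apply: eq_bigr => i _; rewrite bu //; apply: leq_trans kt.
have [kt|tk] := leqP K t; first by rewrite eqs.
have /andP[_ h1] := partial_sum_tail b tk; have /andP[h2 _] := partial_sum_tail beta tk.
apply: le_trans h1 (le_trans _ h2); rewrite !partial_sumS bt betat (eqs t) // mul0r addr0 mul1r.
by have := sqr_ge0 (half_pow t.+1); have := sqr_ge0 (half_pow K); lra.
Qed.

Lemma partial_sum_ge0 b K : 0 <= partial_sum b K.
Proof. by apply: sumr_ge0 => k _; rewrite mulr_ge0 ?sqr_ge0. Qed.

Lemma partial_sum_le1 b K : partial_sum b K <= 1.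
Proof.
have /andP[_] := partial_sum_tail b (leq0n K); rewrite /partial_sum big_ord0 add0r.
have := half_powE 0; rewrite mul1r => ->; have := sqr_ge0 (half_pow K).
by move=> h /le_trans; apply; lra.
Qed.

Lemma level_sum_upper K (f : nat -> nat -> nat) (b : nat -> bool) (p l : nat) :
  (forall k, (k < K)%N -> (f k k * (2 ^ k.+1 * 2 ^ k.+1) <= (p + 2 ^ k.+1) * (l + 2 ^ k.+1))%N) ->
  (\sum_(k < K) (b k * f k k)%N)%:R <= p%:R * l%:R * partial_sum b K + K%:R * (p%:R + l%:R + 1) :> R.
Proof.
elim: K => [|K IH] fP; first by rewrite /partial_sum !big_ord0 mulr0 mul0r addr0.
rewrite big_ord_recr /= natrD partial_sumS.
have {}IH := IH (fun k kK => fP k (leqW kK)).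
have := fP K (ltnSn K); rewrite -(ler_nat R) !natrM !natrD.
have := half_powE K.+1; have := half_pow_ge0 K.+1; have := half_pow_le1 K.+1.
move: (half_pow K.+1) ((2 ^ K.+1)%N%:R : R) ((f K K)%:R : R) => v G F v1 v0 Gv h.
have F1 : F <= (p%:R * v + 1) * (l%:R * v + 1).
  have -> : F = F * (G * G) * (v * v).
    have GG : G * G * (v * v) = 1 by rewrite mulrACA Gv mulr1.
    by rewrite -[RHS]mulrA GG mulr1.
  have -> : (p%:R * v + 1) * (l%:R * v + 1) = (p%:R + G) * (l%:R + G) * (v * v).
    by rewrite mulrACA !mulrDl Gv.
  by apply: ler_wpM2r h; rewrite mulr_ge0.
have p0 : 0 <= p%:R :> R by []. have l0 : 0 <= l%:R :> R by [].
have F2 : F <= p%:R * l%:R * v ^+ 2 + (p%:R + l%:R + 1) by apply: le_trans F1 _; nra.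
have -> : K.+1%:R = K%:R + 1 :> R by rewrite -natr1.
rewrite mulrDl mul1r mulrDr.
case: (b K); rewrite ?mul1r ?mul0r ?mulr0 ?addr0; lra.
Qed.

Lemma level_sum_lower K (f : nat -> nat -> nat) (b : nat -> bool) (p l : nat) :
  (forall k, (k < K)%N -> exists s t, [/\ (s * t <= f k k)%N, (p <= s * 2 ^ k.+1 + 2 ^ k.+1)%N &
     (l <= t * 2 ^ k.+1 + 2 ^ k.+1)%N]) ->
  p%:R * l%:R * partial_sum b K - K%:R * (p%:R + l%:R) <= (\sum_(k < K) (b k * f k k)%N)%:R :> R.
Proof.
elim: K => [|K IH] fP; first by rewrite /partial_sum !big_ord0 mulr0 mul0r subr0.
rewrite big_ord_recr /= natrD partial_sumS.
have {}IH := IH (fun k kK => fP k (leqW kK)).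
have [s [t [+ + +]]] := fP K (ltnSn K); rewrite -3!(ler_nat R) !natrM !natrD !natrM.
have := half_powE K.+1; have := half_pow_ge0 K.+1; have := half_pow_le1 K.+1.
have : 0 <= s%:R :> R by []. have : 0 <= t%:R :> R by [].
move: (half_pow K.+1) ((2 ^ K.+1)%N%:R : R) ((f K K)%:R : R) (s%:R : R) (t%:R : R).
move=> v G F S T T0 S0 v1 v0 Gv h hs ht.
have p0 : 0 <= p%:R :> R by []. have l0 : 0 <= l%:R :> R by [].
have S1 : p%:R * v <= S + 1 by have := ler_wpM2r v0 hs; rewrite mulrDl -mulrA Gv; lra.
have T1 : l%:R * v <= T + 1 by have := ler_wpM2r v0 ht; rewrite mulrDl -mulrA Gv; lra.
have F1 : (p%:R * v) * (l%:R * v) - p%:R * v - l%:R * v <= F.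
  apply: le_trans h; have a0 := mulr_ge0 p0 v0; have b0 := mulr_ge0 l0 v0.
  move: (p%:R * v) (l%:R * v) S1 T1 a0 b0 => x y *.
  have [x1|x1] := leP x 1; first by nra.
  have [y1|y1] := leP y 1; first by nra.
  nra.
have F2 : p%:R * l%:R * v ^+ 2 - (p%:R + l%:R) <= F by apply: le_trans F1; nra.
have -> : K.+1%:R = K%:R + 1 :> R by rewrite -natr1.
rewrite mulrDl mul1r mulrDr.
case: (b K); rewrite ?mul1r ?mul0r ?mulr0 ?addr0; lra.
Qed.

End Reals.

Section EntropyBounds.
Local Open Scope ring_scope.
Variables (R : realType) (A : finType) (H : set (int -> A)) (m : machine) (beta : nat -> bool).
Hypothesis nnH : is_nearest_neighbor H.
Notation E := (Defs.arc (rauzy_graph H)).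
Notation D := (datum m).
Notation Q := (cell D).
Variable kt : kit E Q.
Notation M := (kM kt).
Notation n := (kn kt).
Notation L := (M * n).
Notation hR := (cell_h (@mRh m) (@mPhi m) (@minit m) (@mfree m)).
Notation vR := (cell_v (@mRh m) (@mPhi m) (@minit m) (@mfree m)).
Notation X := (combined_subshift H (column_shift kt hR vR)).
Hypothesis out : moutput m beta.
Hypothesis best : forall b, moutput m b -> b = beta \/
  exists t, [/\ forall u, (u < t)%N -> b u = beta u, b t = false & beta t].
Notation psum := (@partial_sum R).
Notation hp := (@half_pow R).

Let M0 : 0 < M := kM0 kt.
Let n3 : 3 <= n. Proof. by have := kcut0 kt; have := kcutn kt; lia. Qed.
Let L1 : 1 <= L. Proof. by have : 0 < L by (rewrite mulr_gt0 //; lia). Qed.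

(** The bound of [fibre_card] involves the output of one tiling in the fibre, which [best] and
    [partial_sum_lex] compare with beta. *)
Lemma fibre_upper K p l h (base : nat -> int) y0 t :
  (forall k, (k < p)%N -> y0 <= base k /\ base k + l%:Z <= y0 + h%:Z) ->
  #|@fibre m K p l h base y0 t|%:R <=
  expR (ln #|{: Q}|%:R * (2 * p%:R * l%:R * hp K + p%:R + l%:R) +
        ln 2 * (p%:R * l%:R * psum beta K + K%:R * (p%:R + l%:R + 1))) :> R.
Proof.
move=> bP; have [|] := pselect (exists u, @fibre m K p l h base y0 t u); last first.
  move=> nu; rewrite (@eq_card0 _ (@fibre m K p l h base y0 t)) ?expR_ge0 //.
  by move=> u; apply/negP => h'; apply: nu; exists u.
case=> u0 /asboolP[w [a [b [b' [lw <- _]]]]].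
have [_ [na nb] _ [ o' _] _] := lw.
have := fibre_card K bP lw; rewrite -(ler_nat R) => /le_trans; apply.
rewrite natrM !natrX.
have Q0 : 0 < #|{: Q}|%:R :> R by rewrite ltr0n; apply/card_gt0P; exists (w 0 0).
rewrite -{1}(lnK (Q0 : _ \in Num.pos)) -{1}(lnK (ltr0n R 2 : 2 \in Num.pos)) -!expRM_natr -expRD ler_expR.
have lnQ : 0 <= ln #|{: Q}|%:R :> R.
  by rewrite ln_ge0 // ler1n -(ltr0n R).
have ln2 : 0 <= ln 2 :> R by rewrite ln_ge0 // ler1n.
apply: lerD; apply: ler_wpM2l => //.
  have := bad_sum K p l base na nb; rewrite -(ler_nat R) natrD !natrM !natrD.
  have := half_powE R K; have := half_pow_ge0 R K.
  move: (hp K) ((2 ^ K)%N%:R : R) (\sum_c _)%N => v G S v0 Gv h1.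
  have := ler_wpM2r v0 h1; rewrite -mulrA Gv mulr1 => /le_trans; apply.
  have -> : ((p%:R + G) * l%:R + p%:R * (l%:R + G)) * v = 2 * p%:R * l%:R * v + (p%:R + l%:R) * (G * v) by ring.
  by rewrite Gv mulr1 addrA.
have := free_sum K p l base a b b'; rewrite -(ler_nat R) => /le_trans; apply.
pose f (k k' : nat) : nat := if insub k is Some i then @level_cells K p l base a b i else 0%N.
have -> : (\sum_(k < K) b' k * level_cells p l base a b k = \sum_(k < K) (b' k * f k k))%N.
  by apply: eq_bigr => k _; rewrite /f valK.
apply: le_trans (@level_sum_upper R K f b' p l _) _.
  by move=> k kK; rewrite /f insubT; apply: level_cells_leq.
rewrite lerD2r; apply: ler_wpM2l; first by rewrite mulr_ge0.
exact: partial_sum_lex (best o').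
Qed.

(** c does not depend on K, while C does: N tends to infinity first, K afterwards. *)
Lemma pattern_upper : exists c : R, 0 <= c /\ forall K, exists C : R, forall N, (0 < N)%N ->
  ln (pattern_count X N N)%:R <= ln 2 * (N%:R ^+ 2 * (psum beta K / L%:~R + c * hp K) + C * N%:R) :> R.
Proof.
pose lnQ : R := ln #|{: Q}|%:R.
have ln2 : 0 < ln 2 :> R by rewrite ln_gt0 // ltr1n.
have [q0 _] : exists q0 : Q, True.
  by move: out => [q [c' [run _]]]; exists (bcell (@mfree m) (mdata q c') (fun _ _ => false) 0 0).
have lnQ0 : 0 <= lnQ by rewrite ln_ge0 // ler1n; apply/card_gt0P; exists q0.
exists (2 * lnQ / ln 2); split; first by rewrite divr_ge0 ?mulr_ge0 // ltW.
move=> K; pose g : R := (2 * 2 ^ K).+1%:R.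
pose t1 := #|{: option 'I_K * bool * D * bool}|; pose t2 := #|{: option 'I_K * bool * bool}|.
have t10 : (0 < t1)%N by apply/card_gt0P; exists (None, true, dat (cW q0), true).
have t20 : (0 < t2)%N by apply/card_gt0P; exists (None, true, true).
pose d : R := 2 * n%:~R + 1; pose Lr : R := L%:~R.
have Lr1 : 1 <= Lr by rewrite /Lr ler1z.
have nR : 0 <= n%:~R :> R by rewrite ler0z (le_trans _ n3).
have d0 : 0 <= d by rewrite /d; lra.
have g0 : 0 <= g by rewrite /g ler0n.
exists ((ln Lr + (1 + d + g) * ln t1%:R + (5 + d + g) * ln t2%:R + lnQ * (11 + 9 * d) + ln 2 * (3 + 4 * d + K%:R * (6 + d))) / ln 2).
move=> N N0; rewrite -/Lr; set p := ncols kt N; set l := nrows kt N.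
have N1 : 1 <= N%:R :> R by rewrite ler1n.
have pE : p%:R = N%:R + d :> R.
  by rewrite /p /d pmulrn ncolsE !rmorphD rmorphM /= addrA.
have lE : l%:R <= N%:R / Lr + 3.
  rewrite /l /nrows -addn1 -addnA natrD lerD2r ler_pdivlMr ?(lt_le_trans _ Lr1) //.
  have -> : Lr = (absz L)%:R by rewrite /Lr -[in LHS](gez0_abs (le_trans ler01 L1)).
  by rewrite -natrM ler_nat leq_trunc_div.
have N_0 : (0 < pattern_count X N N)%N.
  apply/card_gt0P; move: out => [q [c' [run _]]].
  have wf := build_wang (@mfree m) (mdata_Rh q c') (mdata_Phi run) (mdata_init run) (fun _ _ => false).
  exists [ffun kh : 'I_N * 'I_N => letter kt 0 (bcell (@mfree m) (mdata q c') (fun _ _ => false)) (Posz kh.1) (Posz kh.2)].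
  rewrite inE; exists (fun kh : int * int => letter kt 0 (bcell (@mfree m) (mdata q c') (fun _ _ => false)) kh.1 kh.2).
    exact: (letter_combined nnH kt 0 wf).
  by exists 0, 0 => k' h'; rewrite ffunE !add0r.
pose B : R := expR (lnQ * (2 * p%:R * l%:R * hp K + p%:R + l%:R) +
        ln 2 * (p%:R * l%:R * psum beta K + K%:R * (p%:R + l%:R + 1))).
have tile_le s : (#|@tile_patterns A H Q hR vR kt N s|)%:R <=
    (t1%:R ^+ (p + 2 * 2 ^ K).+1 * t2%:R ^+ (p + l + 2 * 2 ^ K).+1) * B :> R.
  pose P := ({ffun 'I_(p + 2 * 2 ^ K).+1 -> option 'I_K * bool * D * bool} *
    {ffun 'I_((p + l) + 2 * 2 ^ K).+1 -> option 'I_K * bool * bool})%type.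
  have := @card_cover P _ (@tile_patterns A H Q hR vR kt N s)
    (fun t => @fibre m K p l (p + l) (row_base kt s) (row_base kt s 0) t).
  move=> /(_ _)h; have {h} : (#|@tile_patterns A H Q hR vR kt N s| <=
     \sum_(t : P) #|@fibre m K p l (p + l) (row_base kt s) (row_base kt s 0) t|)%N.
    apply: h => v /asboolP[w wP vE]; have [a [b [b' lw]]] := leveled_exists wP.
    exists (param K p (p + l) (row_base kt s 0) w a b); apply/asboolP.
    by exists w, a, b, b'.
  rewrite -(ler_nat R) natr_sum => /le_trans; apply.
  apply: (@le_trans _ _ (\sum_(t : P) B)).
    by apply: ler_sum => t _; apply: fibre_upper => k kp; apply: row_baseP.
  rewrite sumr_const -[leLHS]mulr_natl ler_wpM2r ?expR_ge0 //.
  by rewrite card_prod !card_ffun !card_ord natrM !natrX.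
have B0 : 0 < B by apply: expR_gt0.
have t1R : 0 < t1%:R :> R by rewrite ltr0n. have t2R : 0 < t2%:R :> R by rewrite ltr0n.
have LR : (absz L)%:R = Lr by rewrite /Lr -[in RHS](gez0_abs (le_trans ler01 L1)).
have tot : (pattern_count X N N)%:R <= Lr * ((t1%:R ^+ (p + 2 * 2 ^ K).+1 * t2%:R ^+ (p + l + 2 * 2 ^ K).+1) * B) :> R.
  have := pattern_count_upper hR vR kt N; rewrite -(ler_nat R) natr_sum => /le_trans; apply.
  apply: le_trans (ler_sum _ (fun s _ => tile_le (Posz (nat_of_ord s)))) _.
  by rewrite sumr_const card_ord -[leLHS]mulr_natl LR.
have Lr0 : 0 < Lr by apply: lt_le_trans Lr1.
have lnt1 : 0 <= ln t1%:R :> R by rewrite ln_ge0 // ler1n.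
have lnt2 : 0 <= ln t2%:R :> R by rewrite ln_ge0 // ler1n.
have lnL : 0 <= ln Lr by rewrite ln_ge0.
have A0 := partial_sum_ge0 R beta K; have A1 := partial_sum_le1 R beta K.
have v0 := half_pow_ge0 R K; have v1 := half_pow_le1 R K.
apply: (@le_trans _ _ (ln Lr + ((p%:R + g) * ln t1%:R + (p%:R + l%:R + g) * ln t2%:R + ln B))).
  have e1R : (p + 2 * 2 ^ K).+1%:R = p%:R + g by rewrite /g -natrD addnS.
  have e2R : (p + l + 2 * 2 ^ K).+1%:R = p%:R + l%:R + g by rewrite /g -!natrD addnS.
  clear tile_le; move: (p + 2 * 2 ^ K).+1 (p + l + 2 * 2 ^ K).+1 e1R e2R tot => e1 e2 <- <- tot.
  have f1 : 0 < t1%:R ^+ e1 :> R by apply: exprn_gt0.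
  have f2 : 0 < t2%:R ^+ e2 :> R by apply: exprn_gt0.
  have f3 : 0 < (pattern_count X N N)%:R :> R by rewrite ltr0n.
  move: (pattern_count X N N) f3 tot => pc f3 tot.
  have := tot; rewrite -ler_ln ?posrE //; last by rewrite !mulr_gt0.
  move/le_trans; apply.
  rewrite lnM ?posrE //; last by rewrite !mulr_gt0.
  rewrite lnM ?posrE //; last by rewrite mulr_gt0.
  by rewrite lnM ?posrE // !lnXn // ![_ * ln _]mulr_natl.
rewrite expRK.
clear tot tile_le B B0 N_0; clearbody p l; clearbody d g Lr t1 t2.
have l0 : 0 <= l%:R :> R by [].
have NL : 0 <= N%:R / Lr <= N%:R.
  by rewrite divr_ge0 ?(ltW Lr0) //= ler_pdivrMr // ler_peMr.
have pl : p%:R * l%:R <= N%:R * (N%:R / Lr) + (3 + 4 * d) * N%:R.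
  rewrite pE; move: (N%:R / Lr) lE NL => y lE /andP[y0 yN].
  apply: (@le_trans _ _ ((N%:R + d) * (y + 3))); first by apply: ler_wpM2l lE; lra.
  nra.
have l4 : l%:R <= 4 * N%:R :> R.
  by case/andP: NL => _ yN; apply: le_trans lE _; lra.
have pl0 : 0 <= p%:R * l%:R :> R by rewrite mulr_ge0.
have pN : p%:R <= (1 + d) * N%:R by rewrite pE; nra.
set C := ln Lr + _ + _ + _ + _.
have -> : ln 2 * (N%:R ^+ 2 * (psum beta K / Lr + 2 * lnQ / ln 2 * hp K) + C / ln 2 * N%:R) =
    ln 2 * (N%:R * (N%:R / Lr) * psum beta K) + lnQ * (2 * N%:R ^+ 2 * hp K) + C * N%:R.
  by field; rewrite !gt_eqF.
rewrite /C; clear C; move: (N%:R / Lr) NL pl {lE pE LR} => y /andP[y0 yN] pl.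
have T1 : ln Lr <= ln Lr * N%:R by rewrite ler_peMr.
have gN : g <= g * N%:R by rewrite ler_peMr.
have T2 : (p%:R + g) * ln t1%:R <= (1 + d + g) * ln t1%:R * N%:R.
  by rewrite mulrAC; apply: ler_wpM2r => //; have := pN; rewrite !mulrDl; lra.
have T3 : (p%:R + l%:R + g) * ln t2%:R <= (5 + d + g) * ln t2%:R * N%:R.
  by rewrite mulrAC; apply: ler_wpM2r => //; have := pN; rewrite !mulrDl; lra.
have T4 : lnQ * (2 * p%:R * l%:R * hp K + p%:R + l%:R) <= lnQ * (2 * N%:R ^+ 2 * hp K) + lnQ * (11 + 9 * d) * N%:R.
  rewrite -[X in _ <= _ + X]mulrA -mulrDr; apply: ler_wpM2l => //; rewrite -[2 * p%:R * l%:R]mulrA.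
  move: (p%:R * l%:R) (hp K) pl pl0 v0 v1 => z v pl z0 v0 v1.
  have h1 : z * v <= (N%:R * y + (3 + 4 * d) * N%:R) * v by apply: ler_wpM2r.
  have h2 : N%:R * y * v <= N%:R ^+ 2 * v by apply: ler_wpM2r => //; nra.
  have h3 : (3 + 4 * d) * N%:R * v <= (3 + 4 * d) * N%:R.
    by rewrite ler_piMr // mulr_ge0 //; lra.
  by rewrite mulrDl in h1; nra.
have T5 : ln 2 * (p%:R * l%:R * psum beta K + K%:R * (p%:R + l%:R + 1)) <=
    ln 2 * (N%:R * y * psum beta K) + ln 2 * (3 + 4 * d + K%:R * (6 + d)) * N%:R.
  rewrite -[X in _ <= _ + X]mulrA -mulrDr; apply: ler_wpM2l; first exact: ltW.
  move: (p%:R * l%:R) (psum beta K) pl pl0 A0 A1 => z a pl z0 a0 a1.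
  have h1 : z * a <= (N%:R * y + (3 + 4 * d) * N%:R) * a by apply: ler_wpM2r.
  have h3 : (3 + 4 * d) * N%:R * a <= (3 + 4 * d) * N%:R.
    by rewrite ler_piMr // mulr_ge0 //; lra.
  have h4 : K%:R * (p%:R + l%:R + 1) <= K%:R * ((6 + d) * N%:R) by apply: ler_wpM2l => //; nra.
  by rewrite mulrDl in h1; rewrite mulrDl -mulrA; lra.
rewrite !mulrDl in T1 T2 T3 T4 T5 *; lra.
Qed.

(** In the tiling built from the best run, the bits of the free crosses in a box are chosen
    independently, and different choices give different letters. *)
Lemma pattern_lower K : exists C : R, forall N, (0 < N)%N ->
  ln 2 * (N%:R ^+ 2 * (psum beta K / L%:~R) - C * N%:R) <= ln (pattern_count X N N)%:R :> R.
Proof.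
have ln2 : 0 < ln 2 :> R by rewrite ln_gt0 // ltr1n.
pose Lr : R := L%:~R; have Lr1 : 1 <= Lr by rewrite /Lr ler1z.
have Lr0 : 0 < Lr by apply: lt_le_trans Lr1.
exists (3 + 2 * K%:R) => N N0; have N1 : 1 <= N%:R :> R by rewrite ler1n.
pose l := (N %/ absz L - 2)%N.
have [q [c [run betaE]]] := out.
pose dd := mdata q c; pose row (x : nat) (t : nat) : int := divz (M * Posz x) L + 1 + Posz t.
pose on (k : nat) (i : 'I_N * 'I_l) := (lev (Posz i.1) == k) && (lev (row i.1 i.2) == k).
pose S : {set 'I_N * 'I_l} := [set i | [exists k : 'I_K, beta k && on k i]].
pose f (B : {set 'I_N * 'I_l}) (x y : int) : bool := [exists i, [&& i \in B, x == Posz i.1 & y == row i.1 i.2]].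
have := @pattern_count_lower A H Q hR vR nnH kt N _ (fun B => bcell (@mfree m) dd (f B)) S id.
have wf B := build_wang (@mfree m) (mdata_Rh q c) (mdata_Phi run) (mdata_init run) (f B).
move=> /(_ wf)low; have {low} : (2 ^ #|S| <= pattern_count X N N)%N.
  apply: low => B B' BS BS' e; apply/setP => i.
  have [iS|niS] := boolP (i \in S); last first.
    by apply/idP/idP => /(fintype.subsetP _ _); [move/(_ _ BS)|move/(_ _ BS')]; rewrite (negbTE niS).
  have fB (B0 : {set 'I_N * 'I_l}) : f B0 (Posz i.1) (row i.1 i.2) = (i \in B0).
    apply/existsP/idP => [[j /and3P[jB /eqP e1 /eqP e2]]|iB]; last by exists i; rewrite iB !eqxx.
    suff -> : i = j by [].
    case: e1 e2 => e1; rewrite /row e1 => /addrI[] e2.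
    by case: (i) (j) e1 e2 => [i1 i2] [j1 j2] /= /val_inj -> /val_inj ->.
  have := e i iS; rewrite /= -/(row _ _) => /(congr1 (@cbit D)).
  rewrite /bcell /cbit /= !fB.
  have : [exists k : 'I_K, beta k && on k i] by move: iS; rewrite inE.
  case/existsP => k /andP[bk /andP[/eqP l1 /eqP l2]].
  rewrite l1 l2 eqxx /= /mfree /dd /mdata /= l1 -betaE bk !andbT.
  exact.
rewrite -(ler_nat R) natrX => h.
have {h} : ln 2 * #|S|%:R <= ln (pattern_count X N N)%:R :> R.
  rewrite mulr_natr -lnXn // ler_ln ?posrE ?exprn_gt0 //.
  by apply: lt_le_trans h; rewrite exprn_gt0.
apply: le_trans; apply: ler_wpM2l; first exact: ltW.
pose g (k : nat) : nat := #|[pred i : 'I_N * 'I_l | on k i]|.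
have SE : (\sum_(k < K) beta k * g k <= #|S|)%N.
  have cE (T : finType) (P : pred T) : #|P| = (\sum_u (P u : nat))%N.
    by rewrite -sum1_card big_mkcond /=; apply: eq_bigr => u _; rewrite unfold_in; case: (P u).
  have -> : #|S| = (\sum_i (i \in S : nat))%N by rewrite -cE; apply: eq_card => i; rewrite unfold_in.
  apply: (@leq_trans (\sum_(k < K) \sum_(i : 'I_N * 'I_l) (beta k && on k i))%N).
    apply: leq_sum => k _; rewrite /g cE big_distrr /=; apply: leq_sum => i _.
    by case: (beta k); case: (on k i).
  rewrite exchange_big /=; apply: leq_sum => i _; rewrite inE.
  case: existsP => [[k kP]|nk].
    rewrite (bigD1 k) //= kP big1 // => k' k'k; apply/eqP; rewrite eqb0; apply/negP => /andP[_ /andP[/eqP h1 _]].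
    by case/andP: kP => _ /andP[/eqP h2 _]; case/eqP: k'k; apply: val_inj; rewrite /= -h1 h2.
  by rewrite big1 // => k _; apply/eqP; rewrite eqb0; apply/negP => kP; apply: nk; exists k.
move: SE; rewrite -(ler_nat R) => SE; apply: le_trans SE.
have := @level_sum_lower R K (fun k _ => g k) beta N l; move=> /(_ _)h; apply: le_trans (h _).
  have lE : N%:R / Lr - 3 <= l%:R.
    have LR : (absz L)%:R = Lr by rewrite /Lr -[in RHS](gez0_abs (le_trans ler01 L1)).
    have : (N <= (l + 3) * absz L)%N.
      rewrite {1}(divn_eq N (absz L)); have := ltn_pmod N (_ : 0 < absz L)%N.
      move=> /(_ _)h3; have {}h3 : (N %% absz L < absz L)%N by apply: h3; lia.
      apply: (@leq_trans ((N %/ absz L).+1 * absz L)%N); first by rewrite mulSn addnC leq_add2r ltnW.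
      by rewrite leq_mul2r; apply/orP; right; rewrite /l; lia.
    by rewrite -(ler_nat R) natrM natrD LR lerBlDr ler_pdivrMr.
  have l0 : 0 <= l%:R :> R by [].
  have lN : l%:R <= N%:R :> R by rewrite ler_nat /l; apply: leq_trans (leq_subr _ _) (leq_div _ _).
  rewrite -/Lr; have -> : N%:R ^+ 2 * (psum beta K / Lr) = N%:R * (N%:R / Lr) * psum beta K by ring.
  have A0 := partial_sum_ge0 R beta K; have A1 := partial_sum_le1 R beta K.
  move: (N%:R / Lr) (psum beta K) lE A0 A1 => y a lE a0 a1.
  have h1 : N%:R * (y - 3) * a <= N%:R * l%:R * a by rewrite ler_wpM2r // ler_wpM2l.
  have h2 : K%:R * (N%:R + l%:R) <= K%:R * (2 * N%:R) :> R by apply: ler_wpM2l => //; lra.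
  have h4 : N%:R * a <= N%:R by rewrite ler_piMr.
  rewrite mulrBr mulrBl in h1; rewrite mulrDl; lra.
move=> k kK; have [e [ke _]] := lev_exists k 0.
pose lv (x : int) : bool := lev x == k.
pose dv (y0 : int) (t : nat) : nat := dvdz (Posz (2 ^ k.+1)%N) (y0 - e + Posz t).
have cnt (y0 : int) t : (dv y0 t <= lv (y0 + Posz t)%R)%N.
  rewrite /dv; have [/dvdzP[z zE]|//] := boolP (dvdz _ _); rewrite lt0b /lv.
  have -> : y0 + Posz t = e + 2 * pow2 k * z.
    by rewrite -pow2S /pow2 mulrC -zE; ring.
  by rewrite (lev_shift z ke).
set G := (2 ^ k.+1)%N in dv cnt *; have G0 : (0 < G)%N by rewrite expn_gt0.
have cntS (y0 : int) l' : (l' <= (\sum_(t < l') lv (y0 + Posz t)%R) * G + G)%N.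
  have [_ h1] := count_multiples (y0 - e) l' G0; apply: leq_trans h1 _.
  by rewrite leq_add2r leq_mul2r; apply/orP; right; apply: leq_sum => t _; apply: cnt.
(* The second number bounds from below the count in every column, wherever its rows begin. *)
exists (\sum_(x < N) lv (0 + Posz x)%R)%N, ((l - 1) %/ G)%N; split; last 2 first.
- exact: cntS.
- have := ltn_pmod (l - 1) G0; have := divn_eq (l - 1) G.
  by move: (_ %/ _)%N (_ %% _)%N => a b; lia.
have -> : g k = (\sum_(x < N) \sum_(t < l) lv (Posz x) * lv (row x t))%N.
  rewrite /g -sum1_card big_mkcond /= pair_bigA /=; apply: eq_bigr => -[x t] _.
  by rewrite inE /on /lv /=; case: (_ == _); case: (_ == _).
rewrite big_distrl /=; apply: leq_sum => x _; rewrite add0r -big_distrr /= leq_mul2l; apply/orP; right.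
have := cntS (divz (M * Posz x) L + 1)%R l; rewrite -/(row x _).
move: (\sum_(t < l) _)%N => s h1; rewrite leqNgt; apply/negP => h2.
have : (s.+1 * G <= (l - 1) %/ G * G)%N by rewrite leq_mul2r h2 orbT.
have := leq_trunc_div (l - 1) G; rewrite mulSn; move: (_ %/ _ * _)%N => u h3 h4.
have l1 : (0 < l)%N by case: (l) h2 => //; rewrite div0n.
by lia.
Qed.

End EntropyBounds.

(** * The entropy *)

Section EntropyValue.
Local Open Scope ring_scope.
Local Open Scope classical_set_scope.
Variables (R : realType) (beta : nat -> bool).
Notation psum := (@partial_sum R).
Notation hp := (@half_pow R).

Lemma partial_sum_limit : exists alpha : R,
  forall K, psum beta K <= alpha <= psum beta K + hp K ^+ 2 / 3.
Proof.
pose S := [set psum beta K | K in [set: nat]].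
have ub K : ubound S (psum beta K + hp K ^+ 2 / 3).
  move=> _ [K' _ <-]; have h := sqr_ge0 (hp K); have h' := sqr_ge0 (hp K').
  have [KK|/ltnW KK] := leqP K K'.
    by have /andP[_] := partial_sum_tail R beta KK; lra.
  by have /andP[+ _] := partial_sum_tail R beta KK; lra.
exists (sup S) => K; apply/andP; split.
  by apply: ub_le_sup; [exists (psum beta 0 + hp 0 ^+ 2 / 3); apply: ub|exists K].
by apply: ge_sup; [exists (psum beta 0), 0%N|apply: ub].
Qed.

Lemma half_pow_small (c e : R) : 0 <= c -> 0 < e -> exists K, c * hp K <= e.
Proof.
move=> c0 e0; exists (Num.bound (c / e)); rewrite /half_pow ler_pdivrMr ?exprn_gt0 //.
by rewrite mulrC -ler_pdivrMr // ltW // upper_nthrootP.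
Qed.

Lemma entropy_value (A : finType) (X : set (int * int -> A)) (alpha Lr c : R) :
  1 <= Lr -> 0 <= c -> (forall K, psum beta K <= alpha <= psum beta K + hp K ^+ 2 / 3) ->
  (forall K, exists C : R, forall N, (0 < N)%N ->
    ln (pattern_count X N N)%:R <= ln 2 * (N%:R ^+ 2 * (psum beta K / Lr + c * hp K) + C * N%:R) :> R) ->
  (forall K, exists C : R, forall N, (0 < N)%N ->
    ln 2 * (N%:R ^+ 2 * (psum beta K / Lr) - C * N%:R) <= ln (pattern_count X N N)%:R :> R) ->
  entropy X R = alpha / Lr.
Proof.
move=> Lr1 c0 aP up low; have Lr0 : 0 < Lr by apply: lt_le_trans Lr1.
have ln2 : 0 < ln 2 :> R by rewrite ln_gt0 // ltr1n.
apply/cvg_lim; first exact: norm_hausdorff.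
apply/cvgrPdist_le => e e0.
have e20 : 0 < e / 2 by rewrite divr_gt0.
have [K Ke] := half_pow_small (addr_ge0 c0 ler01) e20.
have [C1 upK] := up K; have [C2 lowK] := low K; pose C := `|C1| + `|C2|.
have C0 : 0 <= C by rewrite addr_ge0.
exists (Num.bound (2 * C / e)).+1 => // N /= NP; have N0 : (0 < N)%N by apply: leq_trans NP.
have N1 : 0 < N%:R :> R by rewrite ltr0n.
have NC : C / N%:R <= e / 2.
  rewrite ler_pdivrMr //; have : 2 * C / e <= N%:R.
    by apply/ltW/(lt_le_trans (archi_boundP _)); [rewrite divr_ge0 ?mulr_ge0 // ltW|rewrite ler_nat ltnW].
  by rewrite ler_pdivrMr //; lra.
have {}upK := upK N N0; have {}lowK := lowK N N0.
set q := ln _ in upK lowK *; set x := q / ln 2 / N%:R ^+ 2.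
have qE : q = ln 2 * (N%:R ^+ 2 * x) by rewrite /x; field; rewrite !gt_eqF.
rewrite qE !ler_pM2l // in upK lowK.
have C1C : C1 <= C by rewrite /C; have := ler_norm C1; have := normr_ge0 C2; lra.
have C2C : C2 <= C by rewrite /C; have := ler_norm C2; have := normr_ge0 C1; lra.
have N2 : 0 < N%:R ^+ 2 :> R by rewrite exprn_gt0.
have {}upK : x <= psum beta K / Lr + c * hp K + C / N%:R.
  rewrite -(ler_pM2l N2); apply: le_trans upK _.
  have -> : N%:R ^+ 2 * (psum beta K / Lr + c * hp K + C / N%:R) = N%:R ^+ 2 * (psum beta K / Lr + c * hp K) + C * N%:R.
    by field; rewrite !gt_eqF.
  by rewrite lerD2l ler_wpM2r // ltW.
have {}lowK : psum beta K / Lr - C / N%:R <= x.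
  rewrite -(ler_pM2l N2); apply: le_trans lowK.
  have -> : N%:R ^+ 2 * (psum beta K / Lr - C / N%:R) = N%:R ^+ 2 * (psum beta K / Lr) - C * N%:R.
    by field; rewrite !gt_eqF.
  by rewrite lerD2l lerN2 ler_wpM2r // ltW.
have /andP[a1 a2] := aP K; have v0 := half_pow_ge0 R K; have v1 := half_pow_le1 R K.
have v2 : hp K ^+ 2 / 3 <= hp K by nra.
have b1 : psum beta K / Lr <= alpha / Lr by rewrite ler_pM2r ?invr_gt0.
have b2 : alpha / Lr <= psum beta K / Lr + hp K.
  rewrite ler_pdivrMr // mulrDl divfK ?gt_eqF //.
  have : hp K <= hp K * Lr by rewrite ler_peMr.
  by lra.
have e1 : c * hp K + hp K <= e / 2 by move: Ke; rewrite mulrDl mul1r.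
have v3 : 0 <= c * hp K by rewrite mulr_ge0.
by rewrite ler_norml; apply/andP; split; lra.
Qed.

(** The integer part of 4^(k+1) alpha. *)
Fixpoint digits (k : nat) : nat := if k is j.+1 then (4 * digits j + beta k)%N else beta 0%N.

Lemma digits_mod k : (digits k %% 4)%N = beta k.
Proof.
have small (b : bool) : (b %% 4)%N = b by case: b.
by case: k => [|k]; rewrite /= ?small // mulnC modnMDl small.
Qed.

Lemma digitsE k : (digits k)%:R = psum beta k.+1 * 4 ^+ k.+1 :> R.
Proof.
have h4 j : hp j ^+ 2 * 4 ^+ j = 1.
  rewrite /half_pow -exprVn -exprM mulnC exprM -exprMn.
  by rewrite (_ : 2^-1 ^+ 2 * 4 = 1 :> R) ?expr1n //; field.
elim: k => [|k IH].
  by rewrite /partial_sum big_ord1 -mulrA h4 mulr1.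
by rewrite partial_sumS mulrDl -[_ * hp _ ^+ 2 * _]mulrA h4 mulr1 [4 ^+ _]exprS mulrCA -IH natrD natrM.
Qed.

(** 4^(k+1) alpha exceeds the integer [digits k] by at most 1/3. An approximation up to 1/4,
    increased by 1/3, therefore has [digits k] as its integer part. *)
Lemma computable_digits (alpha : R) (l : nat) : (0 < l)%N ->
  (forall K, psum beta K <= alpha <= psum beta K + hp K ^+ 2 / 3) ->
  computable_real (alpha / l%:R) -> computable_function (fun k => nat_of_bool (beta k)).
Proof.
move=> l0 aP [s [a [b [cs ca cb b0 approx]]]].
(* Precision: 4^(k+1) l 2^-(n k) = l / (4 * 2^l) is at most 1/4. *)
pose n k := (2 * k + (4 + l))%N.
(* Negative approximations are replaced by 0; they occur only if [digits k] is 0. *)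
pose a' j := (a j * ((s j).+1 %% 2))%N.
have fE k : nat_of_bool (beta k) = (((3 * 4 ^ k.+1 * l * a' (n k) + b (n k)) %/ (3 * b (n k))) %% 4)%N.
  rewrite -digits_mod; congr (_ %% 4)%N.
  have bn : (0 < b (n k))%N by rewrite lt0n.
  have bR : 0 < (b (n k))%:R :> R by rewrite ltr0n.
  have lR : 0 < l%:R :> R by rewrite ltr0n.
  have T0 : 0 < 4 ^+ k.+1 :> R by rewrite exprn_gt0.
  pose r : R := (a' (n k))%:R / (b (n k))%:R.
  pose r0 : R := (-1) ^+ s (n k) * (a (n k))%:R / (b (n k))%:R.
  pose T : R := 4 ^+ k.+1 * l%:R.
  have Tp : 0 < T by rewrite mulr_gt0.
  have T1 : T * 2 ^- n k <= 4^-1.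
    have -> : T * 2 ^- n k = l%:R / (4 * 2 ^+ l).
      have -> : 2 ^+ n k = 4 ^+ k * (16 * 2 ^+ l) :> R.
        rewrite /n exprD exprM [2 ^+ (4 + l)]exprD; congr (_ ^+ k * (_ * _)); by rewrite -natrX.
      rewrite /T exprS.
      by field; rewrite !expf_neq0 // pnatr_eq0.
    rewrite ler_pdivrMr ?mulr_gt0 ?exprn_gt0 // mulKf ?pnatr_eq0 //.
    by rewrite -natrX ler_nat ltnW // ltn_expl.
  have TD : `|T * r0 - 4 ^+ k.+1 * alpha| <= 4^-1.
    have -> : T * r0 - 4 ^+ k.+1 * alpha = T * (r0 - alpha / l%:R).
      by rewrite /T; field; rewrite gt_eqF.
    rewrite normrM (gtr0_norm Tp); apply: le_trans T1; apply: ler_wpM2l; first exact: ltW.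
    exact: approx.
  have /andP[d1 d2] := aP k.+1.
  have e1 : (digits k)%:R <= 4 ^+ k.+1 * alpha by rewrite digitsE mulrC ler_wpM2l // ltW.
  have e2 : 4 ^+ k.+1 * alpha <= (digits k)%:R + 3^-1.
    have h4 : hp k.+1 ^+ 2 * 4 ^+ k.+1 = 1.
      rewrite /half_pow -exprVn -exprM mulnC exprM -exprMn.
      by rewrite (_ : 2^-1 ^+ 2 * 4 = 1 :> R) ?expr1n //; field.
    rewrite digitsE; have := ler_wpM2l (ltW T0) d2.
    rewrite mulrDr; have -> : 4 ^+ k.+1 * (hp k.+1 ^+ 2 / 3) = 3^-1.
      by rewrite mulrA [4 ^+ _ * _]mulrC h4 mul1r.
    by rewrite [4 ^+ _ * psum _ _]mulrC.
  have /andP[d3 d4] : - 4^-1 <= T * r0 - 4 ^+ k.+1 * alpha <= 4^-1 by rewrite -ler_norml.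
  have [f1 f2] : (digits k)%:R - 3^-1 <= T * r /\ T * r < (digits k)%:R + 2 / 3.
    have [odd_s|even_s] := boolP (odd (s (n k))).
      have rE : r = 0.
        by rewrite /r /a' modn2 /= odd_s muln0 mul0r.
      have r00 : T * r0 <= 0.
        by rewrite /r0 -signr_odd odd_s expr1 !mulN1r mulNr mulrN oppr_le0; apply: mulr_ge0; [exact: ltW|exact: divr_ge0].
      have : ((digits k)%:R : R) < 1 by lra.
      by rewrite -[1]/(1%:R) ltr_nat ltnS leqn0 => /eqP ->; rewrite rE; lra.
    have rE : r = r0.
      by rewrite /r /r0 /a' -signr_odd modn2 /= (negbTE even_s) expr0 mul1r muln1.
    by rewrite rE; lra.
  rewrite /r in f1 f2; clear r; move: (a' (n k)) f1 f2 => aa f1 f2.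
  apply/esym/eqP; rewrite eqn_leq; apply/andP; split.
    rewrite -ltnS ltn_divLR ?muln_gt0 // -(ltr_nat R) natrD !natrM natrX.
    have : T * (aa%:R / (b (n k))%:R) * (3 * (b (n k))%:R) < ((digits k)%:R + 2 / 3) * (3 * (b (n k))%:R).
      by rewrite ltr_pM2r // mulr_gt0.
    have -> : T * (aa%:R / (b (n k))%:R) * (3 * (b (n k))%:R) = 3 * 4 ^+ k.+1 * l%:R * aa%:R.
      by rewrite /T; field; rewrite gt_eqF.
    by rewrite -[(digits k).+1%:R]natr1; move: (3 * 4 ^+ k.+1 * _ * _) (digits k)%:R (b (n k))%:R => u d y; nra.
  rewrite leq_divRL ?muln_gt0 // -(ler_nat R) natrD !natrM natrX.
  have : ((digits k)%:R - 3^-1) * (3 * (b (n k))%:R) <= T * (aa%:R / (b (n k))%:R) * (3 * (b (n k))%:R).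
    by rewrite ler_pM2r // mulr_gt0.
  have -> : T * (aa%:R / (b (n k))%:R) * (3 * (b (n k))%:R) = 3 * 4 ^+ k.+1 * l%:R * aa%:R.
    by rewrite /T; field; rewrite gt_eqF.
  by move: (3 * 4 ^+ k.+1 * _ * _) (digits k)%:R (b (n k))%:R => u d y; nra.
apply/recf_computable; apply: recf_ext (fun v _ => esym (fE (nth 0%N v 0))) _.
have rn : recf 1 (fun v => n (nth 0%N v 0)).
  by apply: recf_add; [apply: recf_mul; [apply: recf_const|apply: recf_var]|apply: recf_const].
have ra : recf 1 (fun v => a' (n (nth 0%N v 0))).
  apply: recf_mul; first exact: computable_app ca rn.
  by apply: recf_mod; [apply: recf_S; apply: computable_app cs rn|apply: recf_const].
have rb := computable_app cb rn.
apply: recf_mod; last exact: recf_const.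
apply: recf_div; last by apply: recf_mul => //; apply: recf_const.
apply: recf_add => //; apply: recf_mul => //; apply: recf_mul; last exact: recf_const.
apply: recf_mul; first exact: recf_const.
by apply: recf_exp; [apply: recf_const|apply: recf_S; apply: recf_var].
Qed.

End EntropyValue.

Local Open Scope classical_set_scope.
Local Open Scope ring_scope.

Theorem proposition6p1 (R : realType) (A : finType) (H : set (int -> A))
    (hH : is_nearest_neighbor H) (hD : ~ condition_D (rauzy_graph H)) :
  exists V : set (int -> A),
    [/\ is_sft V,
        combined_subshift H V !=set0 &
        ~ computable_real (entropy (combined_subshift H V) R)].
Proof.
have [m [beta [out best nc]]] := machine_exists.
have [kt] := rauzy_kit (cell (datum m)) hD.
pose hR := cell_h (@mRh m) (@mPhi m) (@minit m) (@mfree m).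
pose vR := cell_v (@mRh m) (@mPhi m) (@minit m) (@mfree m).
exists (column_shift kt hR vR); split; first exact: column_shift_sft.
  have [q [c [run _]]] := out.
  have wf := build_wang (@mfree m) (mdata_Rh q c) (mdata_Phi run) (mdata_init run) (fun _ _ => false).
  by eexists; apply: (letter_combined hH kt 0%R wf).
have [alpha aP] := partial_sum_limit R beta.
have [c [c0 up]] := pattern_upper R hH kt out best.
have low := pattern_lower R hH kt out.
have L1 : (1 <= kM kt * kn kt)%R.
  have M0 := kM0 kt; have n0 : (0 < kn kt)%R by have := kcut0 kt; have := kcutn kt; lia.
  by have := mulr_gt0 M0 n0.
have lE : ((absz (kM kt * kn kt)%R)%:R = (kM kt * kn kt)%:~R :> R)%R.
  by rewrite -[in RHS](gez0_abs (le_trans ler01 L1)).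
have Lr1 : (1 <= (kM kt * kn kt)%:~R :> R)%R by rewrite ler1z.
rewrite (entropy_value Lr1 c0 aP up low) -lE => cr; apply: nc.
by apply: computable_digits aP cr; lia.
Qed.
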